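(* Let $q:(0,\infty)\to(0,\infty)$ be an increasing function with $\lim_{x\to\infty}q(x)=\infty$. Then there exist $g\in H^\infty(\mathbb{D})$ such that $g(\mathbb{D})\cap\mathbb{D}=\varnothing$, the boundary function of $g$ is $C^\infty$ on $\mathbb{T}$, and for $z\in\mathbb{T}$ one has $|g(z)|=1$ if and only if $z=1$, together with a non-zero $f\in H^2(\mathbb{D})$, such that the inequality $\|(T_g^* )^nf\|<q(n)$ holds for infinitely many $n\in\mathbb{N}$.
   Context: $\mathbb{D}$ is the open unit disk, $\mathbb{T}$ the unit circle; $H^\infty$ functions are identified with their boundary values on $\mathbb{T}$. $H^2(\mathbb{D})\subseteq L^2(\mathbb{T})$; for $g\in L^\infty(\mathbb{T})$, $T_g=PM_g$ with $M_g$ multiplication by $g$ and $P$ the orthogonal projection of $L^2(\mathbb{T})$ onto $H^2(\mathbb{D})$; $T_g^*$ is the Hilbert space adjoint. *)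

(* Defs.v *)
From Stdlib Require Import Reals.
From Coquelicot Require Import Coquelicot.
Open Scope R_scope.

Definition expi (t : R) : C := (cos t, sin t).

Definition in_disk (z : C) : Prop := Cmod z < 1.

Definition Hinf_with_coeffs (g : C -> C) (a : nat -> C) : Prop :=
  (forall z, in_disk z -> is_pseries a z (g z)) /\
  (exists M : R, forall z, in_disk z -> Cmod (g z) <= M).

Definition boundary_fun (g : C -> C) (gb : R -> C) : Prop :=
  forall t : R,
    filterlim (fun r : R => g (Cmult (RtoC r) (expi t))) (at_left 1) (locally (gb t)).

(* a function R -> C (i.e. a function on T via t |-> e^{it}) is C^oo *)
Definition smooth_RC (h : R -> C) : Prop :=
  forall (n : nat) (t : R),
    ex_derive_n (fun s => fst (h s)) n t /\ ex_derive_n (fun s => snd (h s)) n t.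

(* H^2(D), identified with the sequences of Taylor coefficients (equivalently,
   Fourier coefficients of the boundary function in L^2(T)) that are square summable *)
Definition inH2 (f : nat -> C) : Prop := ex_series (fun k => (Cmod (f k)) ^ 2).

Definition H2norm (f : nat -> C) : R := sqrt (Series (fun k => (Cmod (f k)) ^ 2)).

Definition H2inner (f h : nat -> C) : C :=
  (Series (fun k => fst (Cmult (f k) (Cconj (h k)))),
   Series (fun k => snd (Cmult (f k) (Cconj (h k))))).

(* Toeplitz operator T_g = P M_g for g in H^oo with Taylor coefficients a:
   since g f is already in H^2, P (g f) = g f, whose Taylor coefficients are the
   Cauchy product of a and f. *)
Definition toeplitz (a : nat -> C) (f : nat -> C) : nat -> C :=
  fun j => sum_n (fun k => Cmult (a k) (f (j - k)%nat)) j.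

Definition is_adjoint (T A : (nat -> C) -> (nat -> C)) : Prop :=
  forall h, inH2 h -> inH2 (A h) /\
    forall f, inH2 f -> H2inner (T f) h = H2inner f (A h).

(* Main.v *)
Require Import Defs.
From Stdlib Require Import Reals.
From Coquelicot Require Import Coquelicot.
From Stdlib Require Import Arith Lra Lia Psatz FunctionalExtensionality ClassicalEpsilon.
Open Scope R_scope.

(** If [P psi] is the analytic projection of a density [psi] on the circle, then
    [T_g^* P psi = P (conj g psi)], so that [|T_g^{*n} P psi| <= | |g|^n psi |]: when [psi] is
    supported in an arc around [1] on which [log |g| <= 1/n], applying [T_g^{*n}] costs at most a
    factor [e].  Projections of densities supported in an arbitrarily small arc are dense in [H^2].
    Hence one can choose inductively densities [psi_j] supported in arcs shrinking to [1] and times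
    [n_j] with [q(n_j) > e |psi_j| + 1], such that [|P psi_{j+1} - P psi_j|] is less than
    [e^{-n_j} 2^{-j-1}]; the limit [f] of [P psi_j] is at distance at most [e^{-n_j}] of [P psi_j].
    Only afterwards is [g = exp h] chosen: [Re h] is a series of smooth bumps vanishing on smaller
    and smaller arcs, with weights so small that [Re h <= 1/n_j] on the support of [psi_j] and that
    [|T_g^*| <= e].  Then [|T_g^{*n_j} f| <= e |psi_j| + 1 < q(n_j)].
    All Taylor coefficients can be taken real. *)

(** * Finite sums, series and C^k functions *)

(** The orbit cannot be estimated on [f] itself: multiplication by [conj g] leaves H^2, and
    projecting back destroys any localisation near 1. A density, on the other hand, keeps its
    support under multiplication, so the projection is taken only once, after all factors have been
    absorbed. The price is that nothing controls the size of [psi_j] as the arcs shrink; divergence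
    of [q] allows [n_j] to be chosen after [psi_j]. Fixing [f] before [g] is consistent because the
    errors see [g] only through the a priori bound e on the adjoint, while the flatness of [g] at 1
    may depend on all [n_j]. This bound comes from Taylor coefficients: the exponential of a series
    of l1 norm at most 1 has l1 norm at most e. Absolute summability also gives the boundary values,
    by Abel's theorem. The bumps are functions of [cos t], hence even, which is why real
    coefficients suffice. Their Poisson extensions are nonnegative, so Re h >= 0 inside the disk,
    and |g| = exp (Re h) >= 1 there. *)

Lemma sum_n_0 (a : nat -> R) : sum_n a 0 = a 0%nat :> R.
Proof. exact (sum_O (G := R_AbelianMonoid) a). Qed.

Lemma sum_n_succ (a : nat -> R) (n : nat) : sum_n a (S n) = sum_n a n + a (S n) :> R.
Proof. exact (sum_Sn (G := R_AbelianMonoid) a n). Qed.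

Lemma sum_n_Rext (a b : nat -> R) (n : nat) :
  (forall k, a k = b k) -> sum_n a n = sum_n b n :> R.
Proof. intros H; apply (sum_n_ext (G := R_AbelianMonoid)); auto. Qed.

Lemma sum_n_Rext_loc (a b : nat -> R) (n : nat) :
  (forall k, (k <= n)%nat -> a k = b k) -> sum_n a n = sum_n b n :> R.
Proof. intros H; apply (sum_n_ext_loc (G := R_AbelianMonoid)); auto. Qed.

Lemma sum_n_le_compat (a b : nat -> R) (n : nat) :
  (forall k, (k <= n)%nat -> a k <= b k) -> sum_n a n <= sum_n b n.
Proof.
  induction n as [|n IH]; intros H.
  - rewrite !sum_n_0; auto.
  - rewrite !sum_n_succ; apply Rplus_le_compat; auto.
Qed.

Lemma sum_n_nonneg (a : nat -> R) (n : nat) : (forall k, 0 <= a k) -> 0 <= sum_n a n.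
Proof.
  intros H; induction n as [|n IH].
  - rewrite sum_n_0; apply H.
  - rewrite sum_n_succ; specialize (H (S n)); lra.
Qed.

Lemma sum_n_scal (c : R) (a : nat -> R) (n : nat) :
  sum_n (fun k => c * a k) n = c * sum_n a n :> R.
Proof. apply (sum_n_mult_l (K := R_Ring)). Qed.

Lemma sum_n_add (a b : nat -> R) (n : nat) :
  sum_n (fun k => a k + b k) n = sum_n a n + sum_n b n :> R.
Proof. apply (sum_n_plus (G := R_AbelianMonoid)). Qed.

Lemma Rabs_sum_n_le (a : nat -> R) (n : nat) :
  Rabs (sum_n a n) <= sum_n (fun k => Rabs (a k)) n.
Proof.
  induction n as [|n IH].
  - rewrite !sum_n_0; lra.
  - rewrite !sum_n_succ; pose proof (Rabs_triang (sum_n a n) (a (S n))); lra.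
Qed.

Lemma sum_n_term_le (a : nat -> R) (n k : nat) :
  (forall i, 0 <= a i) -> (k <= n)%nat -> a k <= sum_n a n.
Proof.
  intros H; induction n as [|n IH]; intros Hk.
  - replace k with 0%nat by lia; rewrite sum_n_0; lra.
  - rewrite sum_n_succ; destruct (Nat.eq_dec k (S n)) as [->|Hne].
    + assert (0 <= sum_n a n) by (apply sum_n_nonneg; auto); lra.
    + assert (a k <= sum_n a n) by (apply IH; lia); specialize (H (S n)); lra.
Qed.

Lemma sum_n_mono (a : nat -> R) (m n : nat) :
  (forall i, 0 <= a i) -> (m <= n)%nat -> sum_n a m <= sum_n a n.
Proof.
  intros H Hmn; induction Hmn; [lra|rewrite sum_n_succ; specialize (H (S m0)); lra].
Qed.

Lemma is_series_partial_sums (a : nat -> R) (l : R) :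
  is_series a l <-> is_lim_seq (sum_n a) l.
Proof. split; intros H; exact H. Qed.

Lemma nonneg_series_bounded (a : nat -> R) (M : R) :
  (forall n, 0 <= a n) -> (forall n, sum_n a n <= M) -> ex_series a /\ Series a <= M.
Proof.
  intros Ha HM.
  assert (Hex : ex_finite_lim_seq (sum_n a)).
  { apply ex_finite_lim_seq_incr with M; auto.
    intros n; rewrite sum_n_succ; specialize (Ha (S n)); lra. }
  destruct Hex as [l Hl]; split; [exists l; exact Hl|].
  rewrite (is_series_unique a l Hl).
  apply (is_lim_seq_le (sum_n a) (fun _ => M) l M HM Hl (is_lim_seq_const M)).
Qed.

Lemma sum_n_le_Series (a : nat -> R) (n : nat) :
  (forall k, 0 <= a k) -> ex_series a -> sum_n a n <= Series a.
Proof.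
  intros Ha Hex.
  apply (is_lim_seq_incr_compare (sum_n a) (Series a)).
  - apply Series_correct, Hex.
  - intros k; rewrite sum_n_succ; specialize (Ha (S k)); lra.
Qed.

Lemma ex_series_Rscal (c : R) (a : nat -> R) : ex_series a -> ex_series (fun n => c * a n).
Proof. exact (ex_series_scal (V := R_NormedModule) c a). Qed.

Lemma ex_series_Rplus (a b : nat -> R) :
  ex_series a -> ex_series b -> ex_series (fun n => a n + b n).
Proof. exact (ex_series_plus (V := R_NormedModule) a b). Qed.

Lemma ex_series_Rminus (a b : nat -> R) :
  ex_series a -> ex_series b -> ex_series (fun n => a n - b n).
Proof. exact (ex_series_minus (V := R_NormedModule) a b). Qed.

Lemma ex_series_abs_le (a b : nat -> R) :
  (forall n, Rabs (a n) <= b n) -> ex_series b -> ex_series (fun n => Rabs (a n)).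
Proof.
  intros H Hb; apply (ex_series_le (K := R_AbsRing) (V := R_CompleteNormedModule) _ b); auto.
  intros n; change (Rabs (Rabs (a n)) <= b n); rewrite Rabs_Rabsolu; auto.
Qed.

Lemma ex_series_dominated (a b : nat -> R) :
  (forall n, Rabs (a n) <= b n) -> ex_series b -> ex_series a.
Proof. intros H Hb; apply ex_series_Rabs, (ex_series_abs_le a b); auto. Qed.

Lemma Rabs_Series_le (a b : nat -> R) :
  (forall n, Rabs (a n) <= b n) -> ex_series b -> Rabs (Series a) <= Series b.
Proof.
  intros H Hb.
  eapply Rle_trans; [apply Series_Rabs, (ex_series_abs_le a b); auto|].
  apply Series_le; auto; intros n; split; [apply Rabs_pos|auto].
Qed.

Lemma tail_tends_0 (a : nat -> R) :
  ex_series a -> is_lim_seq (fun n => Series a - sum_n a n) 0.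
Proof.
  intros H; replace (Finite 0) with (Rbar_minus (Series a) (Series a))
    by (simpl; f_equal; ring).
  apply is_lim_seq_minus'; [apply is_lim_seq_const|apply Series_correct, H].
Qed.

Lemma Series_tail_bound (a b : nat -> R) (N : nat) :
  (forall n, Rabs (a n) <= b n) -> ex_series b ->
  Rabs (Series a - sum_n a N) <= Series b - sum_n b N.
Proof.
  intros H Hb.
  assert (Ha : ex_series a) by (apply (ex_series_dominated a b); auto).
  rewrite (Series_incr_n a (S N)), (Series_incr_n b (S N)); auto; try lia.
  rewrite <- !sum_n_Reals; simpl pred.
  replace (sum_n a N + Series (fun k => a (S N + k)%nat) - sum_n a N)
    with (Series (fun k => a (S N + k)%nat)) by ring.
  replace (sum_n b N + Series (fun k => b (S N + k)%nat) - sum_n b N)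
    with (Series (fun k => b (S N + k)%nat)) by ring.
  apply Rabs_Series_le; [intros n; apply H|].
  apply (ex_series_incr_n b (S N)), Hb.
Qed.

Lemma is_lim_seq_squeeze_0 (u v : nat -> R) (l : R) :
  (forall n, Rabs (u n - l) <= v n) -> is_lim_seq v 0 -> is_lim_seq u l.
Proof.
  intros H Hv.
  apply (is_lim_seq_le_le (fun n => l - v n) u (fun n => l + v n)).
  - intros n; specialize (H n); apply Rabs_le_between in H; lra.
  - replace (Finite l) with (Finite (l - 0)) by (f_equal; ring).
    apply is_lim_seq_minus'; [apply is_lim_seq_const|exact Hv].
  - replace (Finite l) with (Finite (l + 0)) by (f_equal; ring).
    apply is_lim_seq_plus'; [apply is_lim_seq_const|exact Hv].
Qed.

(** Turns differentiation under a sum into the summation of quadratic remainders; it also settles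
    the derivative of the bump at 0. *)
Lemma is_derive_quadratic (f : R -> R) (x l c : R) :
  (forall y, Rabs (f y - f x - l * (y - x)) <= c * (y - x) ^ 2) -> is_derive f x l.
Proof.
  intros H; apply is_derive_Reals; intros eps Heps.
  assert (Hd : 0 < eps / (Rabs c + 1)).
  { apply Rdiv_lt_0_compat; [lra|]; pose proof (Rabs_pos c); lra. }
  exists (mkposreal _ Hd); intros h Hh Hlt; simpl in Hlt.
  specialize (H (x + h)); replace (x + h - x) with h in H by ring.
  replace ((f (x + h) - f x) / h - l) with ((f (x + h) - f x - l * h) / h) by (field; auto).
  assert (Hp : 0 < Rabs h) by (apply Rabs_pos_lt; auto).
  unfold Rdiv; rewrite Rabs_mult, Rabs_inv.
  apply Rmult_lt_reg_r with (Rabs h); auto.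
  rewrite Rmult_assoc, Rinv_l, Rmult_1_r by lra.
  apply Rle_lt_trans with (1 := H).
  rewrite <- (pow2_abs h).
  assert (Rabs h * (Rabs c + 1) < eps).
  { apply Rmult_lt_compat_r with (r := Rabs c + 1) in Hlt; [|pose proof (Rabs_pos c); lra].
    unfold Rdiv in Hlt; rewrite Rmult_assoc, Rinv_l, Rmult_1_r in Hlt; auto.
    pose proof (Rabs_pos c); lra. }
  pose proof (Rle_abs c); nra.
Qed.

(** Each level carries a derivative, defined everywhere, as a witness. Closure under sums and
    products is then an induction on [n], and [Ck_ex_derive_n] translates back to iterated
    derivatives. *)
Fixpoint Ck (n : nat) (f : R -> R) : Prop :=
  match n with
  | O => True
  | S m => exists f' : R -> R, (forall t, is_derive f t (f' t)) /\ Ck m f'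
  end.

Lemma Ck_pred (n : nat) : forall f, Ck (S n) f -> Ck n f.
Proof.
  induction n as [|n IH]; intros f; [easy|].
  intros [f' [H1 H2]]; exists f'; split; auto.
Qed.

Lemma Ck_const (n : nat) (c : R) : Ck n (fun _ => c).
Proof.
  revert c; induction n as [|n IH]; intros c; [easy|].
  exists (fun _ => 0); split; auto; intros t; exact (is_derive_const (V := R_NormedModule) c t).
Qed.

Lemma Ck_plus (n : nat) : forall f g, Ck n f -> Ck n g -> Ck n (fun t => f t + g t).
Proof.
  induction n as [|n IH]; intros f g; [easy|].
  intros [f' [Hf Cf]] [g' [Hg Cg]]; exists (fun t => f' t + g' t); split; auto.
  intros t; exact (is_derive_plus (V := R_NormedModule) f g t _ _ (Hf t) (Hg t)).
Qed.

Lemma Ck_mult (n : nat) : forall f g, Ck n f -> Ck n g -> Ck n (fun t => f t * g t).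
Proof.
  induction n as [|n IH]; intros f g; [easy|].
  intros Df Dg; pose proof (Ck_pred _ _ Df); pose proof (Ck_pred _ _ Dg).
  destruct Df as [f' [Hf Cf]], Dg as [g' [Hg Cg]].
  exists (fun t => f' t * g t + f t * g' t); split; auto using Ck_plus.
  intros t; exact (is_derive_mult f g t _ _ (Hf t) (Hg t) Rmult_comm).
Qed.

Lemma Ck_scal (n : nat) (c : R) (f : R -> R) : Ck n f -> Ck n (fun t => c * f t).
Proof. intros H; apply Ck_mult; auto using Ck_const. Qed.

Lemma Ck_sin_cos (n : nat) : Ck n sin /\ Ck n cos.
Proof.
  induction n as [|n [IH1 IH2]]; [easy|]; split.
  - exists cos; split; auto; intros t; apply is_derive_Reals, derivable_pt_lim_sin.
  - exists (fun t => -1 * sin t); split; [|auto using Ck_scal].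
    intros t; apply is_derive_Reals.
    replace (-1 * sin t) with (- sin t) by ring; apply derivable_pt_lim_cos.
Qed.

Lemma Ck_ex_derive_n (n : nat) : forall f t, Ck n f -> ex_derive_n f n t.
Proof.
  induction n as [|n IH]; intros f t; [easy|].
  intros [f' [Hf Cf]].
  assert (E : Derive f = f').
  { apply functional_extensionality; intros s; apply is_derive_unique, Hf. }
  specialize (IH f' t Cf).
  destruct n as [|n]; [exists (f' t); apply Hf|].
  simpl in *; revert IH; rewrite <- E.
  (* [Ck] peels off the innermost derivative and [Derive_n] the outermost one; [Derive_n_comp]
     exchanges them. *)
  replace (Derive (Derive_n f n)) with (Derive_n (Derive f) n); auto.
  apply functional_extensionality; intros s.
  pose proof (Derive_n_comp f n 1 s) as H; rewrite Nat.add_comm in H; exact H.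
Qed.

Lemma Ck_continuous (f : R -> R) : Ck 1 f -> forall t, continuous f t.
Proof.
  intros [f' [H _]] t; apply (ex_derive_continuous (V := R_NormedModule) f t); exists (f' t); apply H.
Qed.

(** * A flat bump *)

Lemma exp_INR_mult (n : nat) (x : R) : exp (INR n * x) = exp x ^ n.
Proof.
  induction n as [|n IH]; [simpl; rewrite Rmult_0_l; apply exp_0|].
  rewrite S_INR, Rmult_plus_distr_r, Rmult_1_l, exp_plus, IH; simpl; ring.
Qed.

Lemma exp_ge_1_plus (x : R) : 1 + x <= exp x.
Proof. destruct (Req_dec x 0) as [->|H]; [rewrite exp_0; lra|]. left; apply exp_ineq1; auto. Qed.

(** The m-th power of z / m <= exp (z / m). *)
Lemma pow_le_exp (m : nat) (z : R) : 0 <= z -> z ^ m <= INR m ^ m * exp z.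
Proof.
  intros Hz; destruct m as [|m].
  - simpl; pose proof (exp_ge_1_plus z); lra.
  - assert (Hm : 0 < INR (S m)) by (apply lt_0_INR; lia).
    replace (exp z) with (exp (z / INR (S m)) ^ S m)
      by (rewrite <- exp_INR_mult; f_equal; field; lra).
    rewrite <- Rpow_mult_distr; apply pow_incr; split; auto.
    pose proof (exp_ge_1_plus (z / INR (S m))).
    apply Rmult_le_reg_r with (/ INR (S m)); [apply Rinv_0_lt_compat; auto|].
    replace (INR (S m) * exp (z / INR (S m)) * / INR (S m)) with (exp (z / INR (S m)))
      by (field; lra).
    unfold Rdiv in *; lra.
Qed.

(** The flat function exp (- 1 / x) together with its multiples by powers of 1 / x: differentiation
    only produces combinations of members of this family. *)
Definition bump (k : nat) (x : R) : R :=
  if Rle_dec x 0 then 0 else (/ x) ^ k * exp (- / x).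

Lemma bump_nonpos (k : nat) (x : R) : x <= 0 -> bump k x = 0.
Proof. intros H; unfold bump; destruct (Rle_dec x 0); lra. Qed.

Lemma bump_pos (k : nat) (x : R) : 0 < x -> bump k x = (/ x) ^ k * exp (- / x).
Proof. intros H; unfold bump; destruct (Rle_dec x 0); lra. Qed.

Lemma bump_gt_0 (k : nat) (x : R) : 0 < x -> 0 < bump k x.
Proof.
  intros H; rewrite bump_pos by auto.
  apply Rmult_lt_0_compat; [apply pow_lt, Rinv_0_lt_compat; auto|apply exp_pos].
Qed.

Lemma bump_ge_0 (k : nat) (x : R) : 0 <= bump k x.
Proof.
  destruct (Rle_lt_dec x 0) as [H|H].
  - rewrite bump_nonpos; lra.
  - left; apply bump_gt_0; auto.
Qed.

Lemma bump_bounded (k : nat) (x : R) : bump k x <= INR k ^ k.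
Proof.
  destruct (Rle_lt_dec x 0) as [H|H].
  - rewrite bump_nonpos by auto; apply pow_le, pos_INR.
  - rewrite bump_pos by auto.
    assert (Hi : 0 <= / x) by (left; apply Rinv_0_lt_compat; auto).
    pose proof (pow_le_exp k (/ x) Hi) as B.
    apply Rmult_le_compat_r with (r := exp (- / x)) in B; [|left; apply exp_pos].
    rewrite Rmult_assoc, <- exp_plus in B.
    replace (/ x + - / x) with 0 in B by ring; rewrite exp_0 in B; lra.
Qed.

Lemma bump_shift (k m : nat) (x : R) : bump k x = x ^ m * bump (k + m) x.
Proof.
  destruct (Rle_lt_dec x 0) as [H|H].
  - rewrite !bump_nonpos by auto; ring.
  - rewrite !bump_pos by auto; rewrite pow_add.
    assert (x ^ m * (/ x) ^ m = 1).
    { rewrite <- Rpow_mult_distr, Rinv_r by lra; apply pow1. }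
    replace (x ^ m * ((/ x) ^ k * (/ x) ^ m * exp (- / x)))
      with ((x ^ m * (/ x) ^ m) * ((/ x) ^ k * exp (- / x))) by ring.
    rewrite H0; ring.
Qed.

Lemma is_derive_bump (k : nat) (x : R) :
  is_derive (bump k) x (- INR k * bump (k + 1) x + bump (k + 2) x).
Proof.
  destruct (Rtotal_order x 0) as [H|[->|H]].
  - rewrite !(bump_nonpos _ x) by lra.
    replace (- INR k * 0 + 0) with 0 by ring.
    apply (is_derive_ext_loc (fun _ => 0)).
    + assert (Hp : 0 < - x) by lra; exists (mkposreal _ Hp); intros y Hy.
      change (Rabs (y - x) < - x) in Hy; apply Rabs_lt_between in Hy.
      rewrite bump_nonpos; lra.
    + exact (is_derive_const (V := R_NormedModule) 0 x).
  (* At 0, [bump_shift] with m = 2 exhibits the increment as y^2 times the bounded function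
     [bump (k + 2)]. *)
  - rewrite !(bump_nonpos _ 0) by lra.
    apply (is_derive_quadratic _ _ _ (INR (k + 2) ^ (k + 2))).
    intros y; rewrite (bump_nonpos _ 0) by lra.
    replace (bump k y - 0 - (- INR k * 0 + 0) * (y - 0)) with (bump k y) by ring.
    rewrite Rabs_pos_eq by apply bump_ge_0.
    rewrite (bump_shift k 2 y), Rminus_0_r, Rmult_comm.
    apply Rmult_le_compat_r; [apply pow2_ge_0|apply bump_bounded].
  - apply (is_derive_ext_loc (fun y => (/ y) ^ k * exp (- / y))).
    + exists (mkposreal _ H); intros y Hy.
      change (Rabs (y - x) < x) in Hy; apply Rabs_lt_between in Hy.
      rewrite bump_pos; auto; lra.
    + auto_derive; [split; [|split]; auto; lra|].
      rewrite !bump_pos by auto.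
      destruct k as [|k].
      * simpl; field; lra.
      * replace (Nat.pred (S k)) with k by lia.
        replace (S k + 1)%nat with (S (S k)) by lia.
        replace (S k + 2)%nat with (S (S (S k))) by lia.
        rewrite <- !tech_pow_Rmult; field; lra.
Qed.

(** The derivative of [bump 0] is [bump 2], which is at most 2^2. *)
Lemma bump_lipschitz : exists L : R, 0 < L /\
  forall x y, Rabs (bump 0 x - bump 0 y) <= L * Rabs (x - y).
Proof.
  exists (INR 2 ^ 2); split; [apply pow_lt, lt_0_INR; lia|]; intros x y.
  destruct (MVT_gen (bump 0) y x (fun t => bump 2 t)) as [c [_ ->]].
  - intros t _; pose proof (is_derive_bump 0 t) as D; simpl in D.
    replace (- 0 * bump 1 t + bump 2 t) with (bump 2 t) in D by ring; exact D.
  - intros t _; apply continuity_pt_filterlim.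
    apply (ex_derive_continuous (V := R_NormedModule) (bump 0) t); eexists; apply is_derive_bump.
  - rewrite Rabs_mult; apply Rmult_le_compat_r; [apply Rabs_pos|].
    rewrite Rabs_pos_eq by apply bump_ge_0; apply bump_bounded.
Qed.

(** The index [k] stays universally quantified in the induction because the derivative raises it by
    1 and by 2. *)
Lemma Ck_bump_cos (s d : R) (n : nat) :
  forall k, Ck n (fun t => bump k (s * cos t + d)).
Proof.
  induction n as [|n IH]; intros k; [easy|].
  exists (fun t => - s * sin t *
    (- INR k * bump (k + 1) (s * cos t + d) + bump (k + 2) (s * cos t + d))); split.
  - intros t; apply (is_derive_comp (bump k) (fun t => s * cos t + d)).
    + apply is_derive_bump.
    + auto_derive; auto; ring.
  - apply Ck_mult; [apply Ck_scal, Ck_sin_cos|].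
    apply Ck_plus; [apply Ck_scal|]; apply IH.
Qed.

(** * Quadratic Taylor bounds for sine and cosine *)

Lemma Rabs_sin_le (x : R) : Rabs (sin x) <= Rabs x.
Proof.
  destruct (MVT_gen sin 0 x cos) as [c [_ E]].
  - intros t _; apply is_derive_Reals, derivable_pt_lim_sin.
  - intros t _; apply continuity_sin.
  - rewrite sin_0, !Rminus_0_r in E; rewrite E, Rabs_mult.
    assert (Rabs (cos c) <= 1) by (apply Rabs_le, COS_bound).
    pose proof (Rabs_pos x); nra.
Qed.

Lemma one_minus_cos (x : R) : 1 - cos x = 2 * sin (x / 2) ^ 2.
Proof.
  replace x with (2 * (x / 2)) at 1 by field; rewrite cos_2a_sin; ring.
Qed.

Lemma one_minus_cos_bounds (x : R) :
  0 <= 1 - cos x /\ 1 - cos x <= x ^ 2 /\ 1 - cos x <= Rabs x.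
Proof.
  pose proof (Rabs_sin_le (x / 2)) as H; rewrite one_minus_cos.
  assert (Hx : Rabs (x / 2) = Rabs x / 2).
  { unfold Rdiv; rewrite Rabs_mult, (Rabs_pos_eq (/ 2)); lra. }
  rewrite Hx in H; rewrite <- (pow2_abs (sin _)), <- (pow2_abs x).
  assert (Rabs (sin (x / 2)) <= 1) by (apply Rabs_le, SIN_bound).
  pose proof (Rabs_pos (sin (x / 2))); pose proof (Rabs_pos x); nra.
Qed.

Lemma sin_linear_bound (x : R) : Rabs (sin x - x) <= x ^ 2.
Proof.
  destruct (MVT_gen (fun t => sin t - t) 0 x (fun t => cos t - 1)) as [c [Hc E]].
  - intros t _; auto_derive; auto; ring.
  - intros t _; apply continuity_pt_minus; [apply continuity_sin|].
    apply derivable_continuous_pt, derivable_pt_id.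
  - rewrite sin_0, !Rminus_0_r in E; rewrite E, Rabs_mult.
    destruct (one_minus_cos_bounds c) as [B0 [_ B]].
    rewrite Rabs_minus_sym, (Rabs_pos_eq (1 - cos c)) by auto.
    assert (Rabs c <= Rabs x).
    { unfold Rmin, Rmax in Hc; destruct (Rle_dec 0 x);
        unfold Rabs; destruct (Rcase_abs c), (Rcase_abs x); lra. }
    rewrite <- (pow2_abs x); pose proof (Rabs_pos x); nra.
Qed.

(** The addition formula moves the expansion point to 0. The bound is global in [b], as
    [is_derive_quadratic] requires. *)
Lemma cos_taylor (a b : R) : Rabs (cos b - cos a + sin a * (b - a)) <= 2 * (b - a) ^ 2.
Proof.
  replace b with (a + (b - a)) at 1 by ring; set (x := b - a).
  rewrite cos_plus.
  replace (cos a * cos x - sin a * sin x - cos a + sin a * x)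
    with (cos a * (cos x - 1) - sin a * (sin x - x)) by ring.
  destruct (one_minus_cos_bounds x) as [B0 [B1 _]]; pose proof (sin_linear_bound x) as B2.
  apply Rabs_le_between in B2; pose proof (COS_bound a); pose proof (SIN_bound a).
  apply Rabs_le; nra.
Qed.

Lemma sin_taylor (a b : R) : Rabs (sin b - sin a - cos a * (b - a)) <= 2 * (b - a) ^ 2.
Proof.
  replace b with (a + (b - a)) at 1 by ring; set (x := b - a).
  rewrite sin_plus.
  replace (sin a * cos x + cos a * sin x - sin a - cos a * x)
    with (sin a * (cos x - 1) + cos a * (sin x - x)) by ring.
  destruct (one_minus_cos_bounds x) as [B0 [B1 _]]; pose proof (sin_linear_bound x) as B2.
  apply Rabs_le_between in B2; pose proof (COS_bound a); pose proof (SIN_bound a).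
  apply Rabs_le; nra.
Qed.

(** * Trigonometric series with rapidly decreasing coefficients *)

(** Fourier coefficients of smooth functions. The weight n + 1 instead of n makes the bound cover
    the index 0 as well. *)
Definition rapid (h : nat -> R) : Prop :=
  forall p : nat, exists K : R, forall n, Rabs (h n) * (INR n + 1) ^ p <= K.

(** The induction carries 2 - 1 / (n + 1), because 1 / (n + 2)^2 <= 1 / (n + 1) - 1 / (n + 2). *)
Lemma sum_inv_sq_le (n : nat) : sum_n (fun k => / (INR k + 1) ^ 2) n <= 2.
Proof.
  apply Rle_trans with (2 - / (INR n + 1)).
  - induction n as [|n IH].
    + rewrite sum_n_0; simpl; lra.
    + rewrite sum_n_succ, S_INR; pose proof (pos_INR n).
      apply Rle_trans with (2 - / (INR n + 1) + / (INR n + 1 + 1) ^ 2); [lra|].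
      assert (/ (INR n + 1) - / (INR n + 1 + 1) - / (INR n + 1 + 1) ^ 2
              = / ((INR n + 1) * (INR n + 1 + 1) ^ 2)) by (field; lra).
      assert (0 < / ((INR n + 1) * (INR n + 1 + 1) ^ 2)).
      { apply Rinv_0_lt_compat, Rmult_lt_0_compat; [lra|apply pow_lt; lra]. }
      lra.
  - assert (0 < / (INR n + 1)) by (apply Rinv_0_lt_compat; pose proof (pos_INR n); lra); lra.
Qed.

Lemma ex_series_inv_sq : ex_series (fun n => / (INR n + 1) ^ 2).
Proof.
  apply (nonneg_series_bounded _ 2); [|exact sum_inv_sq_le].
  intros n; left; apply Rinv_0_lt_compat, pow_lt; pose proof (pos_INR n); lra.
Qed.

Lemma rapid_ex_series (h : nat -> R) : rapid h -> ex_series (fun n => Rabs (h n)).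
Proof.
  intros H; destruct (H 2%nat) as [K HK].
  apply (ex_series_abs_le h (fun n => K * / (INR n + 1) ^ 2)).
  - intros n; specialize (HK n).
    assert (0 < (INR n + 1) ^ 2) by (apply pow_lt; pose proof (pos_INR n); lra).
    apply Rmult_le_reg_r with ((INR n + 1) ^ 2); auto.
    rewrite Rmult_assoc, Rinv_l by lra; lra.
  - apply ex_series_Rscal, ex_series_inv_sq.
Qed.

Lemma rapid_mult_INR (c : R) (h : nat -> R) : rapid h -> rapid (fun n => c * INR n * h n).
Proof.
  intros H p; destruct (H (S p)) as [K HK]; exists (Rabs c * K); intros n.
  rewrite !Rabs_mult, (Rabs_pos_eq (INR n)) by apply pos_INR; specialize (HK n).
  apply Rle_trans with (Rabs c * (Rabs (h n) * (INR n + 1) ^ S p)).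
  - rewrite <- tech_pow_Rmult.
    assert (0 <= Rabs c * Rabs (h n) * (INR n + 1) ^ p).
    { repeat apply Rmult_le_pos; try apply Rabs_pos; apply pow_le; pose proof (pos_INR n); lra. }
    pose proof (pos_INR n); nra.
  - apply Rmult_le_compat_l; auto; apply Rabs_pos.
Qed.

Lemma Rabs_cos_le_1 (x : R) : Rabs (cos x) <= 1.
Proof. apply Rabs_le, COS_bound. Qed.

Lemma Rabs_sin_le_1 (x : R) : Rabs (sin x) <= 1.
Proof. apply Rabs_le, SIN_bound. Qed.

Lemma Rabs_mult_le_l (a b : R) : Rabs b <= 1 -> Rabs (a * b) <= Rabs a.
Proof. intros H; rewrite Rabs_mult; pose proof (Rabs_pos a); nra. Qed.

(** Cosine and sine coefficients are kept together so that the derivative is a series of the same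
    shape. *)
Definition trig (h s : nat -> R) (t : R) : R :=
  Series (fun n => h n * cos (INR n * t) + s n * sin (INR n * t)).

Lemma trig_term_le (a b x : R) : Rabs (a * cos x + b * sin x) <= Rabs a + Rabs b.
Proof.
  eapply Rle_trans; [apply Rabs_triang|].
  apply Rplus_le_compat; apply Rabs_mult_le_l; auto using Rabs_cos_le_1, Rabs_sin_le_1.
Qed.

Lemma ex_series_trig (h s : nat -> R) (t : R) :
  ex_series (fun n => Rabs (h n)) -> ex_series (fun n => Rabs (s n)) ->
  ex_series (fun n => h n * cos (INR n * t) + s n * sin (INR n * t)).
Proof.
  intros Hh Hs; apply (ex_series_dominated _ (fun n => Rabs (h n) + Rabs (s n))).
  - intros n; apply trig_term_le.
  - apply ex_series_Rplus; auto.
Qed.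

Lemma is_derive_trig (h s : nat -> R) (t : R) : rapid h -> rapid s ->
  is_derive (trig h s) t (trig (fun n => 1 * INR n * s n) (fun n => -1 * INR n * h n) t).
Proof.
  intros Hh Hs.
  pose proof (rapid_mult_INR 1 _ Hh) as Hh1; pose proof (rapid_mult_INR 1 _ Hs) as Hs1.
  pose proof (rapid_mult_INR (-1) _ Hh) as Hh1'.
  pose proof (rapid_ex_series _ (rapid_mult_INR 1 _ Hh1)) as Hh2.
  pose proof (rapid_ex_series _ (rapid_mult_INR 1 _ Hs1)) as Hs2.
  (* [c n] is n^2 (|h n| + |s n|), the size of the second derivative of the n-th term, in the form
     that [rapid_mult_INR] produces. *)
  set (c := fun n => Rabs (1 * INR n * (1 * INR n * h n)) + Rabs (1 * INR n * (1 * INR n * s n))).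
  assert (Hc : ex_series c) by (apply ex_series_Rplus; auto).
  apply (is_derive_quadratic _ _ _ (2 * Series c)); intros y; unfold trig.
  pose proof (rapid_ex_series _ Hh); pose proof (rapid_ex_series _ Hs).
  pose proof (rapid_ex_series _ Hh1'); pose proof (rapid_ex_series _ Hs1).
  rewrite <- Series_minus by (apply ex_series_trig; auto).
  rewrite <- Series_scal_r.
  rewrite <- Series_minus;
    [|apply ex_series_Rminus; apply ex_series_trig; auto
     |apply ex_series_scal_r, ex_series_trig; auto].
  replace (2 * Series c * (y - t) ^ 2) with (Series (fun n => 2 * (y - t) ^ 2 * c n))
    by (rewrite Series_scal_l; ring).
  apply Rabs_Series_le; [|apply ex_series_Rscal; auto].
  intros n; unfold c; set (w := INR n).
  replace (h n * cos (w * y) + s n * sin (w * y) - (h n * cos (w * t) + s n * sin (w * t)) -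
    (1 * w * s n * cos (w * t) + -1 * w * h n * sin (w * t)) * (y - t))
    with (h n * (cos (w * y) - cos (w * t) + sin (w * t) * (w * y - w * t)) +
          s n * (sin (w * y) - sin (w * t) - cos (w * t) * (w * y - w * t))) by ring.
  eapply Rle_trans; [apply Rabs_triang|]; rewrite !Rabs_mult.
  pose proof (cos_taylor (w * t) (w * y)) as B1; pose proof (sin_taylor (w * t) (w * y)) as B2.
  rewrite Rabs_R1, (Rabs_pos_eq w) by apply pos_INR.
  replace (w * y - w * t) with (w * (y - t)) in * by ring.
  apply Rmult_le_compat_l with (r := Rabs (h n)) in B1; [|apply Rabs_pos].
  apply Rmult_le_compat_l with (r := Rabs (s n)) in B2; [|apply Rabs_pos].
  rewrite Rpow_mult_distr in B1, B2; nra.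
Qed.

Lemma Ck_trig (n : nat) : forall h s, rapid h -> rapid s -> Ck n (trig h s).
Proof.
  induction n as [|n IH]; intros h s Hh Hs; [easy|].
  exists (trig (fun n => 1 * INR n * s n) (fun n => -1 * INR n * h n)); split.
  - intros t; apply is_derive_trig; auto.
  - apply IH; apply rapid_mult_INR; auto.
Qed.

(** * Abel's limit theorem for absolutely convergent series *)

Lemma pow_le_1 (r : R) (n : nat) : 0 <= r <= 1 -> 0 <= r ^ n <= 1.
Proof.
  intros H; split; [apply pow_le; lra|].
  rewrite <- (pow1 n); apply pow_incr; lra.
Qed.

Lemma bernoulli_pow (r : R) (n : nat) : 0 <= r <= 1 -> 1 - r ^ n <= INR n * (1 - r).
Proof.
  intros H; induction n as [|n IH]; [simpl; lra|].
  rewrite S_INR; simpl; pose proof (pow_le_1 r n H); nra.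
Qed.

(** By Bernoulli's inequality the terms up to N change by at most N (1 - r) times the l1 norm; both
    tails are dominated by the tail of the absolute values. *)
Lemma abel_l1 (a : nat -> R) (eta : R) : ex_series (fun n => Rabs (a n)) -> 0 < eta ->
  exists rho, 0 <= rho < 1 /\
    forall r, rho < r < 1 -> Rabs (Series (fun n => a n * r ^ n) - Series a) <= eta.
Proof.
  intros Ha Heta.
  destruct (proj2 (is_lim_seq_spec _ _) (tail_tends_0 _ Ha)
    (mkposreal (eta / 4) ltac:(lra))) as [N HN].
  specialize (HN N (le_n N)); simpl in HN; rewrite Rminus_0_r in HN.
  apply Rabs_lt_between in HN.
  set (T := Series (fun n => Rabs (a n))) in *.
  assert (HT : 0 <= T).
  { apply Rle_trans with (sum_n (fun n => Rabs (a n)) N);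
      [apply sum_n_nonneg; intros; apply Rabs_pos|].
    apply sum_n_le_Series; auto; intros; apply Rabs_pos. }
  (* For 1 - r < eta / (2 D), the summand N T limits the change of the head to eta / 2, the two
     tails taking eta / 4 each. The summand 1 + eta keeps eta / (2 D) below 1, so that rho is not
     negative. *)
  set (D := INR N * T + 1 + eta).
  assert (HD : 0 < D) by (unfold D; pose proof (pos_INR N); nra).
  assert (HeD : eta / (2 * D) <= 1).
  { apply Rmult_le_reg_r with (2 * D); [lra|]; unfold Rdiv.
    rewrite Rmult_assoc, Rinv_l by lra; unfold D; pose proof (pos_INR N); nra. }
  assert (HeD' : 0 < eta / (2 * D)) by (apply Rdiv_lt_0_compat; lra).
  exists (1 - eta / (2 * D)); split; [lra|]; intros r Hr.
  assert (Hr1 : 0 <= r <= 1) by lra.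
  assert (Hle : forall n, Rabs (a n * r ^ n) <= Rabs (a n)).
  { intros n; apply Rabs_mult_le_l; pose proof (pow_le_1 r n Hr1); rewrite Rabs_pos_eq; lra. }
  pose proof (Series_tail_bound _ _ N Hle Ha) as B1.
  pose proof (Series_tail_bound a _ N (fun n => Rle_refl (Rabs (a n))) Ha) as B2.
  fold T in B1, B2.
  assert (B3 : Rabs (sum_n (fun n => a n * r ^ n) N - sum_n a N) <= INR N * (1 - r) * T).
  { assert (E : sum_n (fun n => a n * r ^ n) N - sum_n a N
                = sum_n (fun n => a n * r ^ n + -1 * a n) N)
      by (rewrite sum_n_add, sum_n_scal; ring).
    rewrite E.
    eapply Rle_trans; [apply Rabs_sum_n_le|].
    apply Rle_trans with (INR N * (1 - r) * sum_n (fun n => Rabs (a n)) N).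
    - rewrite <- sum_n_scal; apply sum_n_le_compat; intros n Hn.
      replace (a n * r ^ n + -1 * a n) with (- (1 - r ^ n) * a n) by ring.
      rewrite Rabs_mult, Rabs_Ropp.
      apply Rmult_le_compat_r; [apply Rabs_pos|].
      pose proof (pow_le_1 r n Hr1); rewrite Rabs_pos_eq by lra.
      apply Rle_trans with (INR n * (1 - r)); [apply bernoulli_pow; auto|].
      apply Rmult_le_compat_r; [lra|apply le_INR; lia].
    - apply Rmult_le_compat_l; [apply Rmult_le_pos; [apply pos_INR|lra]|].
      apply sum_n_le_Series; auto; intros; apply Rabs_pos. }
  assert (B4 : INR N * (1 - r) * T <= eta / 2).
  { assert (1 - r < eta / (2 * D)) by lra.
    apply Rle_trans with (D * (eta / (2 * D))); [|right; field; lra].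
    apply Rle_trans with (D * (1 - r)); [unfold D; pose proof (pos_INR N); nra|nra]. }
  apply Rabs_le_between in B1; apply Rabs_le_between in B2; apply Rabs_le_between in B3.
  apply Rabs_le; lra.
Qed.

(** * Means over the circle and Fourier coefficients *)

Definition Cont (f : R -> R) : Prop := forall t : R, continuous f t.

Lemma Cont_const (c : R) : Cont (fun _ => c).
Proof. intros t; apply continuous_const. Qed.

Lemma Cont_plus (f g : R -> R) : Cont f -> Cont g -> Cont (fun t => f t + g t).
Proof. intros Hf Hg t; exact (continuous_plus (V := R_NormedModule) f g t (Hf t) (Hg t)). Qed.

Lemma Cont_mult (f g : R -> R) : Cont f -> Cont g -> Cont (fun t => f t * g t).
Proof. intros Hf Hg t; exact (continuous_mult (K := R_AbsRing) f g t (Hf t) (Hg t)). Qed.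

Lemma Cont_opp (f : R -> R) : Cont f -> Cont (fun t => - f t).
Proof. intros Hf t; exact (continuous_opp (V := R_NormedModule) f t (Hf t)). Qed.

Lemma Cont_minus (f g : R -> R) : Cont f -> Cont g -> Cont (fun t => f t - g t).
Proof. intros Hf Hg; apply Cont_plus; auto using Cont_opp. Qed.

Lemma Cont_pow (f : R -> R) (n : nat) : Cont f -> Cont (fun t => f t ^ n).
Proof.
  intros Hf; induction n as [|n IH]; simpl; [apply Cont_const|apply Cont_mult; auto].
Qed.

Lemma Cont_Rabs (f : R -> R) : Cont f -> Cont (fun t => Rabs (f t)).
Proof.
  intros Hf t; apply (continuous_comp f Rabs); [apply Hf|].
  apply continuity_pt_filterlim, Rcontinuity_abs.
Qed.

Lemma Cont_cos (w : R) : Cont (fun t => cos (w * t)).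
Proof.
  intros t; apply (ex_derive_continuous (V := R_NormedModule) (fun t => cos (w * t)) t).
  auto_derive; auto.
Qed.

Lemma Cont_sin (w : R) : Cont (fun t => sin (w * t)).
Proof.
  intros t; apply (ex_derive_continuous (V := R_NormedModule) (fun t => sin (w * t)) t).
  auto_derive; auto.
Qed.

Lemma Cont_cos1 : Cont cos.
Proof. intros t; apply continuity_pt_filterlim, continuity_cos. Qed.

Lemma Cont_sum (f : nat -> R -> R) (n : nat) :
  (forall k, Cont (f k)) -> Cont (fun t => sum_n (fun k => f k t) n).
Proof.
  intros H; induction n as [|n IH].
  - replace (fun t => sum_n (fun k => f k t) 0) with (f 0%nat); auto.
    apply functional_extensionality; intros t; rewrite sum_n_0; auto.
  - replace (fun t => sum_n (fun k => f k t) (S n))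
      with (fun t => sum_n (fun k => f k t) n + f (S n) t); auto using Cont_plus.
    apply functional_extensionality; intros t; rewrite sum_n_succ; auto.
Qed.

#[local] Hint Resolve Cont_const Cont_plus Cont_mult Cont_opp Cont_minus Cont_pow Cont_Rabs
  Cont_cos Cont_sin Cont_cos1 : cont.

Definition mean (f : R -> R) : R := RInt f (- PI) PI / (2 * PI).

Lemma Cont_ex_RInt (f : R -> R) (a b : R) : Cont f -> ex_RInt f a b.
Proof. intros H; apply (ex_RInt_continuous (V := R_CompleteNormedModule)); intros; apply H. Qed.

Lemma mean_plus (f g : R -> R) :
  Cont f -> Cont g -> mean (fun t => f t + g t) = mean f + mean g.
Proof.
  intros Hf Hg; unfold mean.
  rewrite (RInt_plus (V := R_CompleteNormedModule) f g) by (apply Cont_ex_RInt; auto).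
  unfold plus; simpl; unfold Rdiv; ring.
Qed.

Lemma mean_scal (c : R) (f : R -> R) : Cont f -> mean (fun t => c * f t) = c * mean f.
Proof.
  intros Hf; unfold mean.
  rewrite (RInt_scal (V := R_CompleteNormedModule) f) by (apply Cont_ex_RInt; auto).
  unfold scal; simpl; unfold mult; simpl; unfold Rdiv; ring.
Qed.

Lemma mean_minus (f g : R -> R) :
  Cont f -> Cont g -> mean (fun t => f t - g t) = mean f - mean g.
Proof.
  intros Hf Hg.
  replace (fun t => f t - g t) with (fun t => f t + (-1) * g t)
    by (apply functional_extensionality; intros; ring).
  rewrite mean_plus, mean_scal; auto with cont; ring.
Qed.

Lemma mean_const (c : R) : mean (fun _ => c) = c.
Proof.
  unfold mean; rewrite RInt_const; unfold scal; simpl; unfold mult; simpl.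
  pose proof PI_RGT_0; field; lra.
Qed.

Lemma mean_le (f g : R -> R) :
  Cont f -> Cont g -> (forall t, f t <= g t) -> mean f <= mean g.
Proof.
  intros Hf Hg H; unfold mean; pose proof PI_RGT_0.
  apply Rmult_le_compat_r; [left; apply Rinv_0_lt_compat; lra|].
  apply RInt_le; auto using Cont_ex_RInt; lra.
Qed.

Lemma mean_Rabs_le (f g : R -> R) :
  Cont f -> Cont g -> (forall t, Rabs (f t) <= g t) -> Rabs (mean f) <= mean g.
Proof.
  intros Hf Hg H; apply Rabs_le; split.
  - replace (- mean g) with (mean (fun t => -1 * g t)) by (rewrite mean_scal; auto; ring).
    apply mean_le; auto with cont.
    intros t; specialize (H t); apply Rabs_le_between in H; lra.
  - apply mean_le; auto; intros t; specialize (H t); apply Rabs_le_between in H; lra.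
Qed.

Lemma mean_sum (f : nat -> R -> R) (n : nat) :
  (forall k, Cont (f k)) -> mean (fun t => sum_n (fun k => f k t) n) = sum_n (fun k => mean (f k)) n :> R.
Proof.
  intros H; induction n as [|n IH].
  - rewrite sum_n_0; f_equal; apply functional_extensionality; intros t; apply sum_n_0.
  - rewrite sum_n_succ, <- IH, <- mean_plus; auto using Cont_sum.
    f_equal; apply functional_extensionality; intros t; apply sum_n_succ.
Qed.

Lemma mean_derive (f f' : R -> R) :
  (forall t, is_derive f t (f' t)) -> Cont f' -> f PI = f (- PI) -> mean f' = 0.
Proof.
  intros H Hc E; unfold mean.
  rewrite (is_RInt_unique _ _ _ _ (is_RInt_derive (V := R_CompleteNormedModule) f f' (- PI) PI
    (fun t _ => H t) (fun t _ => Hc t))).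
  rewrite E; unfold minus, plus, opp; simpl; unfold Rdiv; ring.
Qed.

Lemma sin_INR_PI (n : nat) : sin (INR n * PI) = 0.
Proof.
  induction n as [|n IH]; [simpl; rewrite Rmult_0_l; apply sin_0|].
  rewrite S_INR, Rmult_plus_distr_r, Rmult_1_l, neg_sin, IH; ring.
Qed.

Lemma sin_INR_mPI (n : nat) : sin (INR n * - PI) = 0.
Proof. rewrite Ropp_mult_distr_r_reverse, sin_neg, sin_INR_PI; ring. Qed.

Lemma cos_INR_mPI (n : nat) : cos (INR n * - PI) = cos (INR n * PI).
Proof. rewrite Ropp_mult_distr_r_reverse; apply cos_neg. Qed.

(** The boundary terms vanish because sin (n PI) = 0; in the sine version they cancel because [v]
    agrees at PI and - PI. *)
Lemma mean_by_parts_cos (v v' : R -> R) (n : nat) : (0 < n)%nat ->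
  (forall t, is_derive v t (v' t)) -> Cont v -> Cont v' ->
  INR n * mean (fun t => v t * cos (INR n * t)) = - mean (fun t => v' t * sin (INR n * t)).
Proof.
  intros Hn Hd Hv Hv'.
  rewrite <- mean_scal by auto with cont.
  assert (E : mean (fun t => v' t * sin (INR n * t) + INR n * (v t * cos (INR n * t))) = 0).
  { apply (mean_derive (fun t => v t * sin (INR n * t))); auto 6 with cont.
    - intros t.
      replace (v' t * sin (INR n * t) + INR n * (v t * cos (INR n * t)))
        with (v' t * sin (INR n * t) + v t * (INR n * cos (INR n * t))) by ring.
      apply (is_derive_mult v (fun t => sin (INR n * t)) t); auto; [|exact Rmult_comm].
      auto_derive; auto; ring.
    - rewrite sin_INR_PI, sin_INR_mPI; ring. }
  rewrite mean_plus in E; auto 6 with cont; lra.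
Qed.

Lemma mean_by_parts_sin (v v' : R -> R) (n : nat) : (0 < n)%nat ->
  (forall t, is_derive v t (v' t)) -> Cont v -> Cont v' -> v PI = v (- PI) ->
  INR n * mean (fun t => v t * sin (INR n * t)) = mean (fun t => v' t * cos (INR n * t)).
Proof.
  intros Hn Hd Hv Hv' Hp.
  rewrite <- mean_scal by auto with cont.
  assert (E : mean (fun t => v' t * cos (INR n * t) - INR n * (v t * sin (INR n * t))) = 0).
  { apply (mean_derive (fun t => v t * cos (INR n * t))); auto 6 with cont.
    - intros t.
      replace (v' t * cos (INR n * t) - INR n * (v t * sin (INR n * t)))
        with (v' t * cos (INR n * t) + v t * (- INR n * sin (INR n * t))) by ring.
      apply (is_derive_mult v (fun t => cos (INR n * t)) t); auto; [|exact Rmult_comm].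
      auto_derive; auto; ring.
    - rewrite Hp, cos_INR_mPI; ring. }
  rewrite mean_minus in E; auto 6 with cont; lra.
Qed.

Lemma mean_cos (n : nat) : (0 < n)%nat -> mean (fun t => cos (INR n * t)) = 0.
Proof.
  intros Hn; assert (0 < INR n) by (apply lt_0_INR; auto).
  assert (E : INR n * mean (fun t => 1 * cos (INR n * t)) = - mean (fun t => 0 * sin (INR n * t))).
  { apply mean_by_parts_cos; auto with cont.
    intros t; exact (is_derive_const (V := R_NormedModule) 1 t). }
  rewrite !mean_scal in E by auto with cont; nra.
Qed.

Lemma smooth_derivative (v : R -> R) : (forall n, Ck n v) ->
  exists v', (forall t, is_derive v t (v' t)) /\ forall n, Ck n v'.
Proof.
  intros H; exists (Derive v); split.
  - intros t; destruct (H 1%nat) as [v' [Hv' _]].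
    apply Derive_correct; exists (v' t); auto.
  - intros n; destruct (H (S n)) as [v' [Hv' C]].
    replace (Derive v) with v'; auto.
    apply functional_extensionality; intros t; symmetry; apply is_derive_unique, Hv'.
Qed.

Lemma derivative_periodic (v v' : R -> R) (T : R) :
  (forall t, is_derive v t (v' t)) -> (forall t, v (t + T) = v t) -> forall t, v' (t + T) = v' t.
Proof.
  intros Hd Hp t.
  assert (D : is_derive (fun s => v (s + T)) t (1 * v' (t + T))).
  { apply (is_derive_comp v (fun s => s + T)); [apply Hd|auto_derive; auto]. }
  apply (is_derive_ext _ v) in D; [|exact Hp].
  pose proof (is_derive_unique v t _ D); pose proof (is_derive_unique v t _ (Hd t)); lra.
Qed.

(** Every integration by parts gains a factor n and replaces [v] by its derivative, which is again
    smooth and periodic. *)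
Lemma fourier_decay (p : nat) : forall v, (forall n, Ck n v) -> (forall t, v (t + 2 * PI) = v t) ->
  exists K, forall n,
    Rabs (mean (fun t => v t * cos (INR n * t))) * (INR n + 1) ^ p <= K /\
    Rabs (mean (fun t => v t * sin (INR n * t))) * (INR n + 1) ^ p <= K.
Proof.
  assert (B : forall v, Cont v -> forall n,
    Rabs (mean (fun t => v t * cos (INR n * t))) <= mean (fun t => Rabs (v t)) /\
    Rabs (mean (fun t => v t * sin (INR n * t))) <= mean (fun t => Rabs (v t))).
  { intros v Hv n; split; apply mean_Rabs_le; auto with cont;
      intros t; apply Rabs_mult_le_l; auto using Rabs_cos_le_1, Rabs_sin_le_1. }
  induction p as [|p IH]; intros v Hv Hp.
  - assert (Cv : Cont v) by exact (Ck_continuous v (Hv 1%nat)).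
    exists (mean (fun t => Rabs (v t))); intros n; simpl.
    rewrite !Rmult_1_r; apply B; auto.
  - assert (Cv : Cont v) by exact (Ck_continuous v (Hv 1%nat)).
    destruct (smooth_derivative v Hv) as [v' [Hd Hv']].
    assert (Cv' : Cont v') by exact (Ck_continuous v' (Hv' 1%nat)).
    destruct (IH v' Hv' (derivative_periodic v v' _ Hd Hp)) as [K HK].
    (* The factor 2 comes from n + 1 <= 2 n for n >= 1; the mean of |v| covers n = 0. *)
    exists (2 * K + mean (fun t => Rabs (v t))); intros n.
    assert (HM : 0 <= mean (fun t => Rabs (v t))).
    { rewrite <- (mean_const 0); apply mean_le; auto with cont; intros; apply Rabs_pos. }
    assert (HK0 : 0 <= K).
    { eapply Rle_trans; [|apply (HK n)]; apply Rmult_le_pos; [apply Rabs_pos|].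
      apply pow_le; pose proof (pos_INR n); lra. }
    destruct n as [|n].
    + simpl INR; rewrite Rplus_0_l, pow1, !Rmult_1_r.
      destruct (B v Cv 0%nat); simpl INR in *; lra.
    + assert (Hn : 1 <= INR (S n)) by (rewrite S_INR; pose proof (pos_INR n); lra).
      specialize (HK (S n)).
      assert (G : forall x y, Rabs (INR (S n) * x) = Rabs y ->
        Rabs y * (INR (S n) + 1) ^ p <= K -> Rabs x * (INR (S n) + 1) ^ S p
          <= 2 * K + mean (fun t => Rabs (v t))).
      { intros x y E H; rewrite <- E, Rabs_mult, (Rabs_pos_eq (INR (S n))) in H by lra.
        rewrite <- tech_pow_Rmult.
        assert (0 <= Rabs x * (INR (S n) + 1) ^ p)
          by (apply Rmult_le_pos; [apply Rabs_pos|apply pow_le; lra]).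
        nra. }
      assert (Hs : v PI = v (- PI)) by (rewrite <- (Hp (- PI)); f_equal; ring).
      split; eapply G.
      * rewrite (mean_by_parts_cos v v') by (auto; lia).
        rewrite Rabs_Ropp; reflexivity.
      * apply HK.
      * rewrite (mean_by_parts_sin v v') by (auto; lia); reflexivity.
      * apply HK.
Qed.

(** * Poisson kernels and inversion of cosine series *)

Definition cosine_coeff (v : R -> R) (n : nat) : R :=
  match n with
  | O => mean v
  | S _ => 2 * mean (fun s => v s * cos (INR n * s))
  end.

Definition kernel_coeff (r : R) (n : nat) : R :=
  match n with O => 1 | S _ => 2 * r ^ n end.

(** The Poisson kernel truncated at N, which turns integrals against it into finite sums. The price
    is that positivity holds only up to an error that vanishes as N grows. *)
Definition poisson_partial (r : R) (N : nat) (x : R) : R :=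
  sum_n (fun n => kernel_coeff r n * cos (INR n * x)) N.

(** Multiplication by the Poisson denominator telescopes through cos ((N + 2) x) = 2 cos x cos ((N +
    1) x) - cos (N x). The part 1 - r^2 belongs to the full kernel; the last two terms are the
    truncation error. *)
Lemma poisson_partial_closed (r : R) (N : nat) (x : R) :
  poisson_partial r N x * (1 - 2 * r * cos x + r ^ 2)
  = 1 - r ^ 2 - 2 * r ^ (N + 1) * cos (INR (N + 1) * x) + 2 * r ^ (N + 2) * cos (INR N * x).
Proof.
  unfold poisson_partial; induction N as [|N IH].
  - rewrite sum_n_0; simpl; rewrite Rmult_0_l, cos_0, !Rmult_1_l; ring.
  - rewrite sum_n_succ, Rmult_plus_distr_r, IH; unfold kernel_coeff.
    replace (S N + 1)%nat with (S (S N)) by lia; replace (S N + 2)%nat with (S (S (S N))) by lia.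
    replace (N + 1)%nat with (S N) by lia; replace (N + 2)%nat with (S (S N)) by lia.
    assert (E : cos (INR (S (S N)) * x) = 2 * cos x * cos (INR (S N) * x) - cos (INR N * x)).
    { replace (INR (S (S N)) * x) with (INR (S N) * x + x) by (rewrite (S_INR (S N)); ring).
      replace (INR N * x) with (INR (S N) * x - x) by (rewrite S_INR; ring).
      rewrite cos_plus, cos_minus; ring. }
    rewrite E, <- !tech_pow_Rmult; ring.
Qed.

(** In the closed form the numerator is at least - 4 r^(N + 1), and the denominator is at least (1 -
    r)^2. *)
Lemma poisson_partial_lower (r : R) (N : nat) (x : R) : 0 <= r < 1 ->
  - (4 * r ^ (N + 1) / (1 - r) ^ 2) <= poisson_partial r N x.
Proof.
  intros Hr; pose proof (poisson_partial_closed r N x) as E.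
  pose proof (COS_bound x) as Bx.
  assert (Hd : 0 < (1 - r) ^ 2) by (apply pow_lt; lra).
  assert (HD : (1 - r) ^ 2 <= 1 - 2 * r * cos x + r ^ 2) by nra.
  set (D := 1 - 2 * r * cos x + r ^ 2) in *.
  assert (Hr1 : 0 <= r <= 1) by lra.
  pose proof (pow_le_1 r (N + 1) Hr1) as P1.
  assert (P2 : r ^ (N + 2) = r * r ^ (N + 1))
    by (replace (N + 2)%nat with (S (N + 1)) by lia; reflexivity).
  rewrite P2 in E; set (w := r ^ (N + 1)) in *.
  pose proof (COS_bound (INR (N + 1) * x)); pose proof (COS_bound (INR N * x)).
  assert (HL : - (4 * w) <= poisson_partial r N x * D).
  { rewrite E.
    assert (0 <= w * (1 - cos (INR (N + 1) * x))) by (apply Rmult_le_pos; lra).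
    assert (0 <= r * w * (1 + cos (INR N * x)))
      by (apply Rmult_le_pos; [apply Rmult_le_pos; lra|lra]).
    assert (0 <= w * (1 - r)) by (apply Rmult_le_pos; lra).
    assert (0 <= 1 - r ^ 2) by nra.
    lra. }
  apply Rmult_le_reg_r with D; [lra|].
  apply Rle_trans with (- (4 * w)); auto.
  assert (4 * w <= 4 * w / (1 - r) ^ 2 * D); [|lra].
  unfold Rdiv; rewrite Rmult_assoc.
  assert (1 <= / (1 - r) ^ 2 * D); [|nra].
  apply Rmult_le_reg_l with ((1 - r) ^ 2); auto.
  rewrite <- Rmult_assoc, Rinv_r by lra; lra.
Qed.

(* Averaging the Poisson kernels at [s - t] and [s + t] leaves only the cosine terms. *)
Definition even_kernel (r t : R) (N : nat) (s : R) : R :=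
  sum_n (fun n => kernel_coeff r n * cos (INR n * t) * cos (INR n * s)) N.

Lemma even_kernel_poisson (r t : R) (N : nat) (s : R) :
  even_kernel r t N s = (poisson_partial r N (s - t) + poisson_partial r N (s + t)) / 2.
Proof.
  unfold even_kernel, poisson_partial.
  transitivity (sum_n (fun n => / 2 * (kernel_coeff r n * cos (INR n * (s - t))
    + kernel_coeff r n * cos (INR n * (s + t)))) N).
  - apply sum_n_Rext; intros n.
    replace (INR n * (s - t)) with (INR n * s - INR n * t) by ring.
    replace (INR n * (s + t)) with (INR n * s + INR n * t) by ring.
    rewrite cos_minus, cos_plus; field.
  - rewrite sum_n_scal, sum_n_add; unfold Rdiv; apply Rmult_comm.
Qed.

Lemma even_kernel_lower (r t : R) (N : nat) (s : R) : 0 <= r < 1 ->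
  - (4 * r ^ (N + 1) / (1 - r) ^ 2) <= even_kernel r t N s.
Proof.
  intros Hr; rewrite even_kernel_poisson.
  pose proof (poisson_partial_lower r N (s - t) Hr).
  pose proof (poisson_partial_lower r N (s + t) Hr); lra.
Qed.

Lemma Cont_even_kernel (r t : R) (N : nat) : Cont (even_kernel r t N).
Proof. apply (Cont_sum (fun n s => _)); intros n; auto with cont. Qed.

Lemma mean_even_kernel (v : R -> R) (r t : R) (N : nat) : Cont v ->
  mean (fun s => v s * even_kernel r t N s)
  = sum_n (fun n => cosine_coeff v n * cos (INR n * t) * r ^ n) N.
Proof.
  intros Hv.
  transitivity (mean (fun s =>
    sum_n (fun n => kernel_coeff r n * cos (INR n * t) * (v s * cos (INR n * s))) N)).
  - f_equal; apply functional_extensionality; intros s; unfold even_kernel.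
    rewrite <- sum_n_scal; apply sum_n_Rext; intros n; ring.
  - rewrite (mean_sum (fun n s => kernel_coeff r n * cos (INR n * t) * (v s * cos (INR n * s))))
      by (intros; auto with cont).
    apply sum_n_Rext; intros n; rewrite mean_scal by auto with cont.
    destruct n as [|n]; unfold cosine_coeff, kernel_coeff.
    + simpl; replace (fun t0 => v t0 * cos (0 * t0)) with v; [ring|].
      apply functional_extensionality; intros s; rewrite Rmult_0_l, cos_0; ring.
    + ring.
Qed.

Lemma sum_n_single (a : nat -> R) (m : nat) : (forall k, k <> m -> a k = 0) ->
  forall N, sum_n a N = (if le_dec m N then a m else 0) :> R.
Proof.
  intros H; induction N as [|N IH].
  - rewrite sum_n_0; destruct (le_dec m 0) as [L|L]; [f_equal; lia|apply H; lia].
  - rewrite sum_n_succ, IH.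
    destruct (le_dec m N), (le_dec m (S N)); try lia.
    + rewrite (H (S N)) by lia; ring.
    + replace m with (S N) by lia; ring.
    + rewrite (H (S N)) by lia; ring.
Qed.

Lemma mean_cos_cos (m n : nat) :
  mean (fun s => cos (INR m * s) * cos (INR n * s))
  = if Nat.eq_dec m n then (if Nat.eq_dec m 0 then 1 else / 2) else 0.
Proof.
  assert (H : forall m n, (n <= m)%nat -> mean (fun s => cos (INR m * s) * cos (INR n * s))
    = / 2 * (mean (fun s => cos (INR (m - n) * s)) + mean (fun s => cos (INR (m + n) * s)))).
  { clear m n; intros m n Hmn.
    rewrite <- mean_plus, <- mean_scal by auto with cont.
    f_equal; apply functional_extensionality; intros s.
    rewrite minus_INR, plus_INR by auto.
    replace ((INR m - INR n) * s) with (INR m * s - INR n * s) by ring.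
    replace ((INR m + INR n) * s) with (INR m * s + INR n * s) by ring.
    rewrite cos_minus, cos_plus; field. }
  assert (Z : mean (fun s => cos (INR 0 * s)) = 1).
  { replace (fun s => cos (INR 0 * s)) with (fun _ : R => 1); [apply mean_const|].
    apply functional_extensionality; intros s; simpl; rewrite Rmult_0_l, cos_0; auto. }
  destruct (le_ge_dec n m) as [L|L].
  - rewrite H by auto; destruct (Nat.eq_dec m n) as [->|D].
    + rewrite Nat.sub_diag, Z; destruct (Nat.eq_dec n 0) as [->|D].
      * simpl Nat.add; rewrite Z; field.
      * rewrite mean_cos by lia; field.
    + rewrite !mean_cos by lia; ring.
  - replace (fun s => cos (INR m * s) * cos (INR n * s))
      with (fun s => cos (INR n * s) * cos (INR m * s))
      by (apply functional_extensionality; intros; ring).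
    rewrite H by auto; destruct (Nat.eq_dec m n) as [->|D].
    + rewrite Nat.sub_diag, Z; destruct (Nat.eq_dec n 0) as [->|D].
      * simpl Nat.add; rewrite Z; field.
      * rewrite mean_cos by lia; field.
    + rewrite !mean_cos by lia; ring.
Qed.


(** Cosines are eigenfunctions of the averaging, with eigenvalue r^m; the cases m = 0, 1, 2 are the
    test functions of Korovkin's argument. *)
Lemma mean_cos_even_kernel (m : nat) (r t : R) (N : nat) : (m <= N)%nat ->
  mean (fun s => cos (INR m * s) * even_kernel r t N s) = cos (INR m * t) * r ^ m.
Proof.
  intros Hm; rewrite mean_even_kernel by auto with cont.
  rewrite (sum_n_single _ m).
  - destruct (le_dec m N); [|lia].
    destruct m as [|m]; unfold cosine_coeff.
    + replace (fun s => cos (INR 0 * s)) with (fun _ : R => 1); [rewrite mean_const; ring|].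
      apply functional_extensionality; intros s; simpl; rewrite Rmult_0_l, cos_0; auto.
    + rewrite mean_cos_cos; destruct (Nat.eq_dec (S m) (S m)); [|lia].
      destruct (Nat.eq_dec (S m) 0); [lia|field].
  - intros k Hk; destruct k as [|k]; unfold cosine_coeff.
    + rewrite mean_cos by lia; ring.
    + rewrite mean_cos_cos; destruct (Nat.eq_dec m (S k)); [lia|ring].
Qed.

(** Measuring distance by [cos] makes [v] a function of [cos t], hence even and periodic, as a
    function with a pure cosine expansion has to be. *)
Definition cos_lipschitz (L : R) (v : R -> R) : Prop :=
  forall s t, Rabs (v s - v t) <= L * Rabs (cos s - cos t).

Lemma cos_lipschitz_Cont (L : R) (v : R -> R) : cos_lipschitz L v -> Cont v.
Proof.
  intros H t; apply continuity_pt_filterlim; intros eps Heps.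
  destruct (continuity_cos t (eps / (Rabs L + 1))) as [d [Hd Hc]].
  { apply Rdiv_lt_0_compat; [lra|]; pose proof (Rabs_pos L); lra. }
  exists d; split; auto; intros s Hs; specialize (Hc s Hs).
  unfold dist in *; simpl in *; unfold R_dist in *.
  apply Rle_lt_trans with (1 := H s t).
  assert (Rabs (cos s - cos t) * (Rabs L + 1) < eps).
  { apply Rmult_lt_compat_r with (r := Rabs L + 1) in Hc; [|pose proof (Rabs_pos L); lra].
    unfold Rdiv in Hc; rewrite Rmult_assoc, Rinv_l, Rmult_1_r in Hc; auto.
    pose proof (Rabs_pos L); lra. }
  pose proof (Rle_abs L); pose proof (Rabs_pos (cos s - cos t)); nra.
Qed.

(* Korovkin's argument: it suffices to control the kernels on [1], [cos] and [cos ^ 2]. *)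
Lemma poisson_partial_error (L : R) (v : R -> R) (eps r t : R) (N : nat) :
  cos_lipschitz L v -> 0 < eps -> 0 <= r < 1 -> (2 <= N)%nat ->
  Rabs (sum_n (fun n => cosine_coeff v n * cos (INR n * t) * r ^ n) N - v t)
  <= eps + L ^ 2 / (4 * eps) * (2 * (1 - r))
     + 2 * (4 * r ^ (N + 1) / (1 - r) ^ 2) * (eps + L ^ 2 / (4 * eps) * 4).
Proof.
  intros HL Heps Hr HN; pose proof (cos_lipschitz_Cont L v HL) as Cv.
  pose proof (Cont_even_kernel r t N) as CQ; set (Q := even_kernel r t N) in *.
  set (d := 4 * r ^ (N + 1) / (1 - r) ^ 2).
  assert (Hd : 0 <= d).
  { unfold d, Rdiv; apply Rmult_le_pos; [apply Rmult_le_pos; [lra|apply pow_le; lra]|].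
    left; apply Rinv_0_lt_compat, pow_lt; lra. }
  (* Completing the square gives L y <= eps + c y^2. The Lipschitz modulus is thus replaced by the
     quadratic test function [w], whose mean against the kernel is explicit. *)
  set (c := L ^ 2 / (4 * eps)).
  assert (Hc : 0 <= c).
  { unfold c, Rdiv; apply Rmult_le_pos; [apply pow2_ge_0|left; apply Rinv_0_lt_compat; lra]. }
  set (w := fun s => eps + c * (cos s - cos t) ^ 2).
  assert (Cw : Cont w) by (unfold w; auto 8 with cont).
  assert (M0 : mean Q = 1).
  { pose proof (mean_cos_even_kernel 0 r t N ltac:(lia)) as E; fold Q in E; simpl in E.
    replace (fun s => cos (0 * s) * Q s) with Q in E; [rewrite Rmult_0_l, cos_0 in E; lra|].
    apply functional_extensionality; intros s; rewrite Rmult_0_l, cos_0; ring. }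
  assert (M1 : mean (fun s => cos (INR 1 * s) * Q s) = cos t * r).
  { pose proof (mean_cos_even_kernel 1 r t N ltac:(lia)) as E; fold Q in E; rewrite E.
    simpl; rewrite Rmult_1_l; ring. }
  assert (M2 : mean (fun s => cos (INR 2 * s) * Q s) = (2 * cos t ^ 2 - 1) * r ^ 2).
  { pose proof (mean_cos_even_kernel 2 r t N ltac:(lia)) as E; fold Q in E; rewrite E.
    replace (INR 2 * t) with (2 * t) by (simpl; ring); rewrite cos_2a_cos; ring. }
  assert (MwQ : mean (fun s => w s * Q s) <= eps + c * (2 * (1 - r))).
  { replace (fun s => w s * Q s) with (fun s => (eps + c * (cos t ^ 2 + / 2)) * Q s
      + (c * / 2 * (cos (INR 2 * s) * Q s) + - 2 * c * cos t * (cos (INR 1 * s) * Q s))).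
    - rewrite mean_plus, mean_plus, !mean_scal, M0, M1, M2 by auto 8 with cont.
      pose proof (COS_bound t) as B.
      assert (0 <= cos t ^ 2 <= 1) by nra.
      assert (cos t ^ 2 * (1 - r) ^ 2 <= 1 * (1 - r) ^ 2)
        by (apply Rmult_le_compat_r; [apply pow2_ge_0|lra]).
      assert (0 <= (1 - r) * (/ 2 + r * / 2)) by (apply Rmult_le_pos; lra).
      assert (cos t ^ 2 * (1 - r) ^ 2 + / 2 * (1 - r ^ 2) <= 2 * (1 - r)) by nra.
      assert (c * (cos t ^ 2 * (1 - r) ^ 2 + / 2 * (1 - r ^ 2)) <= c * (2 * (1 - r)))
        by (apply Rmult_le_compat_l; auto).
      apply Rle_trans with (eps + c * (cos t ^ 2 * (1 - r) ^ 2 + / 2 * (1 - r ^ 2))); [|lra].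
      right; field.
    - apply functional_extensionality; intros s; unfold w.
      replace (INR 2 * s) with (2 * s) by (simpl; ring); rewrite cos_2a_cos.
      replace (INR 1 * s) with s by (simpl; ring); field. }
  assert (Mw : mean w <= eps + c * 4).
  { rewrite <- (mean_const (eps + c * 4)); apply mean_le; auto with cont.
    intros s; unfold w; pose proof (COS_bound s); pose proof (COS_bound t).
    assert ((cos s - cos t) ^ 2 <= 4) by nra; nra. }
  assert (Hvw : forall s, Rabs (v s - v t) <= w s).
  { intros s; apply Rle_trans with (1 := HL s t); unfold w, c.
    rewrite <- (pow2_abs (cos s - cos t)); set (y := Rabs (cos s - cos t)).
    assert (0 <= (2 * eps - L * y) ^ 2 / (4 * eps)).
    { apply Rmult_le_pos; [apply pow2_ge_0|left; apply Rinv_0_lt_compat; lra]. }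
    replace ((2 * eps - L * y) ^ 2 / (4 * eps)) with (eps - L * y + L ^ 2 / (4 * eps) * y ^ 2)
      in H by (field; lra); lra. }
  assert (Hlow : forall s, 0 <= Q s + d).
  { intros s; pose proof (even_kernel_lower r t N s Hr); fold Q d in H; lra. }
  rewrite <- mean_even_kernel by auto; fold Q.
  replace (v t) with (v t * mean Q) by (rewrite M0; ring).
  rewrite <- mean_scal, <- mean_minus by auto with cont.
  (* Adding [d] makes the kernel nonnegative, so that |v - v t| <= w can be integrated against it;
     subtracting it again costs a second [d * mean w]. *)
  replace (fun s => v s * Q s - v t * Q s)
    with (fun s => (v s - v t) * (Q s + d) - d * (v s - v t))
    by (apply functional_extensionality; intros; ring).
  rewrite mean_minus, mean_scal by auto 8 with cont.
  assert (B1 : Rabs (mean (fun s => (v s - v t) * (Q s + d)))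
               <= mean (fun s => w s * Q s) + d * mean w).
  { rewrite <- mean_scal, <- mean_plus by auto with cont.
    apply mean_Rabs_le; auto 8 with cont; intros s.
    rewrite Rabs_mult, (Rabs_pos_eq (Q s + d)) by auto.
    specialize (Hlow s); specialize (Hvw s); nra. }
  assert (B2 : Rabs (mean (fun s => v s - v t)) <= mean w)
    by (apply mean_Rabs_le; auto with cont).
  apply Rabs_le_between in B1; apply Rabs_le_between in B2.
  assert (d * mean w <= d * (eps + c * 4)) by (apply Rmult_le_compat_l; auto).
  apply Rabs_le; nra.
Qed.

Lemma is_lim_seq_scal_pow_0 (r c : R) : 0 <= r < 1 -> is_lim_seq (fun n => c * r ^ n) 0.
Proof.
  intros Hr; replace (Finite 0) with (Rbar_mult c 0) by (simpl; f_equal; ring).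
  apply is_lim_seq_scal_l, is_lim_seq_geom; rewrite Rabs_pos_eq; lra.
Qed.

Lemma ex_series_cos_pow (h : nat -> R) (r t : R) : ex_series (fun n => Rabs (h n)) ->
  0 <= r <= 1 -> ex_series (fun n => Rabs (h n * cos (INR n * t) * r ^ n)).
Proof.
  intros Hh Hr; apply (ex_series_abs_le _ (fun n => Rabs (h n))); auto; intros n.
  rewrite Rmult_assoc; apply Rabs_mult_le_l; rewrite Rabs_mult.
  pose proof (pow_le_1 r n Hr); pose proof (Rabs_cos_le_1 (INR n * t)).
  rewrite (Rabs_pos_eq (r ^ n)) by lra; pose proof (Rabs_pos (cos (INR n * t))); nra.
Qed.

(** The Poisson mean of a nonnegative function: the negative part allowed by truncation tends to 0
    with N. This is the source of Re h >= 0 inside the disk. *)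
Lemma cosine_series_nonneg (L : R) (v : R -> R) (r t : R) : cos_lipschitz L v ->
  (forall s, 0 <= v s) -> ex_series (fun n => Rabs (cosine_coeff v n)) -> 0 <= r < 1 ->
  0 <= Series (fun n => cosine_coeff v n * cos (INR n * t) * r ^ n).
Proof.
  intros HL Hv Hs Hr; pose proof (cos_lipschitz_Cont L v HL) as Cv.
  apply (is_lim_seq_le (fun N => - (4 * / (1 - r) ^ 2 * mean v * r) * r ^ N)
    (sum_n (fun n => cosine_coeff v n * cos (INR n * t) * r ^ n)) 0
    (Series (fun n => cosine_coeff v n * cos (INR n * t) * r ^ n))).
  - intros N; rewrite <- mean_even_kernel by auto.
    apply Rle_trans with (mean (fun s => - (4 * r ^ (N + 1) / (1 - r) ^ 2) * v s)).
    + rewrite mean_scal by auto; replace (N + 1)%nat with (S N) by lia; simpl.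
      right; unfold Rdiv; ring.
    + pose proof (Cont_even_kernel r t N); apply mean_le; auto with cont; intros s.
      rewrite Rmult_comm; apply Rmult_le_compat_l; auto; apply even_kernel_lower; auto.
  - apply is_lim_seq_scal_pow_0; auto.
  - apply Series_correct, ex_series_Rabs, ex_series_cos_pow; auto; lra.
Qed.

(** For fixed r < 1 the truncation error vanishes as N grows; r close to 1 then controls both the
    smoothing error and the passage from Abel means to the series. *)
Lemma cosine_inversion (L : R) (v : R -> R) (t : R) : cos_lipschitz L v ->
  ex_series (fun n => Rabs (cosine_coeff v n)) ->
  Series (fun n => cosine_coeff v n * cos (INR n * t)) = v t.
Proof.
  intros HL Hs; apply Rminus_diag_uniq.
  set (S1 := Series (fun n => cosine_coeff v n * cos (INR n * t))).
  assert (Hex : ex_series (fun n => Rabs (cosine_coeff v n * cos (INR n * t)))).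
  { apply (ex_series_abs_le _ (fun n => Rabs (cosine_coeff v n))); auto; intros n.
    apply Rabs_mult_le_l, Rabs_cos_le_1. }
  assert (G : forall eps, 0 < eps -> Rabs (S1 - v t) <= 0 + eps).
  { intros eps Heps; set (c := L ^ 2 / (4 * (eps / 3))).
    assert (Hc : 0 <= c).
    { unfold c, Rdiv; apply Rmult_le_pos; [apply pow2_ge_0|left; apply Rinv_0_lt_compat; lra]. }
    destruct (abel_l1 _ (eps / 3) Hex ltac:(lra)) as [rho [Hrho Ha]].
    (* [x] is 1 - r. Its first bound puts r in the range provided by Abel's theorem, its second
       makes c (2 x) at most eps / 3; the 1 in the denominator covers c = 0. *)
    set (x := Rmin ((1 - rho) / 2) (eps / 3 / (2 * c + 1))).
    assert (Hx0 : 0 < x).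
    { unfold x; apply Rmin_glb_lt; [lra|apply Rdiv_lt_0_compat; lra]. }
    assert (Hx1 : x <= (1 - rho) / 2) by apply Rmin_l.
    assert (Hx2 : c * (2 * x) <= eps / 3).
    { apply Rle_trans with ((2 * c + 1) * x); [nra|].
      apply Rle_trans with ((2 * c + 1) * (eps / 3 / (2 * c + 1))).
      - apply Rmult_le_compat_l; [lra|apply Rmin_r].
      - right; field; lra. }
    set (r := 1 - x); assert (Hr : 0 <= r < 1) by (unfold r; lra).
    specialize (Ha r ltac:(unfold r; lra)).
    assert (B : Rabs (Series (fun n => cosine_coeff v n * cos (INR n * t) * r ^ n) - v t)
                <= eps / 3 + c * (2 * x)).
    { apply (is_lim_seq_le
        (fun N => Rabs (sum_n (fun n => cosine_coeff v n * cos (INR n * t) * r ^ n) (N + 2) - v t))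
        (fun N => eps / 3 + c * (2 * x)
          + 2 * (4 * r * r ^ 2 / (1 - r) ^ 2) * (eps / 3 + c * 4) * r ^ N)
        (Rabs (Series (fun n => cosine_coeff v n * cos (INR n * t) * r ^ n) - v t))
        (eps / 3 + c * (2 * x))).
      - intros N; pose proof (poisson_partial_error L v (eps / 3) r t (N + 2) HL
          ltac:(lra) Hr ltac:(lia)) as P; fold c in P.
        replace (1 - r) with x in P by (unfold r; ring).
        apply Rle_trans with (1 := P).
        replace (1 - r) with x by (unfold r; ring).
        replace (N + 2 + 1)%nat with (S (N + 2)) by lia; simpl; rewrite pow_add; right.
        unfold Rdiv; simpl; ring.
      - apply is_lim_seq_abs with (l := Finite _).
        apply is_lim_seq_minus'; [|apply is_lim_seq_const].
        apply (is_lim_seq_incr_n (sum_n (fun n => cosine_coeff v n * cos (INR n * t) * r ^ n)) 2).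
        apply Series_correct, ex_series_Rabs, ex_series_cos_pow; auto; lra.
      - replace (Finite (eps / 3 + c * (2 * x))) with (Finite (eps / 3 + c * (2 * x) + 0))
          by (f_equal; ring).
        apply is_lim_seq_plus'; [apply is_lim_seq_const|apply is_lim_seq_scal_pow_0; auto]. }
    fold S1 in Ha.
    apply Rabs_le_between in Ha; apply Rabs_le_between in B; apply Rabs_le; lra. }
  apply le_epsilon in G.
  pose proof (Rabs_pos (S1 - v t)); apply Rabs_eq_0; lra.
Qed.

(** The sign of [s] decides whether the bump sits around t = 0 or away from it. The last bound holds
    because the mean of a nonnegative function dominates its Fourier means; it serves to show that
    [h 0] is positive. *)
Lemma bump_cosine_series (s d : R) : exists h : nat -> R,
  rapid h /\
  (forall t, Series (fun n => h n * cos (INR n * t)) = bump 0 (s * cos t + d)) /\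
  (forall r t, 0 <= r < 1 -> 0 <= Series (fun n => h n * cos (INR n * t) * r ^ n)) /\
  (forall n, Rabs (h n) <= 2 * h 0%nat).
Proof.
  set (v := fun t => bump 0 (s * cos t + d)); exists (cosine_coeff v).
  destruct bump_lipschitz as [L [HL0 HL]].
  assert (Hlip : cos_lipschitz (L * Rabs s) v).
  { intros x y; unfold v; apply Rle_trans with (1 := HL _ _).
    replace (s * cos x + d - (s * cos y + d)) with (s * (cos x - cos y)) by ring.
    rewrite Rabs_mult; lra. }
  pose proof (cos_lipschitz_Cont _ _ Hlip) as Cv.
  assert (Hpos : forall t, 0 <= v t) by (intros; apply bump_ge_0).
  assert (Hrap : rapid (cosine_coeff v)).
  { intros p; destruct (fourier_decay p v) as [K HK].
    - intros n; apply Ck_bump_cos.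
    - intros t; unfold v; rewrite cos_plus, cos_2PI, sin_2PI; do 2 f_equal; ring.
    - exists (2 * K + Rabs (mean v)); intros [|n]; unfold cosine_coeff.
      + simpl INR; rewrite Rplus_0_l, pow1.
        destruct (HK 0%nat) as [H _]; simpl INR in H; rewrite Rplus_0_l, pow1 in H.
        pose proof (Rabs_pos (mean (fun t => v t * cos (0 * t)))); lra.
      + destruct (HK (S n)) as [H _]; rewrite Rabs_mult, (Rabs_pos_eq 2) by lra.
        pose proof (Rabs_pos (mean v)); lra. }
  pose proof (rapid_ex_series _ Hrap) as Hs.
  repeat split.
  - exact Hrap.
  - intros t; apply (cosine_inversion _ v t Hlip Hs).
  - intros r t Hr; apply (cosine_series_nonneg _ v r t Hlip); auto.
  - assert (0 <= mean v) by (rewrite <- (mean_const 0); apply mean_le; auto with cont).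
    intros [|n]; unfold cosine_coeff; [rewrite Rabs_pos_eq; lra|].
    rewrite Rabs_mult, (Rabs_pos_eq 2) by lra; apply Rmult_le_compat_l; [lra|].
    apply mean_Rabs_le; auto with cont; intros x.
    rewrite <- (Rabs_pos_eq (v x)) at 2 by auto; apply Rabs_mult_le_l, Rabs_cos_le_1.
Qed.

(** * The exponential of an absolutely convergent Taylor series *)

(** Course-of-values recursion: stage S p keeps the entries up to p and computes the entry p + 1.
    Beyond the stage number the entries are default values. *)
Fixpoint exp_coeff_upto (h : nat -> R) (n : nat) : nat -> R :=
  match n with
  | O => fun _ => exp (h 0%nat)
  | S p => fun m =>
      if le_dec m p then exp_coeff_upto h p m
      else sum_n (fun k => INR (S k) * h (S k) * exp_coeff_upto h p (p - k)%nat) p / INR (S p)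
  end.

(* Taylor coefficients of [exp (sum h_n z^n)], from the recursion [a' = h' a]. *)
Definition exp_coeff (h : nat -> R) (n : nat) : R := exp_coeff_upto h n n.

Lemma exp_coeff_upto_eq (h : nat -> R) (n m : nat) :
  (m <= n)%nat -> exp_coeff_upto h n m = exp_coeff h m.
Proof.
  induction n as [|n IH]; intros Hm.
  - replace m with 0%nat by lia; reflexivity.
  - destruct (Nat.eq_dec m (S n)) as [->|D]; [reflexivity|].
    simpl; destruct (le_dec m n); [apply IH; lia|lia].
Qed.

Lemma exp_coeff_succ (h : nat -> R) (n : nat) :
  INR (S n) * exp_coeff h (S n) = sum_n (fun k => INR (S k) * h (S k) * exp_coeff h (n - k)) n.
Proof.
  unfold exp_coeff at 1; cbn [exp_coeff_upto]; destruct (le_dec (S n) n); [lia|].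
  unfold Rdiv; rewrite (Rmult_comm _ (/ _)), <- Rmult_assoc, Rinv_r, Rmult_1_l
    by (apply not_0_INR; lia).
  apply sum_n_Rext; intros k; rewrite exp_coeff_upto_eq by lia; reflexivity.
Qed.

(** Summation over the triangle by columns; for nonnegative terms the triangle lies in the square,
    whence the product bound that follows. *)
Lemma sum_cauchy_product (x y : nat -> R) (N : nat) :
  sum_n (fun n => sum_n (fun k => x k * y (n - k)%nat) n) N
  = sum_n (fun k => x k * sum_n y (N - k)) N :> R.
Proof.
  induction N as [|N IH]; [rewrite !sum_n_0; reflexivity|].
  rewrite !sum_n_succ, IH, Nat.sub_diag, sum_n_0, <- Rplus_assoc; f_equal.
  rewrite <- sum_n_add.
  apply sum_n_Rext_loc; intros k Hk.
  replace (S N - k)%nat with (S (N - k)) by lia; rewrite sum_n_succ.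
  change (x k * sum_n y (N - k) + x k * y (S (N - k))
          = x k * (sum_n y (N - k) + y (S (N - k)))); ring.
Qed.

Lemma sum_cauchy_product_le (x y : nat -> R) (N : nat) :
  (forall k, 0 <= x k) -> (forall k, 0 <= y k) ->
  sum_n (fun n => sum_n (fun k => x k * y (n - k)%nat) n) N <= sum_n x N * sum_n y N.
Proof.
  intros Hx Hy; rewrite sum_cauchy_product, Rmult_comm, <- sum_n_scal.
  apply sum_n_le_compat; intros k Hk; rewrite Rmult_comm.
  apply Rmult_le_compat_r; auto; apply sum_n_mono; auto; lia.
Qed.

Lemma exp_coeff_nonneg (h : nat -> R) : (forall n, 0 <= h n) -> forall n, 0 <= exp_coeff h n.
Proof.
  intros H; apply (well_founded_induction lt_wf); intros [|n] IH.
  - left; apply exp_pos.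
  - apply Rmult_le_reg_l with (INR (S n)); [apply lt_0_INR; lia|].
    rewrite Rmult_0_r, exp_coeff_succ, <- (Rmult_0_r (sum_n (fun _ => 0) n)).
    apply Rle_trans with (sum_n (fun _ : nat => 0) n).
    + rewrite Rmult_0_r; apply sum_n_nonneg; intros; lra.
    + apply sum_n_le_compat; intros k Hk.
      repeat apply Rmult_le_pos; [apply pos_INR|apply H|apply IH; lia].
Qed.

(** Majorisation: apart from [h] and earlier entries, the recursion contains only nonnegative
    factors. *)
Lemma exp_coeff_abs (h : nat -> R) (n : nat) :
  Rabs (exp_coeff h n) <= exp_coeff (fun k => Rabs (h k)) n.
Proof.
  revert n; apply (well_founded_induction lt_wf); intros [|n] IH.
  - unfold exp_coeff; simpl; rewrite Rabs_pos_eq by (left; apply exp_pos).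
    destruct (Rle_abs (h 0%nat)) as [L|E]; [left; apply exp_increasing; auto|rewrite <- E; lra].
  - apply Rmult_le_reg_l with (INR (S n)); [apply lt_0_INR; lia|].
    rewrite <- (Rabs_pos_eq (INR (S n))) at 1 by apply pos_INR.
    rewrite <- Rabs_mult, !exp_coeff_succ.
    eapply Rle_trans; [apply Rabs_sum_n_le|]; apply sum_n_le_compat; intros k Hk.
    rewrite !Rabs_mult, (Rabs_pos_eq (INR (S k))) by apply pos_INR.
    apply Rmult_le_compat_l; [|apply IH; lia].
    apply Rmult_le_pos; [apply pos_INR|apply Rabs_pos].
Qed.

Lemma is_derive_polynomial (c : nat -> R) (N : nat) (x : R) :
  is_derive (fun r => sum_n (fun n => c n * r ^ n) (S N)) x
    (sum_n (fun n => INR (S n) * c (S n) * x ^ n) N).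
Proof.
  assert (T : forall n, is_derive (fun r => c n * r ^ n) x (INR n * c n * x ^ Nat.pred n)).
  { intros n; auto_derive; auto; ring. }
  induction N as [|N IH].
  - apply (is_derive_ext (fun r => c 0%nat + c 1%nat * r ^ 1)).
    { intros r; rewrite sum_n_succ, sum_n_0; simpl; ring. }
    rewrite sum_n_0; auto_derive; auto; simpl; ring.
  - apply (is_derive_ext (fun r => sum_n (fun n => c n * r ^ n) (S N) + c (S (S N)) * r ^ S (S N))).
    { intros r; symmetry; apply sum_n_succ. }
    rewrite sum_n_succ.
    exact (is_derive_plus (V := R_NormedModule) _ _ x _ _ IH (T (S (S N)))).
Qed.

(** As polynomials in r the truncated sums satisfy Sa' <= Sb' Sa for r >= 0, because the Cauchy
    product has only nonnegative terms. Hence Sa exp (- Sb) does not increase on [0, 1], and it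
    starts at 1. *)
Lemma exp_coeff_sum_le (b : nat -> R) (N : nat) : (forall n, 0 <= b n) ->
  sum_n (exp_coeff b) N <= exp (sum_n b N).
Proof.
  intros Hb; pose proof (exp_coeff_nonneg b Hb) as Ha.
  destruct N as [|N]; [rewrite !sum_n_0; apply Rle_refl|].
  set (a := exp_coeff b) in *.
  set (Sa := fun r => sum_n (fun n => a n * r ^ n) (S N)).
  set (Sb := fun r => sum_n (fun n => b n * r ^ n) (S N)).
  set (Sa' := fun r => sum_n (fun n => INR (S n) * a (S n) * r ^ n) N).
  set (Sb' := fun r => sum_n (fun n => INR (S n) * b (S n) * r ^ n) N).
  assert (D : forall r, is_derive (fun r => Sa r * exp (- Sb r)) r
    ((Sa' r - Sb' r * Sa r) * exp (- Sb r))).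
  { intros r; pose proof (is_derive_polynomial a N r : is_derive Sa r (Sa' r)) as Da.
    pose proof (is_derive_polynomial b N r : is_derive Sb r (Sb' r)) as Db.
    auto_derive; [split; [exists (Sa' r); auto|split; auto; exists (Sb' r); auto]|].
    replace (Derive (fun x => Sa x) r) with (Sa' r) by (symmetry; apply is_derive_unique, Da).
    replace (Derive (fun x => Sb x) r) with (Sb' r) by (symmetry; apply is_derive_unique, Db).
    ring. }
  assert (Hle : forall r, 0 <= r -> Sa' r <= Sb' r * Sa r).
  { intros r Hr.
    apply Rle_trans with (sum_n (fun k => INR (S k) * b (S k) * r ^ k) N
      * sum_n (fun k => a k * r ^ k) N).
    - eapply Rle_trans; [|apply sum_cauchy_product_le].
      + apply sum_n_le_compat; intros n _; unfold a; rewrite exp_coeff_succ, Rmult_comm, <- sum_n_scal.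
        apply sum_n_le_compat; intros k Hk.
        replace (r ^ n) with (r ^ k * r ^ (n - k)) by (rewrite <- pow_add; f_equal; lia).
        right; ring.
      + intros k; repeat apply Rmult_le_pos; auto using pos_INR, pow_le.
      + intros k; apply Rmult_le_pos; auto using pow_le.
    - apply Rmult_le_compat_l.
      + apply sum_n_nonneg; intros k; repeat apply Rmult_le_pos; auto using pos_INR, pow_le.
      + apply sum_n_mono; [|lia]; intros k; apply Rmult_le_pos; auto using pow_le. }
  destruct (MVT_gen (fun r => Sa r * exp (- Sb r)) 0 1 _ (fun r _ => D r)) as [c [Hc E]].
  { intros r _; apply continuity_pt_filterlim.
    apply (ex_derive_continuous (V := R_NormedModule) (fun r => Sa r * exp (- Sb r)) r).
    eexists; apply D. }
  rewrite Rmin_left, Rmax_right in Hc by lra.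
  assert (Z : forall x : nat -> R, sum_n (fun n => x n * 0 ^ n) (S N) = x 0%nat :> R).
  { intros x; rewrite (sum_n_single _ 0); simpl; [ring|].
    intros [|k] Hk; [lia|simpl; ring]. }
  assert (O : forall x : nat -> R, sum_n (fun n => x n * 1 ^ n) (S N) = sum_n x (S N) :> R).
  { intros x; apply sum_n_Rext; intros n; rewrite pow1; ring. }
  unfold Sa at 1, Sb at 1, Sa at 1, Sb at 1 in E; rewrite !Z, !O in E.
  assert (E0 : a 0%nat * exp (- b 0%nat) = 1).
  { unfold a, exp_coeff; simpl; rewrite <- exp_plus, Rplus_opp_r; apply exp_0. }
  rewrite E0 in E; specialize (Hle c ltac:(lra)); pose proof (exp_pos (- Sb c)) as Hp.
  assert (B : sum_n a (S N) * exp (- sum_n b (S N)) <= 1) by nra.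
  apply Rmult_le_compat_r with (r := exp (sum_n b (S N))) in B; [|left; apply exp_pos].
  rewrite Rmult_assoc, <- exp_plus, Rplus_opp_l, exp_0 in B; lra.
Qed.

Lemma exp_coeff_l1 (h : nat -> R) : ex_series (fun n => Rabs (h n)) ->
  ex_series (fun n => Rabs (exp_coeff h n)) /\
  Series (fun n => Rabs (exp_coeff h n)) <= exp (Series (fun n => Rabs (h n))).
Proof.
  intros Hh; apply nonneg_series_bounded; [intros; apply Rabs_pos|]; intros N.
  apply Rle_trans with (sum_n (exp_coeff (fun k => Rabs (h k))) N).
  { apply sum_n_le_compat; intros; apply exp_coeff_abs. }
  eapply Rle_trans; [apply exp_coeff_sum_le; intros; apply Rabs_pos|].
  assert (L : sum_n (fun n => Rabs (h n)) N <= Series (fun n => Rabs (h n)))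
    by (apply sum_n_le_Series; auto; intros; apply Rabs_pos).
  destruct L as [L|E]; [left; apply exp_increasing; auto|rewrite E; apply Rle_refl].
Qed.

Lemma l1_CV_radius (a : nat -> R) (r : R) : ex_series (fun n => Rabs (a n)) -> Rabs r < 1 ->
  Rbar_lt (Rabs r) (CV_radius a).
Proof.
  intros Ha Hr; apply Rbar_lt_le_trans with 1; [exact Hr|].
  apply (proj1 (CV_radius_bounded a)).
  exists (Series (fun n => Rabs (a n))); intros n; rewrite pow1, Rmult_1_r.
  apply Rle_trans with (sum_n (fun n => Rabs (a n)) n).
  - apply (sum_n_term_le (fun n => Rabs (a n))); auto; intros; apply Rabs_pos.
  - apply sum_n_le_Series; auto; intros; apply Rabs_pos.
Qed.

(** With [sin_coeff], the real and imaginary parts of a_n e^{int}: as power series in r they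
    describe the function along the ray of angle t, and their plain sums give its boundary value. *)
Definition cos_coeff (a : nat -> R) (t : R) (n : nat) : R := a n * cos (INR n * t).
Definition sin_coeff (a : nat -> R) (t : R) (n : nat) : R := a n * sin (INR n * t).

Lemma ex_series_cos_coeff (a : nat -> R) (t : R) :
  ex_series (fun n => Rabs (a n)) -> ex_series (fun n => Rabs (cos_coeff a t n)).
Proof.
  intros Ha; apply (ex_series_abs_le _ (fun n => Rabs (a n))); auto.
  intros n; apply Rabs_mult_le_l, Rabs_cos_le_1.
Qed.

Lemma ex_series_sin_coeff (a : nat -> R) (t : R) :
  ex_series (fun n => Rabs (a n)) -> ex_series (fun n => Rabs (sin_coeff a t n)).
Proof.
  intros Ha; apply (ex_series_abs_le _ (fun n => Rabs (a n))); auto.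
  intros n; apply Rabs_mult_le_l, Rabs_sin_le_1.
Qed.

(** Real and imaginary parts of Phi' = H' Phi, differentiated in r along a ray, for Phi = exp H.
    [PS_derive] shifts the index, so the two factors carry the angles (k + 1) t and (n - k) t, whose
    sum is (n + 1) t. *)
Lemma exp_coeff_derive (h : nat -> R) (t r : R) :
  ex_series (fun n => Rabs (h n)) -> Rabs r < 1 ->
  PSeries (PS_derive (cos_coeff (exp_coeff h) t)) r
    = PSeries (PS_derive (cos_coeff h t)) r * PSeries (cos_coeff (exp_coeff h) t) r
      - PSeries (PS_derive (sin_coeff h t)) r * PSeries (sin_coeff (exp_coeff h) t) r /\
  PSeries (PS_derive (sin_coeff (exp_coeff h) t)) r
    = PSeries (PS_derive (cos_coeff h t)) r * PSeries (sin_coeff (exp_coeff h) t) r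
      + PSeries (PS_derive (sin_coeff h t)) r * PSeries (cos_coeff (exp_coeff h) t) r.
Proof.
  intros Hh Hr; pose proof (proj1 (exp_coeff_l1 h Hh)) as Ha; set (a := exp_coeff h) in *.
  pose proof (l1_CV_radius _ r (ex_series_cos_coeff h t Hh) Hr) as R1.
  pose proof (l1_CV_radius _ r (ex_series_sin_coeff h t Hh) Hr) as R2.
  pose proof (l1_CV_radius _ r (ex_series_cos_coeff a t Ha) Hr) as R3.
  pose proof (l1_CV_radius _ r (ex_series_sin_coeff a t Ha) Hr) as R4.
  rewrite <- CV_radius_derive in R1, R2.
  assert (X : forall u v, Rbar_lt (Rabs r) (CV_radius u) -> Rbar_lt (Rabs r) (CV_radius v) ->
    ex_pseries (PS_mult u v) r).
  { intros u v Hu Hv; apply ex_pseries_mult; auto. }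
  split.
  - rewrite <- !PSeries_mult by auto.
    rewrite <- PSeries_minus by auto.
    apply PSeries_ext; intros n.
    unfold PS_derive at 1, cos_coeff at 1.
    rewrite <- Rmult_assoc; unfold a at 1; rewrite exp_coeff_succ; fold a.
    unfold PS_minus, PS_opp, PS_plus, PS_mult; rewrite <- !sum_n_Reals.
    change (sum_n (fun k => INR (S k) * h (S k) * a (n - k)%nat) n * cos (INR (S n) * t)
      = sum_n (fun k => PS_derive (cos_coeff h t) k * cos_coeff a t (n - k)) n
        + - sum_n (fun k => PS_derive (sin_coeff h t) k * sin_coeff a t (n - k)) n).
    replace (- sum_n (fun k => PS_derive (sin_coeff h t) k * sin_coeff a t (n - k)) n)
      with (-1 * sum_n (fun k => PS_derive (sin_coeff h t) k * sin_coeff a t (n - k)) n) by ring.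
    rewrite Rmult_comm, <- !sum_n_scal, <- sum_n_add.
    apply sum_n_Rext_loc; intros k Hk.
    unfold PS_derive, cos_coeff, sin_coeff.
    replace (INR (S n) * t) with (INR (S k) * t + INR (n - k) * t)
      by (rewrite minus_INR, !S_INR by lia; ring).
    rewrite cos_plus; ring.
  - rewrite <- !PSeries_mult by auto.
    rewrite <- PSeries_plus by auto.
    apply PSeries_ext; intros n.
    unfold PS_derive at 1, sin_coeff at 1.
    rewrite <- Rmult_assoc; unfold a at 1; rewrite exp_coeff_succ; fold a.
    unfold PS_plus, PS_mult; rewrite <- !sum_n_Reals.
    change (sum_n (fun k => INR (S k) * h (S k) * a (n - k)%nat) n * sin (INR (S n) * t)
      = sum_n (fun k => PS_derive (cos_coeff h t) k * sin_coeff a t (n - k)) n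
        + sum_n (fun k => PS_derive (sin_coeff h t) k * cos_coeff a t (n - k)) n).
    rewrite Rmult_comm, <- !sum_n_scal, <- sum_n_add.
    apply sum_n_Rext_loc; intros k Hk.
    unfold PS_derive, cos_coeff, sin_coeff.
    replace (INR (S n) * t) with (INR (S k) * t + INR (n - k) * t)
      by (rewrite minus_INR, !S_INR by lia; ring).
    rewrite sin_plus; ring.
Qed.

(** Along a ray, exp (- H) Phi has derivative 0, and its value at the centre is 1. *)
Lemma exp_coeff_disk (h : nat -> R) (t r : R) : ex_series (fun n => Rabs (h n)) -> 0 <= r < 1 ->
  PSeries (cos_coeff (exp_coeff h) t) r
    = exp (PSeries (cos_coeff h t) r) * cos (PSeries (sin_coeff h t) r) /\
  PSeries (sin_coeff (exp_coeff h) t) r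
    = exp (PSeries (cos_coeff h t) r) * sin (PSeries (sin_coeff h t) r).
Proof.
  intros Hh Hr; pose proof (proj1 (exp_coeff_l1 h Hh)) as Ha.
  set (U := PSeries (cos_coeff h t)); set (V := PSeries (sin_coeff h t)).
  set (X := PSeries (cos_coeff (exp_coeff h) t)); set (Y := PSeries (sin_coeff (exp_coeff h) t)).
  set (U' := PSeries (PS_derive (cos_coeff h t))); set (V' := PSeries (PS_derive (sin_coeff h t))).
  assert (D : forall x, Rabs x < 1 ->
    is_derive U x (U' x) /\ is_derive V x (V' x) /\
    is_derive X x (U' x * X x - V' x * Y x) /\ is_derive Y x (U' x * Y x + V' x * X x)).
  { intros x Hx; destruct (exp_coeff_derive h t x Hh Hx) as [E1 E2].
    unfold U', V', X, Y; rewrite <- E1, <- E2.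
    repeat split; apply is_derive_PSeries, l1_CV_radius; auto;
      (apply ex_series_cos_coeff || apply ex_series_sin_coeff); auto. }
  assert (Dp : forall x, Rabs x < 1 ->
    is_derive (fun x => exp (- U x) * (X x * cos (V x) + Y x * sin (V x))) x 0 /\
    is_derive (fun x => exp (- U x) * (Y x * cos (V x) - X x * sin (V x))) x 0).
  { intros x Hx; destruct (D x Hx) as [DU [DV [DX DY]]].
    pose proof (is_derive_unique _ _ _ DU) as EU; pose proof (is_derive_unique _ _ _ DV) as EV.
    pose proof (is_derive_unique _ _ _ DX) as EX; pose proof (is_derive_unique _ _ _ DY) as EY.
    split; auto_derive;
      try (repeat split; eexists; eassumption);
      change (fun x => U x) with U; change (fun x => V x) with V;
      change (fun x => X x) with X; change (fun x => Y x) with Y;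
      rewrite EU, EV, EX, EY; ring. }
  assert (Cst : forall f : R -> R, (forall x, Rabs x < 1 -> is_derive f x 0) -> f r = f 0).
  { intros f Hf; destruct (MVT_gen f 0 r (fun _ => 0)) as [c [_ E]].
    - intros x Hx; rewrite Rmin_left, Rmax_right in Hx by lra; apply Hf, Rabs_lt_between; lra.
    - intros x Hx; rewrite Rmin_left, Rmax_right in Hx by lra.
      apply continuity_pt_filterlim.
      apply (ex_derive_continuous (V := R_NormedModule) f x); exists 0.
      apply Hf, Rabs_lt_between; lra.
    - lra. }
  pose proof (Cst _ (fun x Hx => proj1 (Dp x Hx))) as E1.
  pose proof (Cst _ (fun x Hx => proj2 (Dp x Hx))) as E2.
  simpl in E1, E2.
  assert (U0 : U 0 = h 0%nat) by (unfold U; rewrite PSeries_0; unfold cos_coeff; simpl;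
    rewrite Rmult_0_l, cos_0; ring).
  assert (V0 : V 0 = 0) by (unfold V; rewrite PSeries_0; unfold sin_coeff; simpl;
    rewrite Rmult_0_l, sin_0; ring).
  assert (X0 : X 0 = exp (h 0%nat)) by (unfold X; rewrite PSeries_0; unfold cos_coeff; simpl;
    rewrite Rmult_0_l, cos_0; unfold exp_coeff; simpl; ring).
  assert (Y0 : Y 0 = 0) by (unfold Y; rewrite PSeries_0; unfold sin_coeff; simpl;
    rewrite Rmult_0_l, sin_0; ring).
  rewrite U0, V0, X0, Y0, cos_0, sin_0 in E1, E2.
  assert (Z : exp (- h 0%nat) * exp (h 0%nat) = 1) by (rewrite <- exp_plus, Rplus_opp_l; apply exp_0).
  assert (ZU : exp (U r) * exp (- U r) = 1) by (rewrite <- exp_plus, Rplus_opp_r; apply exp_0).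
  assert (F1 : X r * cos (V r) + Y r * sin (V r) = exp (U r)).
  { transitivity (exp (U r) * exp (- U r) * (X r * cos (V r) + Y r * sin (V r)));
      [rewrite ZU; ring|].
    rewrite Rmult_assoc, E1.
    replace (exp (- h 0%nat) * (exp (h 0%nat) * 1 + 0 * 0)) with (exp (- h 0%nat) * exp (h 0%nat))
      by ring; rewrite Z; ring. }
  assert (F2 : Y r * cos (V r) - X r * sin (V r) = 0).
  { transitivity (exp (U r) * exp (- U r) * (Y r * cos (V r) - X r * sin (V r)));
      [rewrite ZU; ring|].
    rewrite Rmult_assoc, E2; ring. }
  (* [F1] and [F2] say that e^{-iV} (X + iY) = e^U; rotating back by e^{iV} isolates X and Y. *)
  pose proof (sin2_cos2 (V r)) as S2; unfold Rsqr in S2; split.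
  - transitivity (X r * (sin (V r) * sin (V r) + cos (V r) * cos (V r))); [rewrite S2; ring|].
    rewrite <- F1; replace (X r * (sin (V r) * sin (V r) + cos (V r) * cos (V r))) with
      ((X r * cos (V r) + Y r * sin (V r)) * cos (V r)
       - (Y r * cos (V r) - X r * sin (V r)) * sin (V r)) by ring.
    rewrite F2; ring.
  - transitivity (Y r * (sin (V r) * sin (V r) + cos (V r) * cos (V r))); [rewrite S2; ring|].
    rewrite <- F1; replace (Y r * (sin (V r) * sin (V r) + cos (V r) * cos (V r))) with
      ((X r * cos (V r) + Y r * sin (V r)) * sin (V r)
       + (Y r * cos (V r) - X r * sin (V r)) * cos (V r)) by ring.
    rewrite F2; ring.
Qed.

Lemma abel_seq (a : nat -> R) : ex_series (fun n => Rabs (a n)) ->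
  is_lim_seq (fun m => PSeries a (1 - / (INR m + 2))) (Series a).
Proof.
  intros Ha; apply is_lim_seq_spec; intros eps; simpl.
  destruct (abel_l1 a (eps / 2) Ha) as [rho [Hrho H]]; [destruct eps; simpl; lra|].
  destruct (archimed_cor1 (1 - rho)) as [N [HN HN0]]; [lra|].
  exists N; intros m Hm; apply Rle_lt_trans with (eps / 2); [|destruct eps; simpl; lra].
  assert (0 < INR N) by (apply lt_0_INR; auto).
  assert (INR N <= INR m) by (apply le_INR; auto).
  apply H; split; [|assert (0 < / (INR m + 2)) by (apply Rinv_0_lt_compat; lra); lra].
  assert (/ (INR m + 2) < / INR N) by (apply Rinv_lt_contravar; [apply Rmult_lt_0_compat|]; lra).
  lra.
Qed.

(** The identity in the disk at radius 1 - 1 / (m + 2), with all four series passing to the limit by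
    Abel's theorem. *)
Lemma exp_coeff_circle (h : nat -> R) (t : R) : ex_series (fun n => Rabs (h n)) ->
  Series (cos_coeff (exp_coeff h) t)
    = exp (Series (cos_coeff h t)) * cos (Series (sin_coeff h t)) /\
  Series (sin_coeff (exp_coeff h) t)
    = exp (Series (cos_coeff h t)) * sin (Series (sin_coeff h t)).
Proof.
  intros Hh; pose proof (proj1 (exp_coeff_l1 h Hh)) as Ha.
  assert (Hm : forall m, 0 <= 1 - / (INR m + 2) < 1).
  { intros m; pose proof (pos_INR m).
    assert (0 < / (INR m + 2)) by (apply Rinv_0_lt_compat; lra).
    assert (/ (INR m + 2) <= / 1) by (apply Rinv_le_contravar; lra); lra. }
  pose proof (abel_seq _ (ex_series_cos_coeff h t Hh)) as LU.
  pose proof (abel_seq _ (ex_series_sin_coeff h t Hh)) as LV.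
  pose proof (abel_seq _ (ex_series_cos_coeff _ t Ha)) as LX.
  pose proof (abel_seq _ (ex_series_sin_coeff _ t Ha)) as LY.
  assert (LE : is_lim_seq (fun m => exp (PSeries (cos_coeff h t) (1 - / (INR m + 2))))
    (exp (Series (cos_coeff h t)))).
  { apply is_lim_seq_continuous; auto; apply derivable_continuous_pt, derivable_pt_exp. }
  split.
  - assert (L : is_lim_seq (fun m => PSeries (cos_coeff (exp_coeff h) t) (1 - / (INR m + 2)))
      (exp (Series (cos_coeff h t)) * cos (Series (sin_coeff h t)))).
    { eapply is_lim_seq_ext.
      - intros m; symmetry; apply (exp_coeff_disk h t _ Hh (Hm m)).
      - apply is_lim_seq_mult'; auto.
        apply is_lim_seq_continuous; auto; apply continuity_cos. }
    apply is_lim_seq_unique in L; apply is_lim_seq_unique in LX.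
    rewrite LX in L; injection L; auto.
  - assert (L : is_lim_seq (fun m => PSeries (sin_coeff (exp_coeff h) t) (1 - / (INR m + 2)))
      (exp (Series (cos_coeff h t)) * sin (Series (sin_coeff h t)))).
    { eapply is_lim_seq_ext.
      - intros m; symmetry; apply (exp_coeff_disk h t _ Hh (Hm m)).
      - apply is_lim_seq_mult'; auto.
        apply is_lim_seq_continuous; auto; apply continuity_sin. }
    apply is_lim_seq_unique in L; apply is_lim_seq_unique in LY.
    rewrite LY in L; injection L; auto.
Qed.

(** * Real square-summable sequences and Toeplitz operators *)

(** A bound on all partial sums carries convergence with it and is stable under coordinatewise
    limits. *)
Definition l2_le (x : nat -> R) (M : R) : Prop :=
  forall K, sum_n (fun k => x k ^ 2) K <= M ^ 2.

Lemma l2_le_weaken (x : nat -> R) (M N : R) : 0 <= M <= N -> l2_le x M -> l2_le x N.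
Proof.
  intros H Hx K; apply Rle_trans with (1 := Hx K); apply pow_incr; auto.
Qed.

Lemma l2_le_ext (x y : nat -> R) (M : R) : (forall k, x k = y k) -> l2_le x M -> l2_le y M.
Proof.
  intros E H K; rewrite <- (sum_n_Rext (fun k => x k ^ 2)); [apply H|].
  intros k; rewrite E; reflexivity.
Qed.

Lemma l2_le_coord (x : nat -> R) (M : R) (k : nat) : 0 <= M -> l2_le x M -> Rabs (x k) <= M.
Proof.
  intros HM H; apply Rsqr_incr_0_var; auto.
  rewrite <- Rsqr_abs; unfold Rsqr.
  pose proof (sum_n_term_le (fun k => x k ^ 2) k k (fun i => pow2_ge_0 _) (le_n k)) as L.
  specialize (H k); cbv beta in L; simpl pow in *; lra.
Qed.

Lemma l2_le_scal (c : R) (x : nat -> R) (M : R) : l2_le x M -> l2_le (fun k => c * x k) (Rabs c * M).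
Proof.
  intros H K; rewrite (sum_n_Rext _ (fun k => c ^ 2 * x k ^ 2)) by (intros; ring).
  rewrite sum_n_scal, Rpow_mult_distr, pow2_abs.
  apply Rmult_le_compat_l; [apply pow2_ge_0|apply H].
Qed.

(** Minkowski's inequality from (x + y)^2 <= (1 + N / M) x^2 + (1 + M / N) y^2, whose weights make
    the bounds add up to (M + N)^2. The divisions force the separate treatment of a zero bound. *)
Lemma l2_le_plus (x y : nat -> R) (M N : R) : 0 <= M -> 0 <= N ->
  l2_le x M -> l2_le y N -> l2_le (fun k => x k + y k) (M + N).
Proof.
  assert (Z : forall z, l2_le z 0 -> forall k, z k = 0).
  { intros z Hz k; pose proof (l2_le_coord z 0 k (Rle_refl 0) Hz).
    apply Rabs_eq_0; pose proof (Rabs_pos (z k)); lra. }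
  intros HM HN Hx Hy; destruct (Req_dec M 0) as [->|HM0].
  { rewrite Rplus_0_l; apply (l2_le_ext y); auto; intros k; rewrite (Z x Hx k); ring. }
  destruct (Req_dec N 0) as [->|HN0].
  { rewrite Rplus_0_r; apply (l2_le_ext x); auto; intros k; rewrite (Z y Hy k); ring. }
  intros K.
  apply Rle_trans with (sum_n (fun k => (1 + N / M) * x k ^ 2 + (1 + M / N) * y k ^ 2) K).
  - apply sum_n_le_compat; intros k _.
    assert (0 <= (N * x k - M * y k) ^ 2 / (M * N)).
    { apply Rmult_le_pos; [apply pow2_ge_0|left; apply Rinv_0_lt_compat; nra]. }
    replace ((N * x k - M * y k) ^ 2 / (M * N)) with
      (N / M * x k ^ 2 + M / N * y k ^ 2 - 2 * x k * y k) in H by (field; lra).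
    nra.
  - rewrite sum_n_add, !sum_n_scal.
    assert (0 <= N / M) by (apply Rmult_le_pos; [|left; apply Rinv_0_lt_compat]; lra).
    assert (0 <= M / N) by (apply Rmult_le_pos; [|left; apply Rinv_0_lt_compat]; lra).
    apply Rle_trans with ((1 + N / M) * M ^ 2 + (1 + M / N) * N ^ 2).
    + apply Rplus_le_compat; apply Rmult_le_compat_l; auto; lra.
    + right; field; lra.
Qed.

Lemma l2_le_shift (j : nat) : forall x M, l2_le x M -> l2_le (fun k => x (j + k)%nat) M.
Proof.
  induction j as [|j IH]; intros x M H; [exact H|].
  apply (IH (fun i => x (S i))); intros K.
  assert (E : forall N, sum_n (fun k => x k ^ 2) (S N) = x 0%nat ^ 2 + sum_n (fun k => x (S k) ^ 2) N :> R).
  { induction N as [|N IHN]; [rewrite sum_n_succ, !sum_n_0; reflexivity|].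
    rewrite sum_n_succ, IHN, sum_n_succ; ring. }
  specialize (H (S K)); rewrite E in H; pose proof (pow2_ge_0 (x 0%nat)); lra.
Qed.

(** Multiplication by z^j on the level of coefficients; its adjoint is the j-fold backward shift. *)
Definition unshift (j : nat) (x : nat -> R) (k : nat) : R :=
  if le_dec j k then x (k - j)%nat else 0.

Lemma l2_le_unshift (j : nat) (x : nat -> R) (M : R) : l2_le x M -> l2_le (unshift j x) M.
Proof.
  intros H K.
  assert (E : forall N, sum_n (fun k => unshift j x k ^ 2) N
    = (if le_dec j N then sum_n (fun k => x k ^ 2) (N - j) else 0) :> R).
  { unfold unshift; induction N as [|N IH].
    - rewrite sum_n_0; destruct (le_dec j 0); [|ring].
      replace (0 - j)%nat with 0%nat by lia; rewrite sum_n_0; reflexivity.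
    - rewrite sum_n_succ, IH; destruct (le_dec j N), (le_dec j (S N)); try lia; try ring.
      + replace (S N - j)%nat with (S (N - j)) by lia; rewrite sum_n_succ; reflexivity.
      + replace (S N - j)%nat with 0%nat by lia; rewrite sum_n_0; ring. }
  rewrite E; destruct (le_dec j K); [apply H|apply pow2_ge_0].
Qed.

Lemma is_lim_seq_sum_n (X : nat -> nat -> R) (x : nat -> R) (K : nat) :
  (forall k, is_lim_seq (fun j => X j k) (x k)) ->
  is_lim_seq (fun j => sum_n (X j) K) (sum_n x K).
Proof.
  intros H; induction K as [|K IH].
  - rewrite sum_n_0; apply (is_lim_seq_ext (fun j => X j 0%nat)); auto.
    intros j; rewrite sum_n_0; reflexivity.
  - rewrite sum_n_succ; apply (is_lim_seq_ext (fun j => sum_n (X j) K + X j (S K))).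
    { intros j; rewrite sum_n_succ; reflexivity. }
    apply is_lim_seq_plus'; auto.
Qed.

(** A partial sum involves finitely many coordinates and so inherits the bound. Norm bounds reach
    infinite sums in this way without norm convergence. *)
Lemma l2_le_lim (X : nat -> nat -> R) (x : nat -> R) (M : R) :
  (forall k, is_lim_seq (fun j => X j k) (x k)) -> (forall j, l2_le (X j) M) -> l2_le x M.
Proof.
  intros H HX K.
  apply (is_lim_seq_le (fun j => sum_n (fun k => X j k ^ 2) K) (fun _ => M ^ 2)
    (sum_n (fun k => x k ^ 2) K) (M ^ 2)).
  - intros j; apply HX.
  - apply (is_lim_seq_sum_n (fun j k => X j k ^ 2) (fun k => x k ^ 2)); intros k.
    simpl; apply is_lim_seq_mult'; auto; apply is_lim_seq_mult'; auto; apply is_lim_seq_const.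
  - apply is_lim_seq_const.
Qed.

Lemma l2_le_series (x : nat -> R) (M : R) : l2_le x M ->
  ex_series (fun k => x k ^ 2) /\ Series (fun k => x k ^ 2) <= M ^ 2.
Proof. intros H; apply nonneg_series_bounded; auto; intros; apply pow2_ge_0. Qed.

Lemma series_l2_le (x : nat -> R) : ex_series (fun k => x k ^ 2) ->
  l2_le x (sqrt (Series (fun k => x k ^ 2))).
Proof.
  intros H K.
  assert (L : sum_n (fun k => x k ^ 2) K <= Series (fun k => x k ^ 2))
    by (apply sum_n_le_Series; auto; intros; apply pow2_ge_0).
  rewrite pow2_sqrt; auto.
  apply Rle_trans with (2 := L), sum_n_nonneg; intros; apply pow2_ge_0.
Qed.

Definition pairing (x y : nat -> R) : R := Series (fun k => x k * y k).

(** Cauchy-Schwarz through |x y| <= N / (2 M) x^2 + M / (2 N) y^2, hence the strict positivity of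
    both bounds. *)
Lemma pairing_bound (x y : nat -> R) (M N : R) : 0 < M -> 0 < N -> l2_le x M -> l2_le y N ->
  ex_series (fun k => x k * y k) /\ Rabs (pairing x y) <= M * N.
Proof.
  intros HM HN Hx Hy.
  assert (B : ex_series (fun k => Rabs (x k * y k)) /\
              Series (fun k => Rabs (x k * y k)) <= M * N).
  { apply nonneg_series_bounded; [intros; apply Rabs_pos|]; intros K.
    apply Rle_trans with (sum_n (fun k => N / (2 * M) * x k ^ 2 + M / (2 * N) * y k ^ 2) K).
    - apply sum_n_le_compat; intros k _.
      assert (0 <= (N * Rabs (x k) - M * Rabs (y k)) ^ 2 / (2 * M * N)).
      { apply Rmult_le_pos; [apply pow2_ge_0|left; apply Rinv_0_lt_compat; nra]. }
      replace ((N * Rabs (x k) - M * Rabs (y k)) ^ 2 / (2 * M * N)) with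
        (N / (2 * M) * Rabs (x k) ^ 2 + M / (2 * N) * Rabs (y k) ^ 2 - Rabs (x k) * Rabs (y k)) in H
        by (field; lra).
      rewrite !pow2_abs in H; rewrite Rabs_mult; lra.
    - rewrite sum_n_add, !sum_n_scal.
      assert (0 <= N / (2 * M)) by (apply Rmult_le_pos; [|left; apply Rinv_0_lt_compat]; lra).
      assert (0 <= M / (2 * N)) by (apply Rmult_le_pos; [|left; apply Rinv_0_lt_compat]; lra).
      apply Rle_trans with (N / (2 * M) * M ^ 2 + M / (2 * N) * N ^ 2).
      + apply Rplus_le_compat; apply Rmult_le_compat_l; auto.
      + right; field; lra. }
  destruct B as [B1 B2]; split; [apply ex_series_Rabs, B1|].
  apply Rle_trans with (2 := B2), Series_Rabs, B1.
Qed.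

(** * Absolutely summable combinations of a bounded family in l2 *)

Section WeightedSum.
Variables (a : nat -> R) (W : nat -> nat -> R) (M : R).
Hypothesis Ha : ex_series (fun k => Rabs (a k)).
Hypothesis HM : 0 <= M.
Hypothesis HW : forall k, l2_le (W k) M.

Let A := Series (fun k => Rabs (a k)).
Let part (K j : nat) : R := sum_n (fun k => a k * W k j) K.

Lemma ex_series_weighted (j : nat) : ex_series (fun k => a k * W k j).
Proof.
  apply (ex_series_dominated _ (fun k => M * Rabs (a k))).
  - intros k; rewrite Rabs_mult, Rmult_comm; apply Rmult_le_compat_r; [apply Rabs_pos|].
    apply l2_le_coord; auto.
  - apply ex_series_Rscal; auto.
Qed.

Lemma l2_le_weighted_partial (K : nat) : l2_le (part K) (sum_n (fun k => Rabs (a k)) K * M).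
Proof.
  unfold part; induction K as [|K IH].
  - rewrite sum_n_0; apply (l2_le_ext (fun j => a 0%nat * W 0%nat j)).
    { intros j; rewrite sum_n_0; reflexivity. }
    apply l2_le_scal; auto.
  - rewrite sum_n_succ, Rmult_plus_distr_r.
    apply (l2_le_ext (fun j => part K j + a (S K) * W (S K) j)).
    { intros j; unfold part; rewrite sum_n_succ; reflexivity. }
    apply l2_le_plus; auto using l2_le_scal.
    + apply Rmult_le_pos; auto; apply sum_n_nonneg; intros; apply Rabs_pos.
    + apply Rmult_le_pos; auto; apply Rabs_pos.
Qed.

(** Toeplitz operators and their adjoints both have this form, with [W k] the k-fold forward or
    backward shift of a vector; the l1 norm of the coefficients thus bounds both operators. *)
Lemma l2_le_weighted : l2_le (fun j => Series (fun k => a k * W k j)) (A * M).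
Proof.
  apply (l2_le_lim part).
  - intros j; apply Series_correct, ex_series_weighted.
  - intros K; apply l2_le_weaken with (2 := l2_le_weighted_partial K); split.
    + apply Rmult_le_pos; auto; apply sum_n_nonneg; intros; apply Rabs_pos.
    + apply Rmult_le_compat_r; auto; apply sum_n_le_Series; auto; intros; apply Rabs_pos.
Qed.

Lemma l2_le_weighted_tail (K : nat) :
  l2_le (fun j => Series (fun k => a k * W k j) - part K j)
    ((A - sum_n (fun k => Rabs (a k)) K) * M).
Proof.
  assert (P : forall i, sum_n (fun k => Rabs (a k)) K <= sum_n (fun k => Rabs (a k)) (i + K)).
  { intros i; apply sum_n_mono; [intros; apply Rabs_pos|lia]. }
  apply (l2_le_lim (fun i j => part (i + K) j - part K j)).
  - intros j; apply is_lim_seq_minus'; [|apply is_lim_seq_const].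
    apply (is_lim_seq_incr_n (fun i => part i j) K).
    apply Series_correct, ex_series_weighted.
  - intros i; apply l2_le_weaken with
      ((sum_n (fun k => Rabs (a k)) (i + K) - sum_n (fun k => Rabs (a k)) K) * M).
    + split; [apply Rmult_le_pos; auto; specialize (P i); lra|].
      apply Rmult_le_compat_r; auto; apply Rplus_le_compat_r.
      apply sum_n_le_Series; auto; intros; apply Rabs_pos.
    + induction i as [|i IH].
      * apply (l2_le_ext (fun j => 0 * part K j)); [intros; simpl; ring|].
        replace ((sum_n (fun k => Rabs (a k)) (0 + K) - sum_n (fun k => Rabs (a k)) K) * M)
          with (Rabs 0 * (sum_n (fun k => Rabs (a k)) K * M)) by (simpl; rewrite Rabs_R0; ring).
        apply l2_le_scal, l2_le_weighted_partial.
      * replace (S i + K)%nat with (S (i + K)) by lia; rewrite sum_n_succ.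
        replace ((sum_n (fun k => Rabs (a k)) (i + K) + Rabs (a (S (i + K)))
          - sum_n (fun k => Rabs (a k)) K) * M)
          with ((sum_n (fun k => Rabs (a k)) (i + K) - sum_n (fun k => Rabs (a k)) K) * M
                + Rabs (a (S (i + K))) * M) by ring.
        apply (l2_le_ext (fun j => part (i + K) j - part K j + a (S (i + K)) * W (S (i + K)) j)).
        { intros j; unfold part; rewrite sum_n_succ; ring. }
        apply l2_le_plus; auto using l2_le_scal.
        -- apply Rmult_le_pos; auto; specialize (P i); lra.
        -- apply Rmult_le_pos; auto; apply Rabs_pos.
Qed.

(** The tail estimate gives convergence of the partial sums in norm, and pairing with a fixed vector
    is norm continuous. *)
Lemma pairing_weighted (y : nat -> R) (N : R) : l2_le y N ->
  is_series (fun k => a k * pairing (W k) y) (pairing (fun j => Series (fun k => a k * W k j)) y).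
Proof.
  intros Hy0.
  assert (HA : 0 <= A).
  { apply Rle_trans with (sum_n (fun k => Rabs (a k)) 0);
      [apply sum_n_nonneg; intros; apply Rabs_pos|].
    apply sum_n_le_Series; auto; intros; apply Rabs_pos. }
  assert (HT : forall K, 0 <= A - sum_n (fun k => Rabs (a k)) K).
  { intros K; assert (sum_n (fun k => Rabs (a k)) K <= A); [|lra].
    apply sum_n_le_Series; auto; intros; apply Rabs_pos. }
  assert (Hy : l2_le y (Rabs N + 1)).
  { apply l2_le_weaken with (Rabs N); [pose proof (Rabs_pos N); lra|].
    intros K; rewrite pow2_abs; apply Hy0. }
  pose proof (Rabs_pos N) as HN.
  assert (Hex : forall k, ex_series (fun j => W k j * y j)).
  { intros k; apply (pairing_bound (W k) y (M + 1) (Rabs N + 1)); auto; try lra.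
    apply l2_le_weaken with M; auto; lra. }
  assert (Hex' : ex_series (fun j => Series (fun k => a k * W k j) * y j)).
  { apply (pairing_bound _ y (A * M + 1) (Rabs N + 1)); auto; try nra; try lra.
    apply l2_le_weaken with (A * M); [nra|apply l2_le_weighted]. }
  assert (Hpart : forall K, sum_n (fun k => a k * pairing (W k) y) K = pairing (part K) y :> R /\
    ex_series (fun j => part K j * y j)).
  { induction K as [|K [IH IHe]].
    - rewrite sum_n_0; split.
      + unfold pairing; rewrite <- Series_scal_l; apply Series_ext; intros j.
        unfold part; rewrite sum_n_0; ring.
      + apply (ex_series_ext (fun j => a 0%nat * (W 0%nat j * y j))).
        * intros j; unfold part; rewrite sum_n_0.
          change (a 0%nat * (W 0%nat j * y j) = a 0%nat * W 0%nat j * y j); ring.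
        * apply ex_series_Rscal; auto.
    - assert (E : forall j, part K j * y j + a (S K) * (W (S K) j * y j) = part (S K) j * y j).
      { intros j; unfold part; rewrite sum_n_succ; ring. }
      split.
      + rewrite sum_n_succ, IH; unfold pairing; rewrite <- Series_scal_l, <- Series_plus;
          auto using ex_series_Rscal.
        apply Series_ext; auto.
      + apply (ex_series_ext (fun j => part K j * y j + a (S K) * (W (S K) j * y j))); auto.
        apply ex_series_Rplus; auto using ex_series_Rscal. }
  apply is_series_partial_sums.
  (* [pairing_bound] asks for positive bounds whereas the tail may vanish; the summand 1 / (K + 1)
     repairs this and still tends to 0. *)
  apply (is_lim_seq_squeeze_0 _ (fun K => ((A - sum_n (fun k => Rabs (a k)) K) * M + / (INR K + 1))
    * (Rabs N + 1))).
  - intros K; rewrite (proj1 (Hpart K)), Rabs_minus_sym.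
    unfold pairing; rewrite <- Series_minus by (auto; apply Hpart).
    assert (Hi : 0 < / (INR K + 1)) by (apply Rinv_0_lt_compat; pose proof (pos_INR K); lra).
    assert (0 <= (A - sum_n (fun k => Rabs (a k)) K) * M) by (apply Rmult_le_pos; auto).
    replace (Series (fun n => Series (fun k => a k * W k n) * y n - part K n * y n))
      with (pairing (fun n => Series (fun k => a k * W k n) - part K n) y)
      by (apply Series_ext; intros; ring).
    apply pairing_bound; auto; try lra.
    apply l2_le_weaken with (2 := l2_le_weighted_tail K); lra.
  - replace (Finite 0) with (Rbar_mult (0 * M + 0) (Rabs N + 1)) by (simpl; f_equal; ring).
    apply is_lim_seq_scal_r, is_lim_seq_plus'.
    + apply (is_lim_seq_scal_r _ M 0), tail_tends_0; auto.
    + assert (L : is_lim_seq (fun K => INR K + 1) p_infty).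
      { apply is_lim_seq_plus with p_infty 1; [apply is_lim_seq_INR|apply is_lim_seq_const|].
        reflexivity. }
      apply (is_lim_seq_inv _ _ L); discriminate.
Qed.
End WeightedSum.

(** * Analytic Toeplitz operators with real coefficients and their adjoints *)

Definition real_toeplitz (a x : nat -> R) (j : nat) : R :=
  sum_n (fun k => a k * x (j - k)%nat) j.

Definition real_adjoint (a x : nat -> R) (k : nat) : R := Series (fun j => a j * x (j + k)%nat).

Lemma Series_finite (b : nat -> R) (m : nat) : (forall k, (m < k)%nat -> b k = 0) ->
  Series b = sum_n b m.
Proof.
  intros H; apply is_series_unique, is_series_partial_sums.
  apply is_lim_seq_ext_loc with (fun _ => sum_n b m); [|apply is_lim_seq_const].
  exists m; intros n Hn; induction Hn as [|n Hn IH]; auto.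
  rewrite sum_n_succ, <- IH, (H (S n)) by lia; symmetry; apply Rplus_0_r.
Qed.

Lemma real_toeplitz_weighted (a x : nat -> R) (j : nat) :
  real_toeplitz a x j = Series (fun k => a k * unshift k x j).
Proof.
  rewrite (Series_finite _ j).
  - apply sum_n_Rext_loc; intros k Hk; unfold unshift; destruct (le_dec k j); [reflexivity|lia].
  - intros k Hk; unfold unshift; destruct (le_dec k j); [lia|ring].
Qed.

Lemma l2_le_real_toeplitz (a x : nat -> R) (M : R) : ex_series (fun k => Rabs (a k)) -> 0 <= M ->
  l2_le x M -> l2_le (real_toeplitz a x) (Series (fun k => Rabs (a k)) * M).
Proof.
  intros Ha HM Hx; apply (l2_le_ext (fun j => Series (fun k => a k * unshift k x j))).
  - intros j; symmetry; apply real_toeplitz_weighted.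
  - apply l2_le_weighted; auto; intros k; apply l2_le_unshift; auto.
Qed.

Lemma l2_le_real_adjoint (a x : nat -> R) (M : R) : ex_series (fun k => Rabs (a k)) -> 0 <= M ->
  l2_le x M -> l2_le (real_adjoint a x) (Series (fun k => Rabs (a k)) * M).
Proof.
  intros Ha HM Hx.
  apply (l2_le_weighted a (fun j k => x (j + k)%nat)); auto; intros k; apply l2_le_shift; auto.
Qed.

Lemma pairing_comm (x y : nat -> R) : pairing x y = pairing y x.
Proof. apply Series_ext; intros; ring. Qed.

Lemma pairing_unshift (j : nat) (x y : nat -> R) :
  ex_series (fun k => x k * y (j + k)%nat) ->
  pairing (unshift j x) y = pairing x (fun k => y (j + k)%nat).
Proof.
  intros Hex; unfold pairing; destruct j as [|j].
  - apply Series_ext; intros k; unfold unshift; destruct (le_dec 0 k); [|lia].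
    rewrite Nat.sub_0_r; reflexivity.
  - assert (E : forall k, unshift (S j) x (S j + k) * y (S j + k)%nat = x k * y (S j + k)%nat).
    { intros k; unfold unshift; destruct (le_dec (S j) (S j + k)); [|lia].
      do 2 f_equal; lia. }
    rewrite (Series_incr_n _ (S j)); [|lia|].
    + rewrite <- sum_n_Reals; simpl pred.
      assert (Z : sum_n (fun k => unshift (S j) x k * y k) j = 0 :> R).
      { rewrite (sum_n_Rext_loc _ (fun _ => 0 * 0)).
        - rewrite sum_n_scal; ring.
        - intros k Hk; unfold unshift; destruct (le_dec (S j) k); [lia|ring]. }
      rewrite Z, Rplus_0_l; apply Series_ext; auto.
    + apply (ex_series_incr_n (V := R_NormedModule) _ (S j)).
      apply (ex_series_ext (fun k => x k * y (S j + k)%nat)); auto.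
Qed.

(** Both sides expand into the sum over k of [a k] times the pairing of [x] with the k-fold backward
    shift of [y]. *)
Lemma real_adjoint_correct (a x y : nat -> R) (M N : R) :
  ex_series (fun k => Rabs (a k)) -> 0 < M -> 0 < N -> l2_le x M -> l2_le y N ->
  pairing (real_toeplitz a x) y = pairing x (real_adjoint a y).
Proof.
  intros Ha HM HN Hx Hy.
  pose proof (pairing_weighted a (fun k => unshift k x) M Ha (Rlt_le _ _ HM)
    (fun k => l2_le_unshift k x M Hx) y N Hy) as S1.
  pose proof (pairing_weighted a (fun j k => y (j + k)%nat) N Ha (Rlt_le _ _ HN)
    (fun k => l2_le_shift k y N Hy) x M Hx) as S2.
  apply is_series_unique in S1; apply is_series_unique in S2.
  rewrite (pairing_comm x); unfold real_adjoint; rewrite <- S2.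
  transitivity (pairing (fun j => Series (fun k => a k * unshift k x j)) y).
  - apply Series_ext; intros j; rewrite real_toeplitz_weighted; reflexivity.
  - rewrite <- S1; apply Series_ext; intros k; f_equal.
    rewrite pairing_unshift; [apply pairing_comm|].
    apply (pairing_bound x _ M N); auto; apply l2_le_shift; auto.
Qed.

(** * Projections of continuous densities *)

(* The Fourier coefficients of the symmetrised function [psi(t) + conj(psi(-t))] / 2 at [k >= 0],
   for [psi = p + i s]; the analytic projection [P psi] when they are the coefficients of [psi]. *)
Definition fourier (p s : R -> R) (k : nat) : R :=
  mean (fun t => p t * cos (INR k * t) + s t * sin (INR k * t)).

Lemma fourier_plus (p s p' s' : R -> R) (k : nat) : Cont p -> Cont s -> Cont p' -> Cont s' ->
  fourier (fun t => p t + p' t) (fun t => s t + s' t) k = fourier p s k + fourier p' s' k.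
Proof.
  intros; unfold fourier; rewrite <- mean_plus by auto with cont.
  f_equal; apply functional_extensionality; intros t; ring.
Qed.

Lemma fourier_scal (c : R) (p s : R -> R) (k : nat) : Cont p -> Cont s ->
  fourier (fun t => c * p t) (fun t => c * s t) k = c * fourier p s k.
Proof.
  intros; unfold fourier; rewrite <- mean_scal by auto with cont.
  f_equal; apply functional_extensionality; intros t; ring.
Qed.

Lemma fourier_cos_sin (k l : nat) :
  fourier (fun t => cos (INR k * t)) (fun t => sin (INR k * t)) l
  = if Nat.eq_dec k l then 1 else 0.
Proof.
  assert (H : forall k l, (l <= k)%nat ->
    mean (fun t => cos (INR k * t) * cos (INR l * t) + sin (INR k * t) * sin (INR l * t))
    = if Nat.eq_dec k l then 1 else 0).
  { clear k l; intros k l Hkl.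
    replace (fun t => cos (INR k * t) * cos (INR l * t) + sin (INR k * t) * sin (INR l * t))
      with (fun t => cos (INR (k - l) * t)).
    - destruct (Nat.eq_dec k l) as [->|D]; [|apply mean_cos; lia].
      replace (fun t => cos (INR (l - l) * t)) with (fun _ : R => 1); [apply mean_const|].
      apply functional_extensionality; intros t; rewrite Nat.sub_diag; simpl.
      rewrite Rmult_0_l, cos_0; auto.
    - apply functional_extensionality; intros t.
      rewrite minus_INR by auto.
      replace ((INR k - INR l) * t) with (INR k * t - INR l * t) by ring.
      rewrite cos_minus; ring. }
  unfold fourier; destruct (le_ge_dec l k) as [L|L]; [apply H; auto|].
  replace (fun t => cos (INR k * t) * cos (INR l * t) + sin (INR k * t) * sin (INR l * t))
    with (fun t => cos (INR l * t) * cos (INR k * t) + sin (INR l * t) * sin (INR k * t))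
    by (apply functional_extensionality; intros; ring).
  rewrite H by auto; destruct (Nat.eq_dec l k), (Nat.eq_dec k l); auto; lia.
Qed.

(** Real and imaginary part of the density minus the terms of index below n of its Fourier
    expansion. *)
Fixpoint residual (p s : R -> R) (n : nat) : (R -> R) * (R -> R) :=
  match n with
  | O => (p, s)
  | S m => (fun t => fst (residual p s m) t + - fourier p s m * cos (INR m * t),
            fun t => snd (residual p s m) t + - fourier p s m * sin (INR m * t))
  end.

(** Removing the n-th term does not touch later coefficients and lowers the mean square by exactly
    [x n ^ 2]; the mean square never becomes negative. *)
Lemma bessel (p s : R -> R) (M : R) : Cont p -> Cont s ->
  (forall t, p t ^ 2 + s t ^ 2 <= M ^ 2) -> l2_le (fourier p s) M.
Proof.
  intros Hp Hs HM; set (x := fourier p s).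
  assert (C : forall n, Cont (fst (residual p s n)) /\ Cont (snd (residual p s n))).
  { induction n as [|n [C1 C2]]; simpl; auto with cont. }
  assert (F : forall n m, (n <= m)%nat ->
    fourier (fst (residual p s n)) (snd (residual p s n)) m = x m).
  { induction n as [|n IH]; intros m Hm; [reflexivity|].
    destruct (C n) as [C1 C2]; cbn [residual fst snd].
    rewrite fourier_plus, fourier_scal, fourier_cos_sin, IH by (auto with cont; lia).
    destruct (Nat.eq_dec n m); [lia|ring]. }
  set (e := fun n => mean (fun t => fst (residual p s n) t ^ 2 + snd (residual p s n) t ^ 2)).
  assert (E : forall n, e (S n) = e n - x n ^ 2).
  { intros n; destruct (C n) as [C1 C2]; unfold e; cbn [residual fst snd].
    pose proof (F n n (le_n n)) as Fn; fold x.
    set (P := fst (residual p s n)) in *; set (Q := snd (residual p s n)) in *.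
    replace (fun t => (P t + - x n * cos (INR n * t)) ^ 2 + (Q t + - x n * sin (INR n * t)) ^ 2)
      with (fun t => (P t ^ 2 + Q t ^ 2)
        + (-2 * x n * (P t * cos (INR n * t) + Q t * sin (INR n * t)) + x n ^ 2)).
    - rewrite (mean_plus (fun t => P t ^ 2 + Q t ^ 2)) by auto 8 with cont.
      rewrite (mean_plus (fun t => -2 * x n * (P t * cos (INR n * t) + Q t * sin (INR n * t))))
        by auto 8 with cont.
      rewrite mean_scal, mean_const by auto 8 with cont.
      unfold fourier in Fn; rewrite Fn; ring.
    - apply functional_extensionality; intros t.
      pose proof (sin2_cos2 (INR n * t)) as S2; unfold Rsqr in S2.
      replace (x n ^ 2) with (x n ^ 2 * (sin (INR n * t) * sin (INR n * t)
        + cos (INR n * t) * cos (INR n * t))) by (rewrite S2; ring).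
      ring. }
  assert (B : forall K, sum_n (fun k => x k ^ 2) K = e 0%nat - e (S K) :> R).
  { induction K as [|K IH]; [rewrite sum_n_0, E; ring|rewrite sum_n_succ, IH, (E (S K)); ring]. }
  intros K; rewrite B.
  assert (0 <= e (S K)).
  { rewrite <- (mean_const 0); destruct (C (S K)); apply mean_le; auto with cont.
    intros t; pose proof (pow2_ge_0 (fst (residual p s (S K)) t));
      pose proof (pow2_ge_0 (snd (residual p s (S K)) t)); lra. }
  assert (e 0%nat <= M ^ 2).
  { rewrite <- (mean_const (M ^ 2)); apply mean_le; auto with cont; exact HM. }
  lra.
Qed.

Lemma circle_tail (a : nat -> R) (t : R) (J : nat) : ex_series (fun n => Rabs (a n)) ->
  Rabs (Series (cos_coeff a t) - sum_n (cos_coeff a t) J)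
    <= Series (fun n => Rabs (a n)) - sum_n (fun n => Rabs (a n)) J /\
  Rabs (Series (sin_coeff a t) - sum_n (sin_coeff a t) J)
    <= Series (fun n => Rabs (a n)) - sum_n (fun n => Rabs (a n)) J.
Proof.
  intros Ha; split; apply Series_tail_bound; auto; intros n; apply Rabs_mult_le_l;
    auto using Rabs_cos_le_1, Rabs_sin_le_1.
Qed.

(* [T_g^* P psi = P (conj g psi)] *)
Lemma real_adjoint_fourier (a : nat -> R) (p s : R -> R) (B : R) (k : nat) :
  ex_series (fun n => Rabs (a n)) ->
  Cont (fun t => Series (cos_coeff a t)) -> Cont (fun t => Series (sin_coeff a t)) ->
  Cont p -> Cont s -> 0 <= B -> (forall t, p t ^ 2 + s t ^ 2 <= B ^ 2) ->
  real_adjoint a (fourier p s) k =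
  fourier (fun t => p t * Series (cos_coeff a t) + s t * Series (sin_coeff a t))
          (fun t => s t * Series (cos_coeff a t) - p t * Series (sin_coeff a t)) k.
Proof.
  intros Ha HX HY Hp Hs HB Hb.
  apply is_series_unique, is_series_partial_sums.
  set (T := Series (fun n => Rabs (a n))).
  (* The difference of the densities consists of two tails of the boundary series, each with a
     factor of modulus at most 2 B. *)
  apply (is_lim_seq_squeeze_0 _ (fun J => 4 * B * (T - sum_n (fun n => Rabs (a n)) J))).
  - intros J.
    assert (E : sum_n (fun j => a j * fourier p s (j + k)) J = mean (fun t => sum_n (fun j =>
      a j * (p t * cos (INR (j + k) * t) + s t * sin (INR (j + k) * t))) J) :> R).
    { rewrite (mean_sum (fun j t =>
        a j * (p t * cos (INR (j + k) * t) + s t * sin (INR (j + k) * t)))) by (auto with cont).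
      apply sum_n_Rext; intros j; rewrite mean_scal by auto with cont; reflexivity. }
    rewrite E; unfold fourier.
    assert (Cs : Cont (fun t => sum_n (fun j =>
      a j * (p t * cos (INR (j + k) * t) + s t * sin (INR (j + k) * t))) J)).
    { apply (Cont_sum (fun j t =>
        a j * (p t * cos (INR (j + k) * t) + s t * sin (INR (j + k) * t)))); auto with cont. }
    rewrite <- mean_minus by auto 8 with cont.
    rewrite <- (mean_const (4 * B * _)); apply mean_Rabs_le; auto 8 with cont; intros t.
    set (X := Series (cos_coeff a t)); set (Y := Series (sin_coeff a t)).
    assert (Es : sum_n (fun j =>
        a j * (p t * cos (INR (j + k) * t) + s t * sin (INR (j + k) * t))) J
      = (p t * cos (INR k * t) + s t * sin (INR k * t)) * sum_n (cos_coeff a t) J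
        + (s t * cos (INR k * t) - p t * sin (INR k * t)) * sum_n (sin_coeff a t) J :> R).
    { rewrite <- !sum_n_scal, <- sum_n_add; apply sum_n_Rext; intros j.
      unfold cos_coeff, sin_coeff; rewrite plus_INR.
      replace ((INR j + INR k) * t) with (INR j * t + INR k * t) by ring.
      rewrite cos_plus, sin_plus; ring. }
    rewrite Es; clear Es E Cs.
    replace ((p t * cos (INR k * t) + s t * sin (INR k * t)) * sum_n (cos_coeff a t) J
        + (s t * cos (INR k * t) - p t * sin (INR k * t)) * sum_n (sin_coeff a t) J
        - ((p t * X + s t * Y) * cos (INR k * t) + (s t * X - p t * Y) * sin (INR k * t)))
      with (- ((p t * cos (INR k * t) + s t * sin (INR k * t)) * (X - sum_n (cos_coeff a t) J)
        + (s t * cos (INR k * t) - p t * sin (INR k * t)) * (Y - sum_n (sin_coeff a t) J))) by ring.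
    rewrite Rabs_Ropp; destruct (circle_tail a t J Ha) as [TX TY]; fold X T in TX; fold Y T in TY.
    set (d := T - sum_n (fun n => Rabs (a n)) J) in *.
    assert (Bp : Rabs (p t) <= B).
    { apply Rsqr_incr_0_var; auto; rewrite <- Rsqr_abs; unfold Rsqr; specialize (Hb t).
      pose proof (pow2_ge_0 (s t)); simpl pow in *; lra. }
    assert (Bs : Rabs (s t) <= B).
    { apply Rsqr_incr_0_var; auto; rewrite <- Rsqr_abs; unfold Rsqr; specialize (Hb t).
      pose proof (pow2_ge_0 (p t)); simpl pow in *; lra. }
    pose proof (Rabs_cos_le_1 (INR k * t)) as Bc; pose proof (Rabs_sin_le_1 (INR k * t)) as Bsn.
    assert (B1 : Rabs (p t * cos (INR k * t) + s t * sin (INR k * t)) <= 2 * B).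
    { eapply Rle_trans; [apply Rabs_triang|].
      pose proof (Rabs_mult_le_l (p t) _ Bc); pose proof (Rabs_mult_le_l (s t) _ Bsn); lra. }
    assert (B2 : Rabs (s t * cos (INR k * t) - p t * sin (INR k * t)) <= 2 * B).
    { unfold Rminus; eapply Rle_trans; [apply Rabs_triang|]; rewrite Rabs_Ropp.
      pose proof (Rabs_mult_le_l (s t) _ Bc); pose proof (Rabs_mult_le_l (p t) _ Bsn); lra. }
    eapply Rle_trans; [apply Rabs_triang|]; rewrite !Rabs_mult.
    replace (4 * B * d) with (2 * B * d + 2 * B * d) by ring.
    apply Rplus_le_compat; apply Rmult_le_compat; auto using Rabs_pos.
  - replace (Finite 0) with (Rbar_mult (4 * B) 0) by (simpl; f_equal; ring).
    apply is_lim_seq_scal_l, tail_tends_0; auto.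
Qed.

(** * Smooth boundary values and the action on supported densities *)

Lemma rapid_scal (c : R) (h : nat -> R) : rapid h -> rapid (fun n => c * h n).
Proof.
  intros H p; destruct (H p) as [K HK]; exists (Rabs c * K); intros n.
  rewrite Rabs_mult, Rmult_assoc; apply Rmult_le_compat_l; [apply Rabs_pos|apply HK].
Qed.

Lemma trig_cos (h : nat -> R) (t : R) : trig h (fun _ => 0) t = Series (cos_coeff h t).
Proof. apply Series_ext; intros n; unfold cos_coeff; ring. Qed.

Lemma trig_sin (h : nat -> R) (t : R) : trig (fun _ => 0) h t = Series (sin_coeff h t).
Proof. apply Series_ext; intros n; unfold sin_coeff; ring. Qed.

Lemma rapid_zero : rapid (fun _ => 0).
Proof. intros p; exists 0; intros n; rewrite Rabs_R0; lra. Qed.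

Lemma Ck_circle (h : nat -> R) (n : nat) : rapid h ->
  Ck n (fun t => Series (cos_coeff h t)) /\ Ck n (fun t => Series (sin_coeff h t)).
Proof.
  intros H; split.
  - replace (fun t => Series (cos_coeff h t)) with (trig h (fun _ => 0))
      by (apply functional_extensionality; intros; apply trig_cos).
    apply Ck_trig; auto using rapid_zero.
  - replace (fun t => Series (sin_coeff h t)) with (trig (fun _ => 0) h)
      by (apply functional_extensionality; intros; apply trig_sin).
    apply Ck_trig; auto using rapid_zero.
Qed.

(** The derivatives are combinations of the same two functions with coefficients from u' and v', so
    the induction carries both at once. *)
Lemma Ck_exp_cos_sin (u v : R -> R) (n : nat) : (forall m, Ck m u) -> (forall m, Ck m v) ->
  Ck n (fun t => exp (u t) * cos (v t)) /\ Ck n (fun t => exp (u t) * sin (v t)).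
Proof.
  intros Hu Hv; destruct (smooth_derivative u Hu) as [u' [Du Cu]].
  destruct (smooth_derivative v Hv) as [v' [Dv Cv]].
  induction n as [|n [IH1 IH2]]; [easy|]; split.
  - exists (fun t => u' t * (exp (u t) * cos (v t)) + -1 * (v' t * (exp (u t) * sin (v t)))); split.
    + intros t; auto_derive.
      { split; [exists (u' t)|split; [exists (v' t)|]]; auto. }
      replace (Derive (fun x => u x) t) with (u' t) by (symmetry; apply is_derive_unique, Du).
      replace (Derive (fun x => v x) t) with (v' t) by (symmetry; apply is_derive_unique, Dv).
      ring.
    + apply Ck_plus; [|apply Ck_scal]; apply Ck_mult; auto.
  - exists (fun t => u' t * (exp (u t) * sin (v t)) + v' t * (exp (u t) * cos (v t))); split.
    + intros t; auto_derive.
      { split; [exists (u' t)|split; [exists (v' t)|]]; auto. }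
      replace (Derive (fun x => u x) t) with (u' t) by (symmetry; apply is_derive_unique, Du).
      replace (Derive (fun x => v x) t) with (v' t) by (symmetry; apply is_derive_unique, Dv).
      ring.
    + apply Ck_plus; apply Ck_mult; auto.
Qed.

Lemma Ck_exp_circle (h : nat -> R) (n : nat) : rapid h ->
  Ck n (fun t => Series (cos_coeff (exp_coeff h) t)) /\
  Ck n (fun t => Series (sin_coeff (exp_coeff h) t)).
Proof.
  intros H.
  destruct (Ck_exp_cos_sin (fun t => Series (cos_coeff h t)) (fun t => Series (sin_coeff h t)) n
    (fun m => proj1 (Ck_circle h m H)) (fun m => proj2 (Ck_circle h m H))) as [C S].
  split; [eapply eq_ind; [exact C|]|eapply eq_ind; [exact S|]];
    apply functional_extensionality; intros t; symmetry;
    apply (exp_coeff_circle h t (rapid_ex_series h H)).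
Qed.

Lemma exp_circle_modulus (h : nat -> R) (t : R) : rapid h ->
  Series (cos_coeff (exp_coeff h) t) ^ 2 + Series (sin_coeff (exp_coeff h) t) ^ 2
  = exp (Series (cos_coeff h t)) ^ 2.
Proof.
  intros H; destruct (exp_coeff_circle h t (rapid_ex_series h H)) as [-> ->].
  pose proof (sin2_cos2 (Series (sin_coeff h t))) as S2; unfold Rsqr in S2.
  transitivity (exp (Series (cos_coeff h t)) ^ 2 *
    (sin (Series (sin_coeff h t)) * sin (Series (sin_coeff h t))
    + cos (Series (sin_coeff h t)) * cos (Series (sin_coeff h t)))); [ring|rewrite S2; ring].
Qed.

(** The density is p + i s and the arc is cos t > c. The bound is pointwise, so that multiplication
    by a function of modulus at most e^d on the arc multiplies [K] by e^d. *)
Record supported (c : R) (p s : R -> R) (K : R) : Prop := {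
  supp_bound_ge_0 : 0 <= K;
  supp_cont_re : Cont p;
  supp_cont_im : Cont s;
  supp_bound : forall t, p t ^ 2 + s t ^ 2 <= K ^ 2;
  supp_zero : forall t, cos t <= c -> p t = 0 /\ s t = 0
}.

(** The induction produces the density behind the n-th iterate, still supported in the arc. Bessel's
    inequality is applied once, to the last density. *)
Lemma real_adjoint_iter_supported (h : nat -> R) (c d : R) (p s : R -> R) (K : R) (n : nat) :
  rapid h -> (forall t, c < cos t -> Series (cos_coeff h t) <= d) -> supported c p s K ->
  l2_le (Nat.iter n (real_adjoint (exp_coeff h)) (fourier p s)) (exp d ^ n * K).
Proof.
  intros Hh Hd HS; pose proof (rapid_ex_series h Hh) as Hl.
  assert (G : exists p' s', supported c p' s' (exp d ^ n * K) /\
    Nat.iter n (real_adjoint (exp_coeff h)) (fourier p s) = fourier p' s').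
  { induction n as [|n [p' [s' [H E]]]].
    - exists p, s; simpl; rewrite Rmult_1_l; auto.
    - set (X := fun t => Series (cos_coeff (exp_coeff h) t)).
      set (Y := fun t => Series (sin_coeff (exp_coeff h) t)).
      assert (CX : Cont X) by exact (Ck_continuous X (proj1 (Ck_exp_circle h 1 Hh))).
      assert (CY : Cont Y) by exact (Ck_continuous Y (proj2 (Ck_exp_circle h 1 Hh))).
      destruct H as [HK C1 C2 HB HZ].
      exists (fun t => p' t * X t + s' t * Y t), (fun t => s' t * X t - p' t * Y t); split.
      + split; auto with cont.
        * simpl; rewrite Rmult_assoc; apply Rmult_le_pos; auto; left; apply exp_pos.
        * intros t; replace ((p' t * X t + s' t * Y t) ^ 2 + (s' t * X t - p' t * Y t) ^ 2)
            with ((p' t ^ 2 + s' t ^ 2) * (X t ^ 2 + Y t ^ 2)) by ring.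
          unfold X, Y; rewrite exp_circle_modulus by auto.
          destruct (Rle_lt_dec (cos t) c) as [L|L].
          -- destruct (HZ t L) as [-> ->].
             replace ((0 ^ 2 + 0 ^ 2) * exp (Series (cos_coeff h t)) ^ 2) with 0 by ring.
             apply pow2_ge_0.
          -- replace ((exp d ^ S n * K) ^ 2) with ((exp d ^ n * K) ^ 2 * exp d ^ 2) by (simpl; ring).
             apply Rmult_le_compat; auto.
             ++ pose proof (pow2_ge_0 (p' t)); pose proof (pow2_ge_0 (s' t)); lra.
             ++ apply pow2_ge_0.
             ++ apply pow_incr; split; [left; apply exp_pos|].
                destruct (Hd t L) as [L'|L']; [left; apply exp_increasing; auto|rewrite L'; lra].
        * intros t L; destruct (HZ t L) as [-> ->]; split; ring.
      + simpl; rewrite E; apply functional_extensionality; intros k.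
        apply (real_adjoint_fourier _ _ _ (exp d ^ n * K)); auto.
        apply exp_coeff_l1; auto. }
  destruct G as [p' [s' [[? ? ? ? ?] ->]]]; apply bessel; auto.
Qed.

(** * Density of projections of densities supported in an arc *)

(** The factor 2 comes from (u + v)^2 <= 2 u^2 + 2 v^2. It is crude, but only the finiteness of the
    bound matters. *)
Lemma supported_combination (c : R) (p s p' s' : R -> R) (K K' x : R) :
  supported c p s K -> supported c p' s' K' ->
  supported c (fun t => x * p t + p' t) (fun t => x * s t + s' t) (2 * (Rabs x * K + K')).
Proof.
  intros [HK C1 C2 HB HZ] [HK' C1' C2' HB' HZ']; split; auto with cont.
  - pose proof (Rmult_le_pos _ _ (Rabs_pos x) HK); lra.
  - intros t; specialize (HB t); specialize (HB' t).
    pose proof (Rmult_le_pos _ _ (Rabs_pos x) HK).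
    apply Rle_trans with (2 * (x ^ 2 * (p t ^ 2 + s t ^ 2)) + 2 * (p' t ^ 2 + s' t ^ 2)).
    + pose proof (pow2_ge_0 (x * p t - p' t)); pose proof (pow2_ge_0 (x * s t - s' t)); nra.
    + apply Rle_trans with (2 * (x ^ 2 * K ^ 2) + 2 * K' ^ 2).
      * pose proof (Rmult_le_compat_l _ _ _ (pow2_ge_0 x) HB); lra.
      * rewrite <- (pow2_abs x), <- Rpow_mult_distr; nra.
  - intros t L; destruct (HZ t L) as [-> ->]; destruct (HZ' t L) as [-> ->]; split; ring.
Qed.

Definition approximable (c : R) (x : nat -> R) : Prop :=
  forall eta, 0 < eta -> exists p s K, supported c p s K /\
    l2_le (fun k => x k - fourier p s k) eta.

(** The piecewise linear function that is 0 up to 0 and 1 from 1 on; absolute values make its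
    continuity immediate. *)
Definition clamp (y : R) : R := (Rabs y - Rabs (y - 1) + 1) / 2.

Lemma clamp_range (y : R) : 0 <= clamp y <= 1.
Proof. unfold clamp, Rabs; destruct (Rcase_abs y), (Rcase_abs (y - 1)); lra. Qed.

Lemma clamp_neg (y : R) : y <= 0 -> clamp y = 0.
Proof. intros; unfold clamp; rewrite (Rabs_left1 y), (Rabs_left1 (y - 1)) by lra; lra. Qed.

Lemma clamp_large (y : R) : 1 <= y -> clamp y = 1.
Proof. intros; unfold clamp; rewrite (Rabs_pos_eq y), (Rabs_pos_eq (y - 1)) by lra; lra. Qed.

(** The adjoint maps z^k to a polynomial of degree at most k, with coefficient [a 0] at z^k. *)
Lemma real_adjoint_delta (a : nat -> R) (k l : nat) :
  real_adjoint a (fun i => if Nat.eq_dec k i then 1 else 0) l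
  = if le_dec l k then a (k - l)%nat else 0.
Proof.
  unfold real_adjoint; destruct (le_dec l k) as [L|L].
  - rewrite (Series_finite _ (k - l)).
    + rewrite (sum_n_single _ (k - l)).
      * destruct (le_dec (k - l) (k - l)); [|lia].
        destruct (Nat.eq_dec k (k - l + l)); [ring|lia].
      * intros j Hj; destruct (Nat.eq_dec k (j + l)); [lia|ring].
    + intros j Hj; destruct (Nat.eq_dec k (j + l)); [lia|ring].
  - rewrite (Series_finite _ 0); [rewrite sum_n_0|intros j Hj];
      match goal with |- context [Nat.eq_dec ?u ?v] => destruct (Nat.eq_dec u v) end;
      try lia; ring.
Qed.

(* With [Phi = exp v], [v >= 0] supported in the arc [c' < cos t], the function
   [conj (Phi ^ m) e^{ikt}] projects onto a polynomial with leading coefficient [e^{m v_0}],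
   while it has modulus [1] off the arc: dividing and cutting it off costs only [e^{-m v_0}]. *)
Lemma leading_monomial_approx (c : R) (k : nat) (delta : R) : c < 1 -> 0 < delta ->
  exists (b : nat -> R) (p s : R -> R) (K : R),
    b k = 1 /\ (forall l, (k < l)%nat -> b l = 0) /\ supported c p s K /\
    l2_le (fun l => b l - fourier p s l) delta.
Proof.
  intros Hc Hdelta; set (c' := (c + 1) / 2).
  destruct (bump_cosine_series 1 (- c')) as [h [Hrap [Hv [_ Hh0]]]].
  assert (H0 : 0 < h 0%nat).
  (* If [h 0] were not positive, the bound 2 * h 0 would make all coefficients vanish, although the
     bump is positive at t = 0. *)
  { destruct (Rle_lt_dec (h 0%nat) 0) as [L|L]; auto; exfalso.
    specialize (Hv 0); rewrite cos_0 in Hv.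
    rewrite (Series_ext _ (fun _ => 0 * 0)) in Hv.
    - rewrite Series_scal_l in Hv.
      assert (0 < bump 0 (1 * 1 + - c')) by (apply bump_gt_0; unfold c'; lra); lra.
    - intros n; specialize (Hh0 n); pose proof (Rabs_pos (h n)).
      assert (h n = 0) by (apply Rabs_eq_0; lra); rewrite H0; ring. }
  (* [lam] takes the part of [m]: with lam * h 0 = 1 / delta the leading coefficient is exp (1 /
     delta), which exceeds 1 / delta. *)
  set (lam := / delta / h 0%nat).
  assert (Hlam : 0 < lam) by (unfold lam; apply Rdiv_lt_0_compat; auto; apply Rinv_0_lt_compat; auto).
  set (w := fun n => lam * h n).
  assert (Hw : rapid w) by (apply rapid_scal; auto).
  pose proof (rapid_ex_series w Hw) as Hwl.
  set (a := exp_coeff w).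
  assert (Ha0 : / delta <= a 0%nat).
  { unfold a, exp_coeff, w; simpl; unfold lam.
    replace (/ delta / h 0%nat * h 0%nat) with (/ delta) by (field; lra).
    pose proof (exp_ge_1_plus (/ delta)); lra. }
  assert (Hd' : 0 < / delta) by (apply Rinv_0_lt_compat; auto).
  assert (Ha0' : 0 < a 0%nat) by lra.
  set (X := fun t => Series (cos_coeff a t)); set (Y := fun t => Series (sin_coeff a t)).
  assert (CX : Cont X) by exact (Ck_continuous X (proj1 (Ck_exp_circle w 1 Hw))).
  assert (CY : Cont Y) by exact (Ck_continuous Y (proj2 (Ck_exp_circle w 1 Hw))).
  assert (Hmod : forall t, X t ^ 2 + Y t ^ 2 = exp (lam * bump 0 (cos t - c')) ^ 2).
  { intros t; unfold X, Y, a; rewrite exp_circle_modulus by auto; do 2 f_equal.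
    unfold cos_coeff, w.
    rewrite (Series_ext _ (fun n => lam * (h n * cos (INR n * t)))) by (intros; ring).
    rewrite Series_scal_l, Hv; do 2 f_equal; ring. }
  (* P + i Q is e^{ikt} times the conjugate of X + i Y. *)
  set (P := fun t => cos (INR k * t) * X t + sin (INR k * t) * Y t).
  set (Q := fun t => sin (INR k * t) * X t - cos (INR k * t) * Y t).
  assert (CP : Cont P) by (unfold P; auto with cont).
  assert (CQ : Cont Q) by (unfold Q; auto with cont).
  assert (HPQ : forall t, P t ^ 2 + Q t ^ 2 = exp (lam * bump 0 (cos t - c')) ^ 2).
  { intros t; rewrite <- Hmod; unfold P, Q.
    pose proof (sin2_cos2 (INR k * t)) as S2; unfold Rsqr in S2.
    transitivity ((sin (INR k * t) * sin (INR k * t) + cos (INR k * t) * cos (INR k * t))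
      * (X t ^ 2 + Y t ^ 2)); [ring|rewrite S2; ring]. }
  assert (HF : forall l, fourier P Q l = if le_dec l k then a (k - l)%nat else 0).
  { intros l; rewrite <- real_adjoint_delta.
    pose proof (real_adjoint_fourier a (fun t => cos (INR k * t)) (fun t => sin (INR k * t)) 1 l
      (proj1 (exp_coeff_l1 w Hwl)) CX CY (Cont_cos _) (Cont_sin _) Rle_0_1) as E.
    assert (H1 : forall t, cos (INR k * t) ^ 2 + sin (INR k * t) ^ 2 <= 1 ^ 2).
    { intros t; pose proof (sin2_cos2 (INR k * t)) as S2; unfold Rsqr in S2; simpl; lra. }
    specialize (E H1); unfold P, Q, X, Y; rewrite <- E.
    f_equal; apply functional_extensionality; intros i; apply fourier_cos_sin. }
  (* A continuous cut-off, 0 where cos t <= c and 1 where cos t >= c'. *)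
  set (chi := fun t => clamp ((cos t - c) * / (c' - c))).
  assert (Cchi : Cont chi).
  { unfold chi, clamp, Rdiv; auto 12 with cont. }
  assert (Hcc : 0 < / (c' - c)) by (apply Rinv_0_lt_compat; unfold c'; lra).
  exists (fun l => / a 0%nat * fourier P Q l),
    (fun t => / a 0%nat * (chi t * P t)), (fun t => / a 0%nat * (chi t * Q t)),
    (/ a 0%nat * exp lam).
  assert (Hia : 0 < / a 0%nat) by (apply Rinv_0_lt_compat; auto).
  repeat split; auto with cont.
  - rewrite HF; destruct (le_dec k k); [|lia]; rewrite Nat.sub_diag; field; lra.
  - intros l Hl; rewrite HF; destruct (le_dec l k); [lia|ring].
  - apply Rmult_le_pos; [lra|left; apply exp_pos].
  - intros t; pose proof (clamp_range ((cos t - c) * / (c' - c))) as B; fold (chi t) in B.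
    replace ((/ a 0%nat * (chi t * P t)) ^ 2 + (/ a 0%nat * (chi t * Q t)) ^ 2)
      with ((/ a 0%nat) ^ 2 * (chi t ^ 2 * (P t ^ 2 + Q t ^ 2))) by ring.
    rewrite Rpow_mult_distr; apply Rmult_le_compat_l; [apply pow2_ge_0|].
    rewrite <- (Rmult_1_l (exp lam ^ 2)); apply Rmult_le_compat.
    + apply pow2_ge_0.
    + pose proof (pow2_ge_0 (P t)); pose proof (pow2_ge_0 (Q t)); lra.
    + apply pow_le_1; auto.
    + rewrite HPQ; apply pow_incr; split; [left; apply exp_pos|].
      (* Since 0 ^ 0 = 1 here, [bump 0] is at most 1, whence the bound exp lam. *)
      pose proof (bump_bounded 0 (cos t - c')) as B0; simpl in B0.
      assert (Hle : lam * bump 0 (cos t - c') <= lam) by nra.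
      destruct Hle as [L|L]; [left; apply exp_increasing; auto|rewrite L; lra].
  - unfold chi; rewrite clamp_neg; [ring|]; nra.
  - unfold chi; rewrite clamp_neg; [ring|]; nra.
  (* The part cut away lives where cos t < c'; there the bump vanishes and the modulus of P + i Q is
     exp 0 = 1. *)
  - assert (Hb : l2_le (fourier (fun t => (1 - chi t) * P t) (fun t => (1 - chi t) * Q t)) 1).
    { apply bessel; auto with cont; intros t.
      pose proof (clamp_range ((cos t - c) * / (c' - c))) as B; fold (chi t) in B.
      replace (((1 - chi t) * P t) ^ 2 + ((1 - chi t) * Q t) ^ 2)
        with ((1 - chi t) ^ 2 * (P t ^ 2 + Q t ^ 2)) by ring; rewrite HPQ.
      destruct (Rle_lt_dec (cos t) c') as [L|L].
      - rewrite bump_nonpos by lra; rewrite Rmult_0_r, exp_0.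
        pose proof (pow_le_1 (1 - chi t) 2 ltac:(lra)); simpl pow in *; lra.
      - replace (chi t) with 1; [unfold Rminus; rewrite Rplus_opp_r; simpl; lra|].
        symmetry; apply clamp_large; apply Rmult_le_reg_r with (c' - c); [unfold c'; lra|].
        rewrite Rmult_assoc, Rinv_l by (unfold c'; lra); lra. }
    apply l2_le_weaken with (/ a 0%nat * 1).
    + split; [lra|]; rewrite Rmult_1_r.
      rewrite <- (Rinv_inv delta); apply Rinv_le_contravar; lra.
    + rewrite <- (Rabs_pos_eq (/ a 0%nat)) by lra.
      refine (l2_le_ext _ _ _ _ (l2_le_scal _ _ _ Hb)); intros l.
      rewrite fourier_scal, <- Rmult_minus_distr_l by auto with cont.
      f_equal; [symmetry; apply Rabs_pos_eq; lra|].
      assert (E : fourier P Q l = fourier (fun t => (1 - chi t) * P t + chi t * P t)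
        (fun t => (1 - chi t) * Q t + chi t * Q t) l).
      { f_equal; apply functional_extensionality; intros t; ring. }
      rewrite E, fourier_plus by auto with cont; ring.
Qed.

(** Induction on the degree: subtracting the right multiple of the almost attained polynomial [b]
    removes the leading coefficient. *)
Lemma polynomial_approximable (c : R) (k : nat) : c < 1 -> forall x : nat -> R,
  (forall l, (k <= l)%nat -> x l = 0) -> approximable c x.
Proof.
  intros Hc; induction k as [|k IH]; intros x Hx eta Heta.
  - exists (fun _ => 0), (fun _ => 0), 0; split.
    + repeat split; auto with cont; try lra; intros; lra.
    + apply l2_le_weaken with 0; [lra|]; intros K.
      rewrite (sum_n_Rext _ (fun _ => 0 * 0)), sum_n_scal; [lra|].
      intros l; rewrite Hx by lia; unfold fourier.
      replace (fun t => 0 * cos (INR l * t) + 0 * sin (INR l * t)) with (fun _ : R => 0)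
        by (apply functional_extensionality; intros; ring).
      rewrite mean_const; ring.
  (* The 1 keeps the divisor positive when [x k] is 0. *)
  - set (y := Rabs (x k) + 1).
    assert (Hy : 0 < y) by (unfold y; pose proof (Rabs_pos (x k)); lra).
    destruct (leading_monomial_approx c k (eta / 2 / y) Hc) as [b [p [s [K [Hb [Hb0 [HS HE]]]]]]].
    { apply Rdiv_lt_0_compat; lra. }
    destruct (IH (fun l => x l - x k * b l)) with (eta := eta / 2) as [p' [s' [K' [HS' HE']]]].
    + intros l Hl; destruct (Nat.eq_dec l k) as [->|D]; [rewrite Hb; ring|].
      rewrite Hx, Hb0 by lia; ring.
    + lra.
    + exists (fun t => x k * p t + p' t), (fun t => x k * s t + s' t), (2 * (Rabs (x k) * K + K')).
      split; [apply supported_combination; auto|].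
      destruct HS as [_ C1 C2 _ _], HS' as [_ C1' C2' _ _].
      apply l2_le_weaken with (Rabs (x k) * (eta / 2 / y) + eta / 2).
      * assert (0 <= eta / 2 / y) by (left; apply Rdiv_lt_0_compat; lra).
        pose proof (Rabs_pos (x k)); split; [nra|].
        assert (Rabs (x k) * (eta / 2 / y) <= y * (eta / 2 / y)) by (apply Rmult_le_compat_r; auto; unfold y; lra).
        replace (y * (eta / 2 / y)) with (eta / 2) in H1 by (field; lra); lra.
      * apply (l2_le_ext (fun l => x k * (b l - fourier p s l)
          + (x l - x k * b l - fourier p' s' l))).
        -- intros l; rewrite fourier_plus, fourier_scal by auto with cont; ring.
        -- apply l2_le_plus; auto using l2_le_scal; try lra.
           apply Rmult_le_pos; [apply Rabs_pos|left; apply Rdiv_lt_0_compat; lra].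
Qed.

Lemma l2_approximable (c : R) (x : nat -> R) : c < 1 -> ex_series (fun k => x k ^ 2) ->
  approximable c x.
Proof.
  intros Hc Hx eta Heta.
  assert (He2 : 0 < (eta / 2) ^ 2) by (apply pow_lt; lra).
  destruct (proj2 (is_lim_seq_spec _ _) (tail_tends_0 _ Hx) (mkposreal _ He2)) as [N HN].
  specialize (HN N (le_n N)); simpl in HN; rewrite Rminus_0_r in HN.
  apply Rabs_lt_between in HN.
  set (xN := fun k => if le_dec k N then x k else 0).
  destruct (polynomial_approximable c (S N) Hc xN) with (eta := eta / 2)
    as [p [s [K [HS HE]]]]; [|lra|].
  { intros l Hl; unfold xN; destruct (le_dec l N); [lia|auto]. }
  exists p, s, K; split; auto.
  replace eta with (eta / 2 + eta / 2) by field.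
  apply (l2_le_ext (fun k => (x k - xN k) + (xN k - fourier p s k))); [intros; ring|].
  apply l2_le_plus; auto; try lra; intros M.
  assert (E : forall m, sum_n (fun k => (x k - xN k) ^ 2) (N + m)
    = sum_n (fun k => x k ^ 2) (N + m) - sum_n (fun k => x k ^ 2) N :> R).
  { induction m as [|m IH].
    - rewrite Nat.add_0_r.
      rewrite (sum_n_Rext_loc _ (fun _ => 0 * 0)); [rewrite sum_n_scal; ring|].
      intros l Hl; unfold xN; destruct (le_dec l N); [ring|lia].
    - replace (N + S m)%nat with (S (N + m)) by lia; rewrite !sum_n_succ, IH.
      unfold xN; destruct (le_dec (S (N + m)) N); [lia|ring]. }
  apply Rle_trans with (sum_n (fun k => (x k - xN k) ^ 2) (N + M)).
  - apply sum_n_mono; [intros; apply pow2_ge_0|lia].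
  - rewrite E.
    assert (sum_n (fun k => x k ^ 2) (N + M) <= Series (fun k => x k ^ 2))
      by (apply sum_n_le_Series; auto; intros; apply pow2_ge_0).
    simpl pow in *; lra.
Qed.

(** * The vector with slowly growing orbit *)

(** Thresholds for [cos t] increasing to 1, so that the arcs [arc j < cos t] shrink to the point
    1. *)
Definition arc (j : nat) : R := 1 - / (INR j + 2).

Lemma arc_lt_1 (j : nat) : arc j < 1.
Proof.
  unfold arc; assert (0 < / (INR j + 2)); [|lra].
  apply Rinv_0_lt_compat; pose proof (pos_INR j); lra.
Qed.

Lemma arc_mono (i j : nat) : (i <= j)%nat -> arc i <= arc j.
Proof.
  intros H; apply le_INR in H; pose proof (pos_INR i); unfold arc.
  assert (/ (INR j + 2) <= / (INR i + 2)) by (apply Rinv_le_contravar; lra); lra.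
Qed.

Lemma arc_exhausts (x : R) : x < 1 -> exists j, x < arc j.
Proof.
  intros H; destruct (archimed_cor1 (1 - x)) as [N [HN HN0]]; [lra|].
  exists N; unfold arc; assert (0 < INR N) by (apply lt_0_INR; auto).
  assert (/ (INR N + 2) <= / INR N) by (apply Rinv_le_contravar; lra); lra.
Qed.

(** The recursion runs in the subset type of [P], because a next state exists only for states that
    satisfy the invariant. *)
Lemma dependent_choice (X : Type) (P : nat -> X -> Prop) (Q : nat -> X -> X -> Prop) :
  (forall j x, P j x -> exists y, P (S j) y /\ Q j x y) ->
  forall x0, P 0%nat x0 ->
  exists f : nat -> X, f 0%nat = x0 /\ (forall j, P j (f j)) /\ forall j, Q j (f j) (f (S j)).
Proof.
  intros H x0 H0.
  pose (step := fun j (x : {x | P j x}) =>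
    let y := constructive_indefinite_description _ (H j (proj1_sig x) (proj2_sig x)) in
    exist (P (S j)) (proj1_sig y) (proj1 (proj2_sig y))).
  pose (f := nat_rect (fun j => {x | P j x}) (exist _ x0 H0) step).
  exists (fun j => proj1_sig (f j)); split; [reflexivity|split].
  - intros j; exact (proj2_sig (f j)).
  - intros j; exact (proj2 (proj2_sig (constructive_indefinite_description _
      (H j (proj1_sig (f j)) (proj2_sig (f j)))))).
Qed.

Lemma geometric_half_sum (N : nat) : sum_n (fun i => (/ 2) ^ S i) N = 1 - (/ 2) ^ S N :> R.
Proof.
  induction N as [|N IH]; [rewrite sum_n_0; simpl; field|].
  rewrite sum_n_succ, IH; simpl; field.
Qed.

Lemma half_pow_pos (n : nat) : 0 < (/ 2) ^ n.
Proof. apply pow_lt; lra. Qed.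

Lemma ex_series_half : ex_series (fun i => (/ 2) ^ S i) /\ Series (fun i => (/ 2) ^ S i) <= 1.
Proof.
  apply nonneg_series_bounded; [intros; left; apply half_pow_pos|].
  intros n; rewrite geometric_half_sum; pose proof (half_pow_pos (S n)); lra.
Qed.

Lemma l2_le_telescope (X : nat -> nat -> R) (d : nat -> R) (M : R) (j : nat) : 0 <= M ->
  (forall i, 0 <= d i) -> (forall i, d (j + i)%nat <= M * (/ 2) ^ S i) ->
  (forall i, l2_le (fun k => X (S i) k - X i k) (d i)) ->
  forall i, l2_le (fun k => X (j + i)%nat k - X j k) M.
Proof.
  intros HM Hd0 Hd HX i.
  assert (G : l2_le (fun k => X (j + i)%nat k - X j k) (M * (1 - (/ 2) ^ i))).
  { induction i as [|i IH].
    - rewrite Nat.add_0_r; intros K; simpl; rewrite (sum_n_Rext _ (fun _ => 0 * 0)).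
      + rewrite sum_n_scal; lra.
      + intros k; ring.
    - apply (l2_le_ext (fun k => (X (j + i)%nat k - X j k) + (X (S (j + i)) k - X (j + i)%nat k))).
      { intros k; replace (j + S i)%nat with (S (j + i)) by lia; ring. }
      assert (B : 0 <= (/ 2) ^ i <= 1) by (apply pow_le_1; lra).
      apply l2_le_weaken with (M * (1 - (/ 2) ^ i) + d (j + i)%nat).
      + specialize (Hd i); specialize (Hd0 (j + i)%nat); simpl pow in *; split; nra.
      + apply l2_le_plus; auto; nra. }
  apply l2_le_weaken with (2 := G).
  assert (B : 0 <= (/ 2) ^ i <= 1) by (apply pow_le_1; lra); nra.
Qed.

Lemma exists_large_q (q : R -> R) : is_lim q p_infty p_infty ->
  forall B N, exists n : nat, (N < n)%nat /\ B < q (INR n).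
Proof.
  intros H B N; apply is_lim_spec in H; destruct (H B) as [x Hx].
  destruct (Rle_lt_dec x 0) as [L|L].
  - exists (S N); split; [lia|]; apply Hx.
    apply Rle_lt_trans with (1 := L), lt_0_INR; lia.
  - destruct (INR_unbounded x) as [m Hm]; exists (S N + m)%nat; split; [lia|]; apply Hx.
    rewrite plus_INR; pose proof (pos_INR (S N)); lra.
Qed.

(** The constant function 1, the starting vector that keeps the limit away from 0. *)
Definition delta0 (k : nat) : R := if Nat.eq_dec 0 k then 1 else 0.

(* The error bound [e^(- n j)] absorbs the worst possible growth [e^(n j)] of the error. *)
Lemma slow_vector (q : R -> R) : is_lim q p_infty p_infty ->
  exists (f : nat -> R) (p s : nat -> R -> R) (K : nat -> R) (n : nat -> nat),
    f 0%nat <> 0 /\ ex_series (fun k => f k ^ 2) /\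
    (forall j, supported (arc j) (p j) (s j) (K j)) /\
    (forall j, (j < n j)%nat) /\
    (forall j, exp 1 * K j + 1 < q (INR (n j))) /\
    (forall j, l2_le (fun k => f k - fourier (p j) (s j) k) (exp (- INR (n j)))).
Proof.
  intros Hq.
  pose (P := fun j (x : (R -> R) * (R -> R) * R * nat) => match x with (p, s, K, n) =>
    supported (arc j) p s K /\ (j < n)%nat /\ exp 1 * K + 1 < q (INR n) end).
  pose (Q := fun j (x y : (R -> R) * (R -> R) * R * nat) => match x, y with
    (p, s, K, n), (p', s', K', n') => (n < n')%nat /\
      l2_le (fun k => fourier p' s' k - fourier p s k) (exp (- INR n) * (/ 2) ^ S j) end).
  assert (D0 : ex_series (fun k => delta0 k ^ 2)).
  { apply (nonneg_series_bounded _ 1); [intros; apply pow2_ge_0|]; intros N.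
    rewrite (sum_n_single _ 0); unfold delta0; [simpl; lra|].
    intros k Hk; destruct (Nat.eq_dec 0 k); [lia|ring]. }
  (* The starting error 1/4 and the later drift, at most e^{-n_0} <= 1/2, add up to less than 1, so
     the coefficient of index 0 of the limit is not 0. *)
  destruct (l2_approximable (arc 0) delta0 (arc_lt_1 0) D0 (/ 4) ltac:(lra))
    as [p0 [s0 [K0 [HS0 HE0]]]].
  destruct (exists_large_q q Hq (exp 1 * K0 + 1) 0) as [n0 [Hn0 Hq0]].
  destruct (dependent_choice _ P Q) with (x0 := (p0, s0, K0, n0)) as [F [F0 [FP FQ]]].
  - intros j [[[p s] K] n] [HS [Hn HK]].
    assert (Hx : ex_series (fun k => fourier p s k ^ 2)).
    { destruct HS; apply (l2_le_series _ K), bessel; auto. }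
    (* The current projection is approximated from the next smaller arc, with a precision fixed by
       the time [n] already chosen. The new bound K' may be huge; n' is chosen after it. *)
    destruct (l2_approximable (arc (S j)) (fourier p s) (arc_lt_1 _) Hx
      (exp (- INR n) * (/ 2) ^ S j)) as [p' [s' [K' [HS' HE']]]].
    { apply Rmult_lt_0_compat; [apply exp_pos|apply half_pow_pos]. }
    destruct (exists_large_q q Hq (exp 1 * K' + 1) n) as [n' [Hn' Hq']].
    exists (p', s', K', n'); split; [split; [auto|split; [lia|auto]]|split; auto].
    intros N; rewrite (sum_n_Rext _ (fun k => (fourier p s k - fourier p' s' k) ^ 2)); auto.
    intros k; ring.
  - split; [auto|split; auto].
  - set (p := fun j => fst (fst (fst (F j)))); set (s := fun j => snd (fst (fst (F j)))).
    set (K := fun j => snd (fst (F j))); set (n := fun j => snd (F j)).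
    assert (HP : forall j, supported (arc j) (p j) (s j) (K j) /\ (j < n j)%nat /\
      exp 1 * K j + 1 < q (INR (n j))).
    { intros j; specialize (FP j); unfold p, s, K, n.
      destruct (F j) as [[[? ?] ?] ?]; exact FP. }
    assert (HQ : forall j, (n j < n (S j))%nat /\
      l2_le (fun k => fourier (p (S j)) (s (S j)) k - fourier (p j) (s j) k)
        (exp (- INR (n j)) * (/ 2) ^ S j)).
    { intros j; specialize (FQ j); unfold p, s, n.
      destruct (F j) as [[[? ?] ?] ?], (F (S j)) as [[[? ?] ?] ?]; exact FQ. }
    set (x := fun j => fourier (p j) (s j)).
    assert (Hmono : forall j i, (n j <= n (j + i))%nat).
    { intros j; induction i as [|i IH]; [rewrite Nat.add_0_r; lia|].
      replace (j + S i)%nat with (S (j + i)) by lia; destruct (HQ (j + i)%nat); lia. }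
    (* As the times increase, the errors from step j on are at most e^{-n_j} 2^{-i-1} and add up to
       at most e^{-n_j}. *)
    assert (T : forall j i, l2_le (fun k => x (j + i)%nat k - x j k) (exp (- INR (n j)))).
    { intros j; apply (l2_le_telescope x (fun i => exp (- INR (n i)) * (/ 2) ^ S i)).
      - left; apply exp_pos.
      - intros i; apply Rmult_le_pos; [left; apply exp_pos|left; apply half_pow_pos].
      - intros i; apply Rmult_le_compat; try (left; apply exp_pos); try (left; apply half_pow_pos).
        + specialize (Hmono j i); apply le_INR in Hmono.
          destruct Hmono as [L|E]; [left; apply exp_increasing; lra|rewrite E; lra].
        + replace (S (j + i)) with (j + S i)%nat by lia; rewrite pow_add.
          rewrite <- (Rmult_1_l ((/ 2) ^ S i)) at 2.
          apply Rmult_le_compat_r; [left; apply half_pow_pos|apply pow_le_1; lra].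
      - intros i; exact (proj2 (HQ i)). }
    assert (Hlim : forall k, exists l : R, is_lim_seq (fun i => x i k) l).
    { intros k; apply ex_lim_seq_cauchy_corr; intros eps.
      assert (He : 0 < eps / 2) by (destruct eps; simpl; lra).
      (* Since n_N > N, the distance e^{-n_N} is at most 1 / N. *)
      destruct (archimed_cor1 (eps / 2) He) as [N [HN HN0]].
      exists N.
      assert (G : forall m, (N <= m)%nat -> Rabs (x m k - x N k) < eps / 2).
      { intros m Hm; replace m with (N + (m - N))%nat by lia.
        apply Rle_lt_trans with (exp (- INR (n N))).
        - apply (l2_le_coord (fun k => x (N + (m - N))%nat k - x N k)); auto.
          left; apply exp_pos.
        - apply Rle_lt_trans with (2 := HN).
          rewrite exp_Ropp; apply Rinv_le_contravar; [apply lt_0_INR; auto|].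
          destruct (HP N) as [_ [Hn _]]; apply lt_INR in Hn.
          pose proof (exp_ge_1_plus (INR (n N))); lra. }
      intros a b Ha Hb; pose proof (G a Ha) as Ga; pose proof (G b Hb) as Gb.
      apply Rabs_lt_between in Ga; apply Rabs_lt_between in Gb; apply Rabs_lt_between; lra. }
    pose (f := fun k => proj1_sig (constructive_indefinite_description _ (Hlim k))).
    assert (Hf : forall k, is_lim_seq (fun i => x i k) (f k)).
    { intros k; unfold f; destruct (constructive_indefinite_description _ (Hlim k)); auto. }
    assert (HT : forall j, l2_le (fun k => f k - x j k) (exp (- INR (n j)))).
    { intros j; apply (l2_le_lim (fun i k => x (j + i)%nat k - x j k)); [|apply T].
      intros k; apply is_lim_seq_minus'; [|apply is_lim_seq_const].
      apply (is_lim_seq_ext (fun i => x (i + j)%nat k)); [intros i; f_equal; lia|].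
      apply (is_lim_seq_incr_n (fun i => x i k) j); auto. }
    exists f, p, s, K, n; split; [|split; [|split; [|split; [|split]]]];
      [| |exact (fun j => proj1 (HP j))|exact (fun j => proj1 (proj2 (HP j)))
       |exact (fun j => proj2 (proj2 (HP j)))|exact HT].
    + intros E.
      assert (B1 : Rabs (f 0%nat - x 0%nat 0%nat) <= exp (- INR (n 0%nat)))
        by (apply (l2_le_coord (fun k => f k - x 0%nat k)); auto; left; apply exp_pos).
      assert (B2 : Rabs (delta0 0 - fourier p0 s0 0%nat) <= / 4)
        by (apply (l2_le_coord (fun k => delta0 k - fourier p0 s0 k)); auto; lra).
      assert (B3 : exp (- INR (n 0%nat)) <= / 2).
      { rewrite exp_Ropp; apply Rinv_le_contravar; [lra|].
        destruct (HP 0%nat) as [_ [Hn _]]; apply (le_INR 1) in Hn; simpl in Hn.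
        pose proof (exp_ge_1_plus (INR (n 0%nat))); lra. }
      assert (Ex : x 0%nat 0%nat = fourier p0 s0 0%nat)
        by (unfold x, p, s; rewrite F0; reflexivity).
      rewrite E, Ex in B1; change (delta0 0) with 1 in B2.
      apply Rabs_le_between in B1; apply Rabs_le_between in B2; lra.
    + apply (l2_le_series f (exp (- INR (n 0%nat)) + K 0%nat)).
      apply (l2_le_ext (fun k => (f k - x 0%nat k) + x 0%nat k)); [intros; ring|].
      destruct (HP 0%nat) as [[HK Cp Cs HB _] _].
      apply l2_le_plus; [left; apply exp_pos|exact HK|exact (HT 0%nat)|exact (bessel _ _ _ Cp Cs HB)].
Qed.

(** * The flat symbol *)

(** Fubini under a product majorant: a finite sum over i commutes with the sum over n, and the error
    is at most the tail of [beta] times the sum of [gamma]. *)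
Lemma Series_swap (x : nat -> nat -> R) (beta gamma : nat -> R) :
  (forall i n, Rabs (x i n) <= beta i * gamma n) -> (forall i, 0 <= beta i) ->
  ex_series beta -> ex_series gamma ->
  is_series (fun i => Series (x i)) (Series (fun n => Series (fun i => x i n))).
Proof.
  intros H Hb0 Hb Hg.
  assert (Hxi : forall i, ex_series (x i)).
  { intros i; apply (ex_series_dominated _ (fun n => beta i * gamma n)); auto.
    apply ex_series_Rscal; auto. }
  assert (Hxn : forall n, ex_series (fun i => x i n)).
  { intros n; apply (ex_series_dominated _ (fun i => gamma n * beta i)).
    - intros i; rewrite Rmult_comm; auto.
    - apply ex_series_Rscal; auto. }
  assert (Hxx : ex_series (fun n => Series (fun i => x i n))).
  { apply (ex_series_dominated _ (fun n => Series beta * gamma n)).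
    - intros n; rewrite Rmult_comm, <- Series_scal_l; apply Rabs_Series_le.
      + intros i; rewrite Rmult_comm; auto.
      + apply ex_series_Rscal; auto.
    - apply ex_series_Rscal; auto. }
  assert (Hpart : forall N, ex_series (fun n => sum_n (fun i => x i n) N) /\
    sum_n (fun i => Series (x i)) N = Series (fun n => sum_n (fun i => x i n) N) :> R).
  { induction N as [|N [IH1 IH2]].
    - split; [apply (ex_series_ext (x 0%nat)); auto; intros n; rewrite sum_n_0; reflexivity|].
      rewrite sum_n_0; apply Series_ext; intros n; rewrite sum_n_0; reflexivity.
    - split.
      + apply (ex_series_ext (fun n => sum_n (fun i => x i n) N + x (S N) n)).
        * intros n; rewrite sum_n_succ; reflexivity.
        * apply ex_series_Rplus; auto.
      + rewrite sum_n_succ, IH2, <- Series_plus by auto.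
        apply Series_ext; intros n; rewrite sum_n_succ; reflexivity. }
  apply is_series_partial_sums.
  apply (is_lim_seq_squeeze_0 _ (fun N => (Series beta - sum_n beta N) * Series gamma)).
  - intros N; rewrite (proj2 (Hpart N)), Rabs_minus_sym, <- Series_minus by (auto; apply Hpart).
    rewrite <- Series_scal_l; apply Rabs_Series_le; [|apply ex_series_Rscal; auto]; intros n.
    replace ((Series beta - sum_n beta N) * gamma n)
      with (Series (fun i => gamma n * beta i) - sum_n (fun i => gamma n * beta i) N)
      by (rewrite Series_scal_l, sum_n_scal; ring).
    apply Series_tail_bound; [intros i; rewrite Rmult_comm; auto|apply ex_series_Rscal; auto].
  - replace (Finite 0) with (Rbar_mult 0 (Series gamma)) by (simpl; f_equal; ring).
    apply is_lim_seq_scal_r, tail_tends_0; auto.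
Qed.

Lemma ex_series_finite (b : nat -> R) (m : nat) : (forall k, (m < k)%nat -> b k = 0) -> ex_series b.
Proof.
  intros H; exists (sum_n b m); apply is_series_partial_sums.
  apply is_lim_seq_ext_loc with (fun _ => sum_n b m); [|apply is_lim_seq_const].
  exists m; intros n Hn; induction Hn as [|n Hn IH]; auto.
  rewrite sum_n_succ, <- IH, (H (S n)) by lia; symmetry; apply Rplus_0_r.
Qed.

Lemma Series_sq_inv_le : Series (fun n => / 2 * / (INR n + 1) ^ 2) <= 1.
Proof.
  apply nonneg_series_bounded.
  - intros n; apply Rmult_le_pos; [lra|]; left; apply Rinv_0_lt_compat, pow_lt.
    pose proof (pos_INR n); lra.
  - intros n; rewrite sum_n_scal.
    assert (sum_n (fun n => / (INR n + 1) ^ 2) n <= 2); [|lra].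
    apply sum_inv_sq_le.
Qed.

(** The i-th bump lives where cos t < arc i and vanishes on the i-th arc. Its weight must beat its
    seminorms, so that the sum is smooth, and the numbers d 0, ..., d i, so that the sum is flat on
    each arc. *)
Lemma flat_symbol (d : nat -> R) : (forall j, 0 < d j) -> exists h : nat -> R,
  rapid h /\
  Series (fun n => Rabs (h n)) <= 1 /\
  (forall r t, 0 <= r < 1 -> 0 <= PSeries (cos_coeff h t) r) /\
  (forall t, cos t < 1 -> 0 < Series (cos_coeff h t)) /\
  (forall t, cos t = 1 -> Series (cos_coeff h t) = 0) /\
  (forall j t, arc j < cos t -> Series (cos_coeff h t) <= d j).
Proof.
  intros Hd.
  pose (H := fun i => proj1_sig (constructive_indefinite_description _
    (bump_cosine_series (-1) (arc i)))).
  assert (HH : forall i, rapid (H i) /\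
    (forall t, Series (fun n => H i n * cos (INR n * t)) = bump 0 (-1 * cos t + arc i)) /\
    (forall r t, 0 <= r < 1 -> 0 <= Series (fun n => H i n * cos (INR n * t) * r ^ n))).
  { intros i; unfold H; destruct (constructive_indefinite_description _ _) as [h Hh]; simpl.
    tauto. }
  clearbody H.
  pose (K := fun i p => proj1_sig (constructive_indefinite_description _ (proj1 (HH i) p))).
  assert (HK : forall i p n, Rabs (H i n) * (INR n + 1) ^ p <= K i p).
  { intros i p; unfold K; destruct (constructive_indefinite_description _ _); auto. }
  clearbody K.
  (* Bounds the seminorms of order up to i + 2 of the i-th bump, a diagonal choice: for each order
     only finitely many i escape. The 2 makes order 2 available for every i, as the l1 bound
     requires. *)
  set (C := fun i => 1 + sum_n (fun p => Rabs (K i p)) (i + 2)).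
  assert (HC : forall i, 1 <= C i).
  { intros i; unfold C; pose proof (sum_n_nonneg (fun p => Rabs (K i p)) (i + 2)
      (fun p => Rabs_pos _)); lra. }
  assert (HCK : forall i p, (p <= i + 2)%nat -> K i p <= C i).
  { intros i p Hp; pose proof (sum_n_term_le (fun p => Rabs (K i p)) (i + 2) p
      (fun p => Rabs_pos _) Hp); pose proof (Rle_abs (K i p)); unfold C; simpl in *; lra. }
  (* Adding reciprocals gives a positive number that is at most 1 and at most each of d 0, ..., d
     i. *)
  set (D := fun i => / (1 + sum_n (fun k => / d k) i)).
  assert (Hid : forall k, 0 < / d k) by (intros; apply Rinv_0_lt_compat; auto).
  assert (HD0 : forall i, 0 < D i <= 1).
  { intros i; unfold D.
    pose proof (sum_n_nonneg (fun k => / d k) i (fun k => Rlt_le _ _ (Hid k))); split.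
    - apply Rinv_0_lt_compat; lra.
    - rewrite <- Rinv_1; apply Rinv_le_contravar; lra. }
  assert (HD : forall i j, (j <= i)%nat -> D i <= d j).
  { intros i j Hj; unfold D; rewrite <- (Rinv_inv (d j)); apply Rinv_le_contravar; auto.
    pose proof (sum_n_term_le (fun k => / d k) i j (fun k => Rlt_le _ _ (Hid k)) Hj);
      simpl in *; lra. }
  (* The powers of 1/2 make the sum over i at most 1; the extra 1/2 compensates the sum of 1 / (n +
     1)^2, which is at most 2. *)
  set (w := fun i => (/ 2) ^ S i * (/ 2 * (/ C i * D i))).
  assert (HiC : forall i, 0 < / C i <= 1).
  { intros i; specialize (HC i); split; [apply Rinv_0_lt_compat; lra|].
    rewrite <- Rinv_1; apply Rinv_le_contravar; lra. }
  assert (Hw0 : forall i, 0 < w i).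
  { intros i; unfold w; pose proof (half_pow_pos (S i)); destruct (HiC i), (HD0 i).
    apply Rmult_lt_0_compat; [auto|].
    apply Rmult_lt_0_compat; [lra|apply Rmult_lt_0_compat; lra]. }
  assert (HwD : forall i, w i <= (/ 2) ^ S i * D i).
  { intros i; unfold w; apply Rmult_le_compat_l; [left; apply half_pow_pos|].
    destruct (HiC i), (HD0 i); nra. }
  assert (HwC : forall i x, 0 <= x <= C i -> w i * x <= (/ 2) ^ S i * / 2).
  { intros i x Hx; unfold w; rewrite Rmult_assoc.
    apply Rmult_le_compat_l; [left; apply half_pow_pos|].
    destruct (HiC i), (HD0 i); specialize (HC i).
    assert (/ C i * x <= 1).
    { apply Rmult_le_reg_l with (C i); [lra|].
      rewrite <- Rmult_assoc, Rinv_r by lra; lra. }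
    assert (0 <= / C i * x) by (apply Rmult_le_pos; lra).
    replace (/ 2 * (/ C i * D i) * x) with (/ 2 * (D i * (/ C i * x))) by ring.
    assert (D i * (/ C i * x) <= 1 * 1) by (apply Rmult_le_compat; lra); lra. }
  assert (Hn1 : forall n p, 0 < (INR n + 1) ^ p)
    by (intros; apply pow_lt; pose proof (pos_INR n); lra).
  assert (HwH : forall i n p, (p <= i + 2)%nat ->
    Rabs (w i * H i n) * (INR n + 1) ^ p <= (/ 2) ^ S i * / 2).
  { intros i n p Hp; rewrite Rabs_mult, (Rabs_pos_eq (w i)) by (left; auto).
    rewrite Rmult_assoc; apply HwC; split.
    - apply Rmult_le_pos; [apply Rabs_pos|left; auto].
    - eapply Rle_trans; [apply HK|apply HCK; auto]. }
  set (gamma := fun n => / 2 * / (INR n + 1) ^ 2).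
  assert (Hgamma : ex_series gamma) by (apply ex_series_Rscal, ex_series_inv_sq).
  assert (Hbg : forall i n, Rabs (w i * H i n) <= (/ 2) ^ S i * gamma n).
  { intros i n; unfold gamma; apply Rmult_le_reg_r with ((INR n + 1) ^ 2); auto.
    rewrite !Rmult_assoc, Rinv_l, Rmult_1_r by (apply Rgt_not_eq, Hn1).
    apply HwH; lia. }
  assert (Hh0 : forall i, 0 <= (/ 2) ^ S i) by (intros; left; apply half_pow_pos).
  set (h := fun n => Series (fun i => w i * H i n)).
  assert (Hg0 : forall n, 0 <= gamma n).
  { intros n; unfold gamma; apply Rmult_le_pos; [lra|left; apply Rinv_0_lt_compat; auto]. }
  assert (Hmult : forall m, (forall n, Rabs (m n) <= 1) ->
    is_series (fun i => w i * Series (fun n => H i n * m n)) (Series (fun n => h n * m n))).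
  { intros m Hm.
    pose proof (Series_swap (fun i n => w i * H i n * m n) (fun i => (/ 2) ^ S i) gamma) as Sw.
    assert (E1 : Series (fun n => Series (fun i => w i * H i n * m n))
      = Series (fun n => h n * m n)).
    { apply Series_ext; intros n; unfold h; apply Series_scal_r. }
    rewrite <- E1.
    apply (is_series_ext (fun i => Series (fun n => w i * H i n * m n))).
    - intros i; rewrite <- Series_scal_l; apply Series_ext; intros n; ring.
    - apply Sw; auto; [|apply ex_series_half].
      intros i n; eapply Rle_trans; [apply Rabs_mult_le_l; auto|auto]. }
  assert (HU : forall t, is_series (fun i => w i * bump 0 (-1 * cos t + arc i))
    (Series (cos_coeff h t))).
  { intros t; apply (is_series_ext (fun i => w i * Series (fun n => H i n * cos (INR n * t)))).
    - intros i; rewrite (proj1 (proj2 (HH i))); reflexivity.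
    - apply Hmult; intros n; apply Rabs_cos_le_1. }
  assert (Hu0 : forall t i, 0 <= w i * bump 0 (-1 * cos t + arc i)).
  { intros t i; apply Rmult_le_pos; [left; auto|apply bump_ge_0]. }
  exists h; split; [|split; [|split; [|split; [|split]]]].
  - intros p.
    (* The finitely many i with p > i + 2 are not covered by [C]; for them the seminorm itself
       enters the bound. *)
    set (beta := fun i => (/ 2) ^ S i + (if le_dec p (i + 2) then 0 else w i * K i p)).
    assert (Hbeta : ex_series beta).
    { apply ex_series_Rplus; [apply ex_series_half|].
      apply (ex_series_finite _ p); intros i Hi; destruct (le_dec p (i + 2)); [auto|lia]. }
    exists (Series beta); intros n.
    rewrite <- (Rabs_pos_eq ((INR n + 1) ^ p)) by (left; auto).
    rewrite <- Rabs_mult; unfold h; rewrite <- Series_scal_r.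
    apply Rabs_Series_le; auto; intros i.
    rewrite Rabs_mult, (Rabs_pos_eq ((INR n + 1) ^ p)) by (left; auto).
    unfold beta; destruct (le_dec p (i + 2)) as [L|L].
    + specialize (HwH i n p L); specialize (Hh0 i); lra.
    + rewrite Rabs_mult, (Rabs_pos_eq (w i)), Rmult_assoc by (left; auto).
      specialize (HK i p n); specialize (Hw0 i); specialize (Hh0 i); nra.
  - apply Rle_trans with (2 := Series_sq_inv_le).
    apply Series_le; auto; intros n; split; [apply Rabs_pos|].
    apply Rle_trans with (Series (fun i => gamma n * (/ 2) ^ S i)).
    + apply Rabs_Series_le; [intros i; rewrite (Rmult_comm (gamma n)); apply Hbg|].
      apply ex_series_Rscal, ex_series_half.
    + rewrite Series_scal_l; fold (gamma n).
      rewrite <- (Rmult_1_r (gamma n)) at 2.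
      apply Rmult_le_compat_l; [apply Hg0|apply ex_series_half].
  - intros r t Hr.
    assert (Sm := Hmult (fun n => cos (INR n * t) * r ^ n)).
    apply (is_series_ext _ (fun i => w i * Series (fun n => H i n * cos (INR n * t) * r ^ n))) in Sm.
    + replace (PSeries (cos_coeff h t) r) with (Series (fun n => h n * (cos (INR n * t) * r ^ n)))
        by (apply Series_ext; intros; unfold cos_coeff; ring).
      rewrite <- (is_series_unique _ _ Sm).
      apply Rle_trans with (sum_n
        (fun i => w i * Series (fun n => H i n * cos (INR n * t) * r ^ n)) 0).
      * apply sum_n_nonneg; intros i; apply Rmult_le_pos; [left; auto|apply HH; auto].
      * apply sum_n_le_Series; [|eexists; exact Sm].
        intros i; apply Rmult_le_pos; [left; auto|apply HH; auto].
    + intros i; f_equal; apply Series_ext; intros n; ring.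
    + intros n; rewrite Rabs_mult; pose proof (pow_le_1 r n ltac:(lra)).
      pose proof (Rabs_cos_le_1 (INR n * t)); pose proof (Rabs_pos (cos (INR n * t))).
      rewrite (Rabs_pos_eq (r ^ n)) by lra; nra.
  - intros t Ht; destruct (arc_exhausts (cos t) Ht) as [j Hj].
    apply Rlt_le_trans with (w j * bump 0 (-1 * cos t + arc j)).
    + apply Rmult_lt_0_compat; auto; apply bump_gt_0; lra.
    + rewrite <- (is_series_unique _ _ (HU t)).
      apply Rle_trans with (sum_n (fun i => w i * bump 0 (-1 * cos t + arc i)) j).
      * apply (sum_n_term_le (fun i => w i * bump 0 (-1 * cos t + arc i))); auto.
      * apply sum_n_le_Series; auto; eexists; apply HU.
  - intros t Ht; rewrite <- (is_series_unique _ _ (HU t)).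
    rewrite (Series_ext _ (fun _ => 0 * 0)); [rewrite Series_scal_l; ring|].
    intros i; rewrite bump_nonpos; [ring|]; pose proof (arc_lt_1 i); lra.
  - intros j t Ht; rewrite <- (is_series_unique _ _ (HU t)).
    apply Rle_trans with (Series (fun i => d j * (/ 2) ^ S i)).
    + apply Series_le; [|apply ex_series_Rscal, ex_series_half].
      intros i; split; auto.
      (* On the j-th arc the bumps with i <= j vanish, as arc i <= arc j. The others are at most 1
         and have weight at most 2^{-i-1} D i <= 2^{-i-1} d j. *)
      destruct (le_dec i j) as [L|L].
      * rewrite bump_nonpos; [rewrite Rmult_0_r; apply Rmult_le_pos; [left|]; auto|].
        pose proof (arc_mono i j L); lra.
      * pose proof (bump_bounded 0 (-1 * cos t + arc i)) as B; simpl in B.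
        pose proof (bump_ge_0 0 (-1 * cos t + arc i)).
        specialize (HwD i); specialize (HD i j ltac:(lia)); specialize (Hw0 i); specialize (Hh0 i).
        simpl pow in *; nra.
    + rewrite Series_scal_l; pose proof (proj2 ex_series_half) as B; specialize (Hd j).
      simpl in *; nra.
Qed.

(** * Passage to complex coefficients *)

Section Iteration.
Variable a : nat -> R.
Hypothesis Ha : ex_series (fun n => Rabs (a n)).
Let A := Series (fun n => Rabs (a n)).

Lemma l1_norm_ge_0 : 0 <= A.
Proof.
  apply Rle_trans with (sum_n (fun k => Rabs (a k)) 0);
    [apply sum_n_nonneg; intros; apply Rabs_pos|].
  apply sum_n_le_Series; auto; intros; apply Rabs_pos.
Qed.

Lemma l2_le_adjoint_iter (x : nat -> R) (M : R) (n : nat) : 0 <= M -> l2_le x M ->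
  l2_le (Nat.iter n (real_adjoint a) x) (A ^ n * M).
Proof.
  intros HM Hx; pose proof l1_norm_ge_0 as HA; induction n as [|n IH].
  - simpl; rewrite Rmult_1_l; auto.
  - simpl; rewrite Rmult_assoc; apply l2_le_real_adjoint; auto.
    apply Rmult_le_pos; auto; apply pow_le; auto.
Qed.

Lemma adjoint_iter_plus (x y : nat -> R) (M N : R) (n : nat) : 0 <= M -> 0 <= N ->
  l2_le x M -> l2_le y N ->
  Nat.iter n (real_adjoint a) (fun k => x k + y k)
  = (fun k => Nat.iter n (real_adjoint a) x k + Nat.iter n (real_adjoint a) y k).
Proof.
  intros HM HN Hx Hy; pose proof l1_norm_ge_0 as HA; induction n as [|n IH]; [reflexivity|].
  simpl; rewrite IH; apply functional_extensionality; intros k; unfold real_adjoint at 1.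
  set (u := Nat.iter n (real_adjoint a) x); set (v := Nat.iter n (real_adjoint a) y).
  pose proof (l2_le_adjoint_iter x M n HM Hx) as Hu; fold u in Hu.
  pose proof (l2_le_adjoint_iter y N n HN Hy) as Hv; fold v in Hv.
  assert (0 <= A ^ n) by (apply pow_le; auto).
  unfold real_adjoint; rewrite <- Series_plus.
  - apply Series_ext; intros; ring.
  - apply (ex_series_weighted a (fun j i => u (j + i)%nat) (A ^ n * M)); auto.
    + apply Rmult_le_pos; auto.
    + intros j; apply l2_le_shift; auto.
  - apply (ex_series_weighted a (fun j i => v (j + i)%nat) (A ^ n * N)); auto.
    + apply Rmult_le_pos; auto.
    + intros j; apply l2_le_shift; auto.
Qed.

Lemma real_adjoint_zero : real_adjoint a (fun _ => 0) = (fun _ => 0).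
Proof.
  apply functional_extensionality; intros k; unfold real_adjoint.
  rewrite (Series_ext _ (fun _ => 0 * 0)) by (intros; ring); rewrite Series_scal_l; ring.
Qed.
End Iteration.

(** The symbol has real coefficients, so its adjoint acts separately on the real and imaginary parts
    of a sequence. *)
Definition complex_adjoint (a : nat -> R) (f : nat -> C) (k : nat) : C :=
  (real_adjoint a (fun i => fst (f i)) k, real_adjoint a (fun i => snd (f i)) k).

Lemma complex_adjoint_iter (a x : nat -> R) (n : nat) :
  Nat.iter n (complex_adjoint a) (fun k => RtoC (x k))
  = fun k => RtoC (Nat.iter n (real_adjoint a) x k).
Proof.
  induction n as [|n IH]; [reflexivity|].
  simpl; rewrite IH; apply functional_extensionality; intros k.
  unfold complex_adjoint, RtoC; simpl; rewrite real_adjoint_zero; reflexivity.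
Qed.

Lemma Cmod_sqr (z : C) : Cmod z ^ 2 = fst z ^ 2 + snd z ^ 2.
Proof.
  unfold Cmod; rewrite pow2_sqrt; auto.
  pose proof (pow2_ge_0 (fst z)); pose proof (pow2_ge_0 (snd z)); lra.
Qed.

Lemma H2norm_real_le (x : nat -> R) (M : R) : 0 <= M -> l2_le x M ->
  H2norm (fun k => RtoC (x k)) <= M.
Proof.
  intros HM Hx; unfold H2norm.
  rewrite (Series_ext _ (fun k => x k ^ 2)).
  - rewrite <- (sqrt_pow2 M) by auto; apply sqrt_le_1_alt, l2_le_series; auto.
  - intros k; rewrite Cmod_R; apply pow2_abs.
Qed.

Lemma inH2_real (x : nat -> R) : ex_series (fun k => x k ^ 2) -> inH2 (fun k => RtoC (x k)).
Proof.
  apply ex_series_ext; intros k; rewrite Cmod_R; symmetry; apply pow2_abs.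
Qed.

Lemma inH2_components (f : nat -> C) : inH2 f <->
  exists M, 0 < M /\ l2_le (fun k => fst (f k)) M /\ l2_le (fun k => snd (f k)) M.
Proof.
  split.
  - intros H; set (T := sqrt (Series (fun k => Cmod (f k) ^ 2))).
    assert (HT : 0 <= T) by apply sqrt_pos.
    pose proof (series_l2_le (fun k => Cmod (f k)) H) as B; fold T in B.
    exists (T + 1); split; [lra|]; split;
      (apply l2_le_weaken with T; [lra|]; intros K; apply Rle_trans with (2 := B K);
       apply sum_n_le_compat; intros k _; rewrite Cmod_sqr;
       pose proof (pow2_ge_0 (fst (f k))); pose proof (pow2_ge_0 (snd (f k))); lra).
  - intros [M [_ [H1 H2]]].
    apply (ex_series_ext (fun k => fst (f k) ^ 2 + snd (f k) ^ 2)).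
    + intros k; symmetry; apply Cmod_sqr.
    + apply ex_series_Rplus; [apply (l2_le_series _ M H1)|apply (l2_le_series _ M H2)].
Qed.

Lemma fst_sum_n (u : nat -> C) (n : nat) : fst (sum_n u n) = sum_n (fun k => fst (u k)) n.
Proof.
  induction n as [|n IH]; [rewrite !sum_O; reflexivity|].
  rewrite !sum_Sn, <- IH; reflexivity.
Qed.

Lemma snd_sum_n (u : nat -> C) (n : nat) : snd (sum_n u n) = sum_n (fun k => snd (u k)) n.
Proof.
  induction n as [|n IH]; [rewrite !sum_O; reflexivity|].
  rewrite !sum_Sn, <- IH; reflexivity.
Qed.

Lemma toeplitz_components (a : nat -> R) (f : nat -> C) (j : nat) :
  toeplitz (fun k => RtoC (a k)) f j
  = (real_toeplitz a (fun k => fst (f k)) j, real_toeplitz a (fun k => snd (f k)) j).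
Proof.
  apply injective_projections; unfold toeplitz, real_toeplitz; cbn [fst snd].
  - rewrite fst_sum_n; apply sum_n_Rext; intros k; simpl; ring.
  - rewrite snd_sum_n; apply sum_n_Rext; intros k; simpl; ring.
Qed.

Lemma H2inner_components (f h : nat -> C) (M N : R) : 0 < M -> 0 < N ->
  l2_le (fun k => fst (f k)) M -> l2_le (fun k => snd (f k)) M ->
  l2_le (fun k => fst (h k)) N -> l2_le (fun k => snd (h k)) N ->
  H2inner f h =
  (pairing (fun k => fst (f k)) (fun k => fst (h k)) + pairing (fun k => snd (f k)) (fun k => snd (h k)),
   pairing (fun k => snd (f k)) (fun k => fst (h k)) - pairing (fun k => fst (f k)) (fun k => snd (h k))).
Proof.
  intros HM HN F1 F2 G1 G2; unfold H2inner, pairing.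
  rewrite <- Series_plus, <- Series_minus
    by (eapply pairing_bound; [exact HM|exact HN|auto|auto]).
  f_equal; apply Series_ext; intros k; simpl; ring.
Qed.

Lemma complex_adjoint_correct (a : nat -> R) : ex_series (fun n => Rabs (a n)) ->
  is_adjoint (toeplitz (fun k => RtoC (a k))) (complex_adjoint a).
Proof.
  intros Ha h Hh; apply inH2_components in Hh; destruct Hh as [N [HN [H1 H2]]].
  set (A := Series (fun n => Rabs (a n))).
  assert (HA : 0 <= A) by (apply l1_norm_ge_0; auto).
  assert (W : forall x M, 0 < M -> l2_le x M -> l2_le (real_adjoint a x) ((A + 1) * M) /\
    l2_le (real_toeplitz a x) ((A + 1) * M)).
  { intros x M HM Hx; split; apply l2_le_weaken with (A * M); try (split; nra).
    - apply l2_le_real_adjoint; auto; lra.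
    - apply l2_le_real_toeplitz; auto; lra. }
  split.
  - apply inH2_components; exists ((A + 1) * N); split; [nra|].
    split; simpl; apply W; auto.
  - intros f Hf; apply inH2_components in Hf; destruct Hf as [M [HM [F1 F2]]].
    rewrite (H2inner_components _ h ((A + 1) * M) N); try nra; auto.
    + rewrite (H2inner_components f _ M ((A + 1) * N)); try nra; auto.
      * assert (E1 : (fun k => fst (toeplitz (fun k => RtoC (a k)) f k))
          = real_toeplitz a (fun k => fst (f k))).
        { apply functional_extensionality; intros k; rewrite toeplitz_components; reflexivity. }
        assert (E2 : (fun k => snd (toeplitz (fun k => RtoC (a k)) f k))
          = real_toeplitz a (fun k => snd (f k))).
        { apply functional_extensionality; intros k; rewrite toeplitz_components; reflexivity. }
        rewrite E1, E2; unfold complex_adjoint; simpl.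
        rewrite !(real_adjoint_correct a _ _ M N) by auto; reflexivity.
      * simpl; apply W; auto.
      * simpl; apply W; auto.
    + apply (l2_le_ext (real_toeplitz a (fun k => fst (f k)))); [|apply W; auto].
      intros k; rewrite toeplitz_components; reflexivity.
    + apply (l2_le_ext (real_toeplitz a (fun k => snd (f k)))); [|apply W; auto].
      intros k; rewrite toeplitz_components; reflexivity.
Qed.

(** * Power series on the disk in polar coordinates and their boundary values *)

Definition polar (r t : R) : C := (r * cos t, r * sin t).

Lemma polar_exists (z : C) : in_disk z -> exists r t, 0 <= r < 1 /\ z = polar r t.
Proof.
  intros Hz; exists (Cmod z).
  assert (Hr : 0 <= Cmod z < 1) by (split; [apply Cmod_ge_0|exact Hz]).
  destruct (Req_dec (Cmod z) 0) as [H0|H0].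
  - exists 0; split; auto; apply Cmod_eq_0 in H0; rewrite H0; unfold polar.
    rewrite Cmod_0, !Rmult_0_l; reflexivity.
  - set (r := Cmod z) in *; set (x := fst z / r).
    assert (E : r ^ 2 = fst z ^ 2 + snd z ^ 2) by apply Cmod_sqr.
    assert (Ex : fst z = r * x) by (unfold x; field; auto).
    assert (Hx : -1 <= x <= 1).
    { pose proof (pow2_ge_0 (snd z)); rewrite Ex in E.
      assert (0 < r ^ 2) by (apply pow_lt; lra).
      assert (x ^ 2 <= 1) by (apply Rmult_le_reg_l with (r ^ 2); auto; nra).
      split; nra. }
    assert (Es : r * sqrt (1 - x²) = Rabs (snd z)).
    { rewrite <- (sqrt_Rsqr r) by lra; rewrite <- sqrt_mult_alt by apply Rle_0_sqr.
      rewrite <- sqrt_Rsqr_abs; f_equal; unfold Rsqr; rewrite Ex in E; nra. }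
    destruct (Rle_lt_dec 0 (snd z)) as [L|L].
    + exists (acos x); split; auto; unfold polar; rewrite cos_acos, sin_acos, Es by auto.
      rewrite (Rabs_pos_eq (snd z)), <- Ex by auto; apply surjective_pairing.
    + exists (- acos x); split; auto; unfold polar; rewrite cos_neg, sin_neg, cos_acos, sin_acos by auto.
      replace (r * - sqrt (1 - x²)) with (- (r * sqrt (1 - x²))) by ring.
      rewrite Es, Rabs_left, <- Ex, Ropp_involutive by auto; apply surjective_pairing.
Qed.

Lemma pow_n_polar (r t : R) (n : nat) :
  pow_n (K := C_Ring) (polar r t) n = (cos (INR n * t) * r ^ n, sin (INR n * t) * r ^ n).
Proof.
  induction n as [|n IH].
  - simpl; rewrite Rmult_0_l, cos_0, sin_0, Rmult_1_l, Rmult_0_l; reflexivity.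
  - simpl pow_n; rewrite IH; unfold mult; simpl; unfold Cmult, polar; simpl fst; simpl snd.
    change (match n with 0%nat => 1 | S _ => INR n + 1 end) with (INR (S n)).
    rewrite S_INR; replace ((INR n + 1) * t) with (INR n * t + t) by ring.
    rewrite cos_plus, sin_plus; f_equal; ring.
Qed.

(** Total on the plane: where a component series diverges, [Series] supplies a default value. *)
Definition disk_fun (a : nat -> R) (z : C) : C :=
  (Series (fun n => a n * fst (pow_n (K := C_Ring) z n)),
   Series (fun n => a n * snd (pow_n (K := C_Ring) z n))).

Lemma disk_fun_polar (a : nat -> R) (r t : R) :
  disk_fun a (polar r t) = (PSeries (cos_coeff a t) r, PSeries (sin_coeff a t) r).
Proof.
  unfold disk_fun, PSeries, cos_coeff, sin_coeff; f_equal; apply Series_ext; intros n;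
    rewrite pow_n_polar; simpl; ring.
Qed.

Lemma disk_fun_pseries (a : nat -> R) (z : C) : ex_series (fun n => Rabs (a n)) -> in_disk z ->
  is_pseries (fun k => RtoC (a k)) z (disk_fun a z).
Proof.
  intros Ha Hz; destruct (polar_exists z Hz) as [r [t [Hr ->]]].
  assert (H1 : is_series (fun n => a n * fst (pow_n (K := C_Ring) (polar r t) n))
    (fst (disk_fun a (polar r t)))).
  { apply Series_correct.
    apply (ex_series_ext (fun n => a n * cos (INR n * t) * r ^ n)).
    - intros n; rewrite pow_n_polar; simpl; ring.
    - apply ex_series_Rabs, ex_series_cos_pow; auto; lra. }
  assert (H2 : is_series (fun n => a n * snd (pow_n (K := C_Ring) (polar r t) n))
    (snd (disk_fun a (polar r t)))).
  { apply Series_correct.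
    apply (ex_series_dominated _ (fun n => Rabs (a n))); auto.
    intros n; apply Rabs_mult_le_l; rewrite pow_n_polar; simpl; rewrite Rabs_mult.
    pose proof (pow_le_1 r n ltac:(lra)); pose proof (Rabs_sin_le_1 (INR n * t)).
    pose proof (Rabs_pos (sin (INR n * t))); rewrite (Rabs_pos_eq (r ^ n)) by lra; nra. }
  unfold is_pseries.
  apply filterlim_locally; intros eps.
  pose proof (proj1 (filterlim_locally _ _) H1 eps) as [N1 B1].
  pose proof (proj1 (filterlim_locally _ _) H2 eps) as [N2 B2].
  exists (max N1 N2); intros n Hn; specialize (B1 n ltac:(lia)); specialize (B2 n ltac:(lia)).
  assert (E : sum_n (fun k => scal (pow_n (K := C_Ring) (polar r t) k) (RtoC (a k))) n
    = (sum_n (fun n => a n * fst (pow_n (K := C_Ring) (polar r t) n)) n,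
       sum_n (fun n => a n * snd (pow_n (K := C_Ring) (polar r t) n)) n)).
  { apply injective_projections; cbn [fst snd].
    - rewrite fst_sum_n; apply sum_n_Rext; intros k; unfold scal; simpl; ring.
    - rewrite snd_sum_n; apply sum_n_Rext; intros k; unfold scal; simpl; ring. }
  assert (B : @ball C_UniformSpace (disk_fun a (polar r t)) eps
    (sum_n (fun n => a n * fst (pow_n (K := C_Ring) (polar r t) n)) n,
     sum_n (fun n => a n * snd (pow_n (K := C_Ring) (polar r t) n)) n)) by (split; assumption).
  exact (eq_ind_r (fun w => @ball C_UniformSpace (disk_fun a (polar r t)) eps w) B E).
Qed.

Lemma Cmod_pair (x y M : R) : 0 <= M -> x ^ 2 + y ^ 2 = M ^ 2 -> Cmod (x, y) = M.
Proof. intros HM E; unfold Cmod; simpl fst; simpl snd; rewrite E; apply sqrt_pow2; auto. Qed.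

Lemma disk_fun_modulus (h : nat -> R) (r t : R) : ex_series (fun n => Rabs (h n)) -> 0 <= r < 1 ->
  Cmod (disk_fun (exp_coeff h) (polar r t)) = exp (PSeries (cos_coeff h t) r).
Proof.
  intros Hh Hr; rewrite disk_fun_polar.
  destruct (exp_coeff_disk h t r Hh Hr) as [-> ->].
  apply Cmod_pair; [left; apply exp_pos|].
  pose proof (sin2_cos2 (PSeries (sin_coeff h t) r)) as S2; unfold Rsqr in S2.
  transitivity (exp (PSeries (cos_coeff h t) r) ^ 2 *
    (sin (PSeries (sin_coeff h t) r) * sin (PSeries (sin_coeff h t) r) +
     cos (PSeries (sin_coeff h t) r) * cos (PSeries (sin_coeff h t) r))); [ring|rewrite S2; ring].
Qed.

Lemma disk_fun_boundary (a : nat -> R) : ex_series (fun n => Rabs (a n)) ->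
  boundary_fun (disk_fun a) (fun t => (Series (cos_coeff a t), Series (sin_coeff a t))).
Proof.
  intros Ha t; apply filterlim_locally; intros eps.
  assert (He : 0 < eps / 2) by (destruct eps; simpl; lra).
  destruct (abel_l1 _ (eps / 2) (ex_series_cos_coeff a t Ha) He) as [r1 [H1 B1]].
  destruct (abel_l1 _ (eps / 2) (ex_series_sin_coeff a t Ha) He) as [r2 [H2 B2]].
  assert (Hd : 0 < 1 - Rmax r1 r2) by (unfold Rmax; destruct (Rle_dec r1 r2); lra).
  exists (mkposreal _ Hd); intros r Hr Hr1.
  change (Rabs (r - 1) < 1 - Rmax r1 r2) in Hr; apply Rabs_lt_between in Hr.
  pose proof (Rmax_l r1 r2); pose proof (Rmax_r r1 r2).
  assert (E : Cmult (RtoC r) (expi t) = polar r t).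
  { unfold Cmult, polar, RtoC, expi; simpl; f_equal; ring. }
  rewrite E, disk_fun_polar; split; simpl.
  - apply Rle_lt_trans with (eps / 2); [apply B1; lra|lra].
  - apply Rle_lt_trans with (eps / 2); [apply B2; lra|lra].
Qed.

(** * Choice of the symbol and estimate of the orbit *)

Theorem theorem6p4 (q : R -> R)
  (hq_pos : forall x, 0 < x -> 0 < q x)
  (hq_incr : forall x y, 0 < x -> x <= y -> q x <= q y)
  (hq_lim : is_lim q p_infty p_infty) :
  exists (g : C -> C) (a : nat -> C) (gb : R -> C),
    Hinf_with_coeffs g a /\
    (forall z, in_disk z -> ~ in_disk (g z)) /\
    boundary_fun g gb /\
    smooth_RC gb /\
    (forall t : R, Cmod (gb t) = 1 <-> expi t = RtoC 1) /\
    exists (f : nat -> C) (Tstar : (nat -> C) -> (nat -> C)),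
      inH2 f /\ (exists k, f k <> RtoC 0) /\
      is_adjoint (toeplitz a) Tstar /\
      forall N : nat, exists n : nat, (N < n)%nat /\
        H2norm (Nat.iter n Tstar f) < q (INR n).
Proof.
  destruct (slow_vector q hq_lim) as [f [p [s [K [n [Hf0 [Hf2 [HS [Hn [HK HE]]]]]]]]]].
  assert (Hn0 : forall j, 0 < INR (n j)) by (intros j; apply lt_0_INR; specialize (Hn j); lia).
  (* On the j-th arc this gives |g| <= exp (1 / n_j), so that n_j applications cost a factor e. *)
  destruct (flat_symbol (fun j => / INR (n j))) as [h [Hrap [Hh1 [Hpos [Hlt [Heq Hflat]]]]]].
  { intros j; apply Rinv_0_lt_compat; auto. }
  pose proof (rapid_ex_series h Hrap) as Hh.
  destruct (exp_coeff_l1 h Hh) as [Ha Ha1].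
  set (a := exp_coeff h) in *.
  exists (disk_fun a), (fun k => RtoC (a k)),
    (fun t => (Series (cos_coeff a t), Series (sin_coeff a t))).
  assert (HcU : forall t r, 0 <= r < 1 ->
    PSeries (cos_coeff h t) r <= Series (fun k => Rabs (h k))).
  { intros t r Hr; eapply Rle_trans; [apply Rle_abs|].
    apply Rabs_Series_le; auto; intros k; unfold cos_coeff; rewrite Rmult_assoc.
    apply Rabs_mult_le_l; rewrite Rabs_mult.
    pose proof (pow_le_1 r k ltac:(lra)); pose proof (Rabs_cos_le_1 (INR k * t)).
    pose proof (Rabs_pos (cos (INR k * t))); rewrite (Rabs_pos_eq (r ^ k)) by lra; nra. }
  split; [split|split; [|split; [|split; [|split]]]].
  - intros z Hz; apply disk_fun_pseries; auto.
  - exists (exp 1); intros z Hz; destruct (polar_exists z Hz) as [r [t [Hr ->]]].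
    unfold a; rewrite disk_fun_modulus by auto; specialize (HcU t r Hr).
    assert (L : PSeries (cos_coeff h t) r <= 1) by lra.
    destruct L as [L|L]; [left; apply exp_increasing; auto|rewrite L; lra].
  - intros z Hz; destruct (polar_exists z Hz) as [r [t [Hr ->]]].
    unfold in_disk, a; rewrite disk_fun_modulus by auto; specialize (Hpos r t Hr).
    pose proof (exp_ge_1_plus (PSeries (cos_coeff h t) r)); lra.
  - apply disk_fun_boundary; auto.
  - intros m t; split; apply Ck_ex_derive_n; [apply (Ck_exp_circle h m Hrap)|apply (Ck_exp_circle h m Hrap)].
  - intros t; rewrite (Cmod_pair _ _ (exp (Series (cos_coeff h t))));
      [|left; apply exp_pos|apply exp_circle_modulus; auto]; split.
    + intros E; assert (Hc : cos t = 1).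
      { pose proof (COS_bound t) as B; destruct (Req_dec (cos t) 1) as [C1|C1]; auto.
        pose proof (Hlt t ltac:(lra)) as L; apply exp_increasing in L.
        rewrite exp_0 in L; lra. }
      pose proof (sin2_cos2 t) as S2; rewrite Hc in S2; unfold Rsqr in S2.
      unfold expi, RtoC; rewrite Hc; f_equal; nra.
    + intros E; unfold expi, RtoC in E; injection E as Ec Es.
      rewrite Heq by auto; apply exp_0.
  - exists (fun k => RtoC (f k)), (complex_adjoint a).
    split; [apply inH2_real; auto|split; [|split; [apply complex_adjoint_correct; auto|]]].
    + exists 0%nat; intros E; apply Hf0; injection E; auto.
    (* Step N of the construction supplies the time n_N, and n_N > N makes these times unbounded. *)
    + intros N; exists (n N); split; [apply Hn|].
      rewrite complex_adjoint_iter.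
      apply Rle_lt_trans with (2 := HK N).
      destruct (HS N) as [HK0 Cp Cs HB HZ].
      set (x := fourier (p N) (s N)).
      (* The projection of the N-th density contributes at most e K_N, the remainder at most 1. *)
      assert (Ef : f = fun k => x k + (f k - x k))
        by (apply functional_extensionality; intros; ring).
      pose proof (exp_pos 1) as He1; pose proof (exp_pos (- INR (n N))) as HeN.
      assert (Hx : l2_le x (K N)) by (apply bessel; auto).
      rewrite Ef, (adjoint_iter_plus a Ha x _ (K N) (exp (- INR (n N))) _ HK0 (Rlt_le _ _ HeN)
        Hx (HE N)).
      assert (HeK : 0 <= exp 1 * K N) by (apply Rmult_le_pos; lra).
      apply H2norm_real_le; [lra|].
      apply l2_le_plus; try lra.
      * replace (exp 1) with (exp (/ INR (n N)) ^ n N).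
        -- apply (real_adjoint_iter_supported h (arc N)); auto; intros t Ht; apply Hflat; auto.
        -- rewrite <- exp_INR_mult; f_equal; field; specialize (Hn0 N); lra.
      * assert (HA0 := l1_norm_ge_0 a Ha).
        (* The l1 norm of [a] is at most e, so the growth e^{n_N} of the remainder is cancelled by
           its initial size e^{-n_N}. *)
        apply l2_le_weaken with (Series (fun k => Rabs (a k)) ^ n N * exp (- INR (n N))).
        -- split; [apply Rmult_le_pos; [apply pow_le; auto|lra]|].
           apply Rle_trans with (exp 1 ^ n N * exp (- INR (n N))).
           ++ apply Rmult_le_compat_r; [lra|]; apply pow_incr; split; auto.
              apply Rle_trans with (1 := Ha1).
              destruct Hh1 as [L|L]; [left; apply exp_increasing; auto|rewrite L; lra].
           ++ rewrite <- exp_INR_mult, Rmult_1_r, <- exp_plus, Rplus_opp_r, exp_0; lra.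
        -- apply l2_le_adjoint_iter; [exact Ha|lra|exact (HE N)].
Qed.
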